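(* Let $k\in\mathbb{C}$ with $\Re(k)>0$, $\Im(k)\ge 0$, let $\alpha\in\mathbb{C}$ with $\Re(\alpha)\ge 0$, let $M_0>0$ and let $\Gamma_0=\{(x,0): -M_0<x<M_0\}$. Let $g\in C^{0,\beta}(\Gamma_0)$ be a Hölder continuous function on $\Gamma_0$ with exponent $\beta>0$. Then there exists a unique solution $\sigma\in C(\Gamma_0)$ of the integral equation $$-\frac12\,\sigma+ik\alpha\,S_{\Gamma_0}[\sigma]=g\qquad\text{on }\Gamma_0 .$$
   Context: $S_{\Gamma_0}$ is the Helmholtz single layer operator on the segment: $S_{\Gamma_0}[\sigma](\boldsymbol{x})=\int_{-M_0}^{M_0}\frac{i}{4}H_0^{(1)}(k|\boldsymbol{x}-(x',0)|)\,\sigma(x')\,dx'$, where $H_0^{(1)}$ is the Hankel function of the first kind of order zero. $C(\Gamma_0)$ is the Banach space of continuous functions on the segment with the supremum norm (functions continuous up to the endpoints, i.e. $C([-M_0,M_0])$), on which $S_{\Gamma_0}$ acts as an operator into itself; a Hölder continuous $g$ extends continuously to the endpoints. *)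

(* Defs.v *)
From mathcomp Require Import all_boot all_order all_algebra.
From mathcomp Require Import complex.
From mathcomp Require Import all_classical all_reals all_analysis.

Set Implicit Arguments.
Unset Strict Implicit.
Unset Printing Implicit Defensive.

Import Order.TTheory GRing.Theory Num.Theory numFieldNormedType.Exports.
Import ComplexField.Normc.

Local Open Scope classical_set_scope.
Local Open Scope ring_scope.
Local Open Scope complex_scope.

(* [R[i]^o] is [R[i]] with the topology of its modulus; [R[i]] alone carries
   no canonical topology. *)

(* Principal branch, with values in ]-pi, pi] for z <> 0. *)
Definition carg (R : realType) (z : R[i]) : R :=
  if 0 <= complex.Im z then acos (complex.Re z / normc z)
  else - acos (complex.Re z / normc z).

Definition clog (R : realType) (z : R[i]) : R[i] := ln (normc z) +i* carg z.

(* [series harmonic n] is the n-th harmonic number 1 + 1/2 + ... + 1/n. *)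
Definition euler_gamma (R : realType) : R :=
  limn (fun n : nat => series (@harmonic R) n - ln n%:R).

Definition besselJ0 (R : realType) (z : R[i]) : R[i] :=
  limn (series (fun m : nat =>
    (-1) ^+ m * (z / 2) ^+ (2 * m) / (m`!%:R) ^+ 2 : R[i]^o)).

(* Standard series of the Bessel function of the second kind,
     Y_0(z) = 2/pi * ((log (z/2) + gamma) * J_0(z)
                       + sum_(m >= 1) (-1)^(m+1) H_m (z/2)^(2m) / m!^2),
   where H_m is the m-th harmonic number; the term m = 0 vanishes. *)
Definition besselY0 (R : realType) (z : R[i]) : R[i] :=
  (2 / pi)%:C *
  ((clog (z / 2) + (euler_gamma R)%:C) * besselJ0 z +
   limn (series (fun m : nat =>
     (-1) ^+ m.+1 * (series (@harmonic R) m)%:C * (z / 2) ^+ (2 * m) /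
     (m`!%:R) ^+ 2 : R[i]^o))).

Definition hankel1_0 (R : realType) (z : R[i]) : R[i] :=
  besselJ0 z + 'i%C * besselY0 z.

Definition cintegral (R : realType) (D : set R) (f : R -> R[i]) : R[i] :=
  Rintegral lebesgue_measure D (fun x => complex.Re (f x)) +i*
  Rintegral lebesgue_measure D (fun x => complex.Im (f x)).

Definition dist2 (R : realType) (p q : R * R) : R :=
  Num.sqrt ((p.1 - q.1) ^+ 2 + (p.2 - q.2) ^+ 2).

(* A density on the segment {(x, 0) : -M0 < x < M0} is encoded as a function
   of the abscissa x. The value of [hankel1_0] at 0 is meaningless, but it only
   enters the integral at the single point x' with (x', 0) = p. *)
Definition single_layer (R : realType) (k : R[i]) (M0 : R)
    (sigma : R -> R[i]) (p : R * R) : R[i] :=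
  cintegral `[- M0, M0] (fun x' : R =>
    'i%C / 4 * hankel1_0 (k * (dist2 p (x', 0))%:C) * sigma x').

Definition holder_on_segment (R : realType) (M0 beta : R) (g : R -> R[i]) :=
  exists L : R, forall x y : R, - M0 < x < M0 -> - M0 < y < M0 ->
    normc (g x - g y) <= L * `|x - y| `^ beta.

(* The density space is C([-M0, M0]), whereas the equation is posed on the open
   segment; by continuity it then holds at the endpoints too. *)
Definition continuous_solution (R : realType) (k alpha : R[i]) (M0 : R)
    (g sigma : R -> R[i]) : Prop :=
  {within `[- M0, M0], continuous (sigma : R -> R[i]^o)} /\
  forall x : R, - M0 < x < M0 ->
    - (1 / 2) * sigma x + 'i%C * k * alpha * single_layer k M0 sigma (x, 0) = g x.

(* Main.v *)
(* The kernel satisfies |K(x, y)| <= C |x - y|^(-1/2), with a matching Hoelder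
   estimate, so the single layer operator is a small operator plus a finite
   rank one (its sampling on a fine mesh), and the Fredholm alternative reduces
   existence to uniqueness.

   For uniqueness, use the superposition of exponentials
     pi/2 H_0(k r) = int_0^(pi/2) e^(i k r cos t) dt
                     - i int_0^oo e^(-k r s) / sqrt (1 + s^2) ds.
   For a single exponential, f(x) = int e^(-a |x - y|) sigma(y) dy satisfies
   f' = a q and q' = a f - 2 sigma with q = - f at M and q = f at - M, whence
     2 int f conj(sigma) = conj(a) int |f|^2 + a int |q|^2
                           + |f(M)|^2 + |f(-M)|^2.
   Applied with a = - i k cos t (weighted by k) and a = k s (weighted by - i k)
   it shows Re (k <H sigma, sigma>) >= c int_0^(pi/2) |f_t(M)|^2 dt. The
   homogeneous equation makes the left-hand side nonpositive when
   Re alpha >= 0, so int e^(i k cos t (M - y)) sigma(y) dy = 0 for all t;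
   differentiating in t, every moment of e^(i k cos t (M - y)) sigma(y)
   vanishes, and sigma = 0.

   The superposition formula holds because both sides solve Bessel's equation
   with the same leading behaviour at r = 0; for the right-hand side Euler's
   constant enters through
     gamma = int_0^(1/r) (1 - e^(-r s)) / s ds - int_(1/r)^oo e^(-r s) / s ds. *)
Require Import Defs.
From HB Require Import structures.
From mathcomp Require Import all_boot all_order all_algebra.
From mathcomp Require Import complex.
From mathcomp Require Import all_classical all_reals all_analysis.
From mathcomp Require Import measurable_realfun ring lra.

Set Implicit Arguments.
Unset Strict Implicit.
Unset Printing Implicit Defensive.

Import Order.TTheory GRing.Theory Num.Theory numFieldNormedType.Exports.
Import ComplexField.Normc.

Local Open Scope classical_set_scope.
Local Open Scope ring_scope.
Local Open Scope complex_scope.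

(** * Componentwise calculus of complex-valued functions *)

(** Real k is allowed. Then a weighted square has coefficient Re (c a) = 0 for both families of
    exponentials, so the energy identity is not coercive: only the boundary term at M survives, and
    uniqueness has to be extracted from it through moments.

    Any power |x - y|^(-s) with 0 < s < 1 dominates the logarithm. The choice s = 1/2 lets one
    estimate, sqrt |a - b| (1 / sqrt a + 1 / sqrt b), carry both the Hoelder factor and the
    integrable singularity.

    Sampling on a mesh produces step functions, so the Fredholm argument runs on bounded measurable
    functions. The layer operator sends these to continuous functions, and this makes both solutions
    and null vectors continuous afterwards.

    The parameter alpha may vanish, in which case the equation is trivial; otherwise one divides by
    it, and Re alpha >= 0 enters as Re (1 / alpha) >= 0.

    Limits, derivatives and integrals are taken on real and imaginary parts; the modulus topology of
    the statement is met only when the Bessel series are summed and when continuity of a density is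
    translated. *)

Section ComplexParts.
Variable R : realType.
Local Notation C := R[i].
Implicit Types z w : C.

Lemma cReD z w : complex.Re (z + w) = complex.Re z + complex.Re w.
Proof. by case: z; case: w. Qed.
Lemma cImD z w : complex.Im (z + w) = complex.Im z + complex.Im w.
Proof. by case: z; case: w. Qed.
Lemma cReN z : complex.Re (- z) = - complex.Re z.
Proof. by case: z. Qed.
Lemma cImN z : complex.Im (- z) = - complex.Im z.
Proof. by case: z. Qed.
Lemma cReM z w : complex.Re (z * w) =
  complex.Re z * complex.Re w - complex.Im z * complex.Im w.
Proof. by case: z; case: w. Qed.
Lemma cImM z w : complex.Im (z * w) =
  complex.Re z * complex.Im w + complex.Im z * complex.Re w.
Proof. by case: z; case: w. Qed.
Lemma cReB z w : complex.Re (z - w) = complex.Re z - complex.Re w.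
Proof. by rewrite cReD cReN. Qed.
Lemma cImB z w : complex.Im (z - w) = complex.Im z - complex.Im w.
Proof. by rewrite cImD cImN. Qed.

Lemma cRe_sum (I : Type) (s : seq I) (P : pred I) (F : I -> C) :
  complex.Re (\sum_(i <- s | P i) F i) = \sum_(i <- s | P i) complex.Re (F i).
Proof. by apply: (big_morph (@complex.Re R) cReD). Qed.
Lemma cIm_sum (I : Type) (s : seq I) (P : pred I) (F : I -> C) :
  complex.Im (\sum_(i <- s | P i) F i) = \sum_(i <- s | P i) complex.Im (F i).
Proof. by apply: (big_morph (@complex.Im R) cImD). Qed.

Lemma complexP z w :
  complex.Re z = complex.Re w -> complex.Im z = complex.Im w -> z = w.
Proof. by case: z => a b; case: w => c d /= -> ->. Qed.

(** Equivalent to the modulus, but it splits over the real and imaginary parts, so the triangle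
    inequality for integrals follows from the real one with constant 1. *)
Definition norm1 z : R := `|complex.Re z| + `|complex.Im z|.

Lemma norm1_ge0 z : 0 <= norm1 z.
Proof. by rewrite addr_ge0. Qed.

Lemma norm1_0 : norm1 0 = 0.
Proof. by rewrite /norm1 /= normr0 addr0. Qed.

Lemma norm1_eq0 z : norm1 z = 0 -> z = 0.
Proof.
move=> /eqP; rewrite paddr_eq0// !normr_eq0 => /andP[/eqP a /eqP b].
exact: complexP.
Qed.

Lemma norm1D z w : norm1 (z + w) <= norm1 z + norm1 w.
Proof.
rewrite /norm1 cReD cImD addrACA; apply: lerD; exact: ler_normD.
Qed.

Lemma norm1N z : norm1 (- z) = norm1 z.
Proof. by rewrite /norm1 cReN cImN !normrN. Qed.

Lemma norm1B z w : norm1 (z - w) <= norm1 z + norm1 w.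
Proof. by rewrite -(norm1N w) norm1D. Qed.

Lemma norm1C z w : norm1 (z - w) = norm1 (w - z).
Proof. by rewrite -norm1N opprB. Qed.

Lemma norm1M z w : norm1 (z * w) <= norm1 z * norm1 w.
Proof.
rewrite /norm1 cReM cImM mulrDl !mulrDr -!normrM.
apply: (le_trans (lerD (ler_normB _ _) (ler_normD _ _))); lra.
Qed.

Lemma norm1_real (x : R) : norm1 x%:C = `|x|.
Proof. by rewrite /norm1 /= normr0 addr0. Qed.

Lemma norm1_realM (x : R) z : norm1 (x%:C * z) = `|x| * norm1 z.
Proof. by rewrite /norm1 cReM cImM /= !mul0r subr0 addr0 !normrM mulrDr. Qed.

Lemma norm1_i : norm1 'i%C = 1.
Proof. by rewrite /norm1 /= normr0 normr1 add0r. Qed.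

Lemma Re_norm1 z : `|complex.Re z| <= norm1 z.
Proof. by rewrite lerDl. Qed.
Lemma Im_norm1 z : `|complex.Im z| <= norm1 z.
Proof. by rewrite lerDr. Qed.

Lemma Re_le_normc z : `|complex.Re z| <= normc z.
Proof.
by case: z => a b /=; rewrite -sqrtr_sqr ler_wsqrtr// lerDl sqr_ge0.
Qed.
Lemma Im_le_normc z : `|complex.Im z| <= normc z.
Proof.
by case: z => a b /=; rewrite -sqrtr_sqr ler_wsqrtr// lerDr sqr_ge0.
Qed.
Lemma normc_le_norm1 z : normc z <= norm1 z.
Proof.
case: z => a b /=; rewrite /norm1/=.
rewrite -(@ler_pXn2r _ 2)// ?nnegrE ?sqrtr_ge0 ?addr_ge0//.
rewrite sqr_sqrtr ?addr_ge0 ?sqr_ge0// sqrrD !real_normK ?num_real//.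
have : 0 <= `|a| * `|b| by rewrite mulr_ge0.
lra.
Qed.

Lemma norm1_le_eps z : (forall e, 0 < e -> norm1 z <= e) -> z = 0.
Proof.
move=> h; apply: norm1_eq0; apply/eqP; rewrite eq_le norm1_ge0 andbT.
by apply/ler_addgt0Pr => e e0; rewrite add0r h.
Qed.

End ComplexParts.

(** * Integrals of complex-valued functions *)

Section ComplexIntegral.
Context d (T : measurableType d) (R : realType).
Local Notation C := R[i].
Variable mu : {measure set T -> \bar R}.
Implicit Types (D : set T) (f g : T -> C).

Definition cmeasurable D f := measurable_fun D (fun x => complex.Re (f x)) /\
  measurable_fun D (fun x => complex.Im (f x)).

Definition cintegrable D f :=
  mu.-integrable D (fun x => (complex.Re (f x))%:E) /\
  mu.-integrable D (fun x => (complex.Im (f x))%:E).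

(** Extends [cintegral] to an arbitrary measure; for the Lebesgue measure the two are
    convertible. *)
Definition cint D f : C := Rintegral mu D (fun x => complex.Re (f x)) +i*
  Rintegral mu D (fun x => complex.Im (f x)).

Lemma cmeasurable_cst D (c : C) : cmeasurable D (fun=> c).
Proof. by split; exact: measurable_cst. Qed.

Lemma cmeasurableD D f g : cmeasurable D f -> cmeasurable D g ->
  cmeasurable D (fun x => f x + g x).
Proof.
move=> [f1 f2] [g1 g2]; split.
- by under eq_fun do rewrite cReD; exact: measurable_funD.
- by under eq_fun do rewrite cImD; exact: measurable_funD.
Qed.

Lemma cmeasurableM D f g : cmeasurable D f -> cmeasurable D g ->
  cmeasurable D (fun x => f x * g x).
Proof.
move=> [f1 f2] [g1 g2]; split.
- under eq_fun do rewrite cReM.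
  by apply: measurable_funB; exact: measurable_funM.
- under eq_fun do rewrite cImM.
  by apply: measurable_funD; exact: measurable_funM.
Qed.

Lemma cmeasurableB D f g : cmeasurable D f -> cmeasurable D g ->
  cmeasurable D (fun x => f x - g x).
Proof.
move=> [f1 f2] [g1 g2]; split.
- by under eq_fun do rewrite cReB; exact: measurable_funB.
- by under eq_fun do rewrite cImB; exact: measurable_funB.
Qed.

Lemma cmeasurable_real D (u : T -> R) : measurable_fun D u ->
  cmeasurable D (fun x => (u x)%:C).
Proof. by move=> mu'; split => //=; exact: measurable_cst. Qed.

Lemma measurable_norm1 D f : cmeasurable D f ->
  measurable_fun D (fun x => norm1 (f x)).
Proof.
by move=> [f1 f2]; apply: measurable_funD; apply: measurableT_comp.
Qed.

Lemma cintegrable_measurable D f : cintegrable D f -> cmeasurable D f.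
Proof.
by move=> [f1 f2]; split; apply/measurable_EFinP; exact: (measurable_int mu).
Qed.

Lemma integrable_norm1 D f : measurable D -> cintegrable D f ->
  mu.-integrable D (fun x => (norm1 (f x))%:E).
Proof.
move=> mD [f1 f2].
under eq_fun do rewrite EFinD.
by apply: integrableD => //; exact: integrable_norm.
Qed.

Lemma cintegrable_le D f (u : T -> R) : measurable D -> cmeasurable D f ->
  mu.-integrable D (fun x => (u x)%:E) ->
  (forall x, D x -> norm1 (f x) <= u x) -> cintegrable D f.
Proof.
move=> mD [f1 f2] iu fu; split.
- apply: (le_integrable mD _ _ iu); first exact/measurable_EFinP.
  move=> x Dx /=; rewrite lee_fin (le_trans (Re_norm1 _))//.
  by rewrite (le_trans (fu _ Dx))// ler_norm.
- apply: (le_integrable mD _ _ iu); first exact/measurable_EFinP.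
  move=> x Dx /=; rewrite lee_fin (le_trans (Im_norm1 _))//.
  by rewrite (le_trans (fu _ Dx))// ler_norm.
Qed.

Lemma cintegrableD D f g : measurable D -> cintegrable D f -> cintegrable D g ->
  cintegrable D (fun x => f x + g x).
Proof.
move=> mD [f1 f2] [g1 g2]; split.
- by under eq_fun do rewrite cReD EFinD; exact: integrableD.
- by under eq_fun do rewrite cImD EFinD; exact: integrableD.
Qed.

Lemma integrableZ_fin D (c : R) (u : T -> R) : measurable D ->
  mu.-integrable D (fun x => (u x)%:E) ->
  mu.-integrable D (fun x => (c * u x)%:E).
Proof.
by move=> mD iu; under eq_fun do rewrite EFinM; apply: integrableZl.
Qed.

Lemma cintegrableZ D (c : C) f : measurable D -> cintegrable D f ->
  cintegrable D (fun x => c * f x).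
Proof.
move=> mD If; apply: (@cintegrable_le _ _ (fun x => norm1 c * norm1 (f x))) => //.
- by apply: cmeasurableM; [exact: cmeasurable_cst|exact: cintegrable_measurable].
- by apply: integrableZ_fin => //; exact: integrable_norm1.
- by move=> x _; exact: norm1M.
Qed.

Lemma cintegrableMr D f g (b : R) : measurable D -> cintegrable D f ->
  cmeasurable D g -> (forall x, D x -> norm1 (g x) <= b) ->
  cintegrable D (fun x => f x * g x).
Proof.
move=> mD If mg gb.
apply: (@cintegrable_le _ _ (fun x => b * norm1 (f x))) => //.
- by apply: cmeasurableM => //; exact: cintegrable_measurable.
- by apply: integrableZ_fin => //; exact: integrable_norm1.
- move=> x Dx; rewrite (le_trans (norm1M _ _))// mulrC ler_wpM2r ?norm1_ge0//.
  exact: gb.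
Qed.

Lemma cintegrableB D f g : measurable D -> cintegrable D f -> cintegrable D g ->
  cintegrable D (fun x => f x - g x).
Proof.
move=> mD [f1 f2] [g1 g2]; split.
- by under eq_fun do rewrite cReB EFinB; exact: integrableB.
- by under eq_fun do rewrite cImB EFinB; exact: integrableB.
Qed.

Lemma cintegrable_sum D (I : Type) (s : seq I) (F : I -> T -> C) :
  measurable D -> (forall i, cintegrable D (F i)) ->
  cintegrable D (fun x => \sum_(i <- s) F i x).
Proof.
move=> mD mF; elim: s => [|i s ih].
  under eq_fun do rewrite big_nil.
  by split; exact: integrable0.
by under eq_fun do rewrite big_cons; exact: cintegrableD.
Qed.

Lemma eq_cint D f g : {in D, f =1 g} -> cint D f = cint D g.
Proof.
by move=> fg; rewrite /cint; congr (_ +i* _); apply: eq_Rintegral => x xD;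
  rewrite fg.
Qed.

Lemma cintD D f g : measurable D -> cintegrable D f -> cintegrable D g ->
  cint D (fun x => f x + g x) = cint D f + cint D g.
Proof.
move=> mD [f1 f2] [g1 g2]; apply: complexP; rewrite ?cReD ?cImD /=.
- by under eq_Rintegral do rewrite cReD; exact: RintegralD.
- by under eq_Rintegral do rewrite cImD; exact: RintegralD.
Qed.

Lemma cintB D f g : measurable D -> cintegrable D f -> cintegrable D g ->
  cint D (fun x => f x - g x) = cint D f - cint D g.
Proof.
move=> mD [f1 f2] [g1 g2]; apply: complexP; rewrite ?cReB ?cImB /=.
- by under eq_Rintegral do rewrite cReB; exact: RintegralB.
- by under eq_Rintegral do rewrite cImB; exact: RintegralB.
Qed.

Lemma cintZ D (c : C) f : measurable D -> cintegrable D f ->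
  cint D (fun x => c * f x) = c * cint D f.
Proof.
move=> mD [f1 f2]; apply: complexP; rewrite ?cReM ?cImM /=.
- under eq_Rintegral do rewrite cReM.
  rewrite RintegralB ?RintegralZl//; exact: integrableZ_fin.
- under eq_Rintegral do rewrite cImM.
  rewrite RintegralD ?RintegralZl//; exact: integrableZ_fin.
Qed.

Lemma cint0 D : cint D (fun=> 0) = 0.
Proof.
by apply: complexP; rewrite /= Rintegral_mkcond /Rintegral integral0_eq// => x _;
  rewrite /patch; case: ifP.
Qed.

Lemma cint_sum D (I : Type) (s : seq I) (F : I -> T -> C) :
  measurable D -> (forall i, cintegrable D (F i)) ->
  cint D (fun x => \sum_(i <- s) F i x) = \sum_(i <- s) cint D (F i).
Proof.
move=> mD iF; elim: s => [|i s ih].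
  by under eq_cint do rewrite big_nil; rewrite big_nil cint0.
under eq_cint do rewrite big_cons.
by rewrite big_cons cintD// ?ih//; exact: cintegrable_sum.
Qed.

Lemma norm1_cint D f : measurable D -> cintegrable D f ->
  norm1 (cint D f) <= Rintegral mu D (fun x => norm1 (f x)).
Proof.
move=> mD [f1 f2].
rewrite /norm1 RintegralD//=; last 2 first.
  exact: integrable_norm.
  exact: integrable_norm.
by apply: lerD; exact: le_normr_Rintegral.
Qed.

Lemma norm1_cint_le D f (u : T -> R) : measurable D -> cintegrable D f ->
  mu.-integrable D (fun x => (u x)%:E) ->
  (forall x, D x -> norm1 (f x) <= u x) ->
  norm1 (cint D f) <= Rintegral mu D u.
Proof.
move=> mD If Iu fu; apply: (le_trans (norm1_cint mD If)).
by apply: le_Rintegral => //; exact: integrable_norm1.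
Qed.

End ComplexIntegral.

(** * Derivative rules on explicit abstractions *)

Section RealDerive.
Variable R : realType.
Implicit Types (f g : R -> R) (x a b : R).

Lemma isd_add f g x a b : is_derive x 1 f a -> is_derive x 1 g b ->
  is_derive x 1 (fun y => f y + g y) (a + b).
Proof. by move=> hf hg; exact: is_deriveD. Qed.
Lemma isd_sub f g x a b : is_derive x 1 f a -> is_derive x 1 g b ->
  is_derive x 1 (fun y => f y - g y) (a - b).
Proof. by move=> hf hg; exact: is_deriveB. Qed.
Lemma isd_mul f g x a b : is_derive x 1 f a -> is_derive x 1 g b ->
  is_derive x 1 (fun y => f y * g y) (a * g x + f x * b).
Proof.
move=> hf hg; apply: is_derive_eq (is_deriveM hf hg) _.
by rewrite /GRing.scale/= addrC mulrC (mulrC a) mulrC.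
Qed.
Lemma isd_comp f g x a b : is_derive (g x) 1 f a -> is_derive x 1 g b ->
  is_derive x 1 (fun y => f (g y)) (b * a).
Proof. by move=> hf hg; have := is_derive1_comp hf hg; rewrite mulrC. Qed.
Lemma isd_cst (c : R) x : is_derive x 1 (fun=> c) 0.
Proof. exact: is_derive_cst. Qed.
Lemma isd_id (x : R) : is_derive x 1 (fun y => y) 1.
Proof. exact: is_derive_id. Qed.
Lemma isd_cont f x a : is_derive x 1 f a -> {for x, continuous f}.
Proof.
by move=> [h _]; apply/differentiable_continuous; rewrite -derivable1_diffP.
Qed.

End RealDerive.

(** * Mean values, antiderivatives and dominated convergence on the line *)

Section RealCalculus.
Variable R : realType.
Implicit Types (f F : R -> R) (a b : R).
Local Notation mu := (@lebesgue_measure R).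

Lemma within_itv_cont f a b : (forall x, a <= x <= b -> {for x, continuous f}) ->
  {within `[a, b], continuous f}.
Proof.
move=> cf; apply: continuous_in_subspaceT => x; rewrite inE/= in_itv/=.
exact: cf.
Qed.

Lemma mvt_le f (f' : R -> R) a b (B : R) : a <= b ->
  (forall x, a <= x <= b -> is_derive x 1 f (f' x)) ->
  (forall x, a <= x <= b -> `|f' x| <= B) -> `|f b - f a| <= B * (b - a).
Proof.
move=> ab df fB.
have [||c] := MVT_segment (f := f) (df := f') ab.
- by move=> x; rewrite in_itv/= => /andP[/ltW ax /ltW xb]; apply: df; rewrite ax.
- by apply: within_itv_cont => x /df; exact: isd_cont.
rewrite in_itv/= => /fB cB ->; rewrite normrM (ger0_norm (_ : 0 <= b - a)) ?subr_ge0//.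
by rewrite ler_wpM2r ?subr_ge0.
Qed.

Lemma continuous_itv_integrable f a b :
  (forall x, a <= x <= b -> {for x, continuous f}) ->
  mu.-integrable `[a, b] (fun x => (f x)%:E).
Proof.
move=> cf; apply: continuous_compact_integrable; first exact: segment_compact.
exact: within_itv_cont.
Qed.

Lemma ftc_itv F f a b : a <= b ->
  (forall x, a <= x <= b -> is_derive x 1 F (f x)) ->
  (forall x, a <= x <= b -> {for x, continuous f}) ->
  Rintegral mu `[a, b] f = F b - F a.
Proof.
rewrite le_eqVlt => /predU1P[<- _ _|ab dF cf].
  by rewrite set_itv1 Rintegral_set1 subrr.
rewrite /Rintegral (continuous_FTC2 ab (F := F)) //.
- exact: within_itv_cont.
- split.
  + move=> x; rewrite in_itv/= => /andP[/ltW ax /ltW xb].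
    by have [] : is_derive x 1 F (f x) by apply: dF; rewrite ax.
  + by apply: cvg_at_right_filter; apply: (isd_cont (dF _ _)); rewrite lexx ltW.
  + by apply: cvg_at_left_filter; apply: (isd_cont (dF _ _)); rewrite lexx ltW.
- move=> x; rewrite in_itv/= => /andP[/ltW ax /ltW xb].
  by rewrite derive1E; have [] : is_derive x 1 F (f x) by apply: dF; rewrite ax.
Qed.

Lemma dominated_integrable d (T : measurableType d) (nu : {measure set T -> \bar R})
    (D : set T) (f_ : nat -> T -> R) (f g : T -> R) : measurable D ->
  (forall n, measurable_fun D (f_ n)) ->
  (forall x, D x -> f_ n x @[n --> \oo] --> f x) ->
  nu.-integrable D (fun x => (g x)%:E) ->
  (forall n x, D x -> `|f_ n x| <= g x) ->
  nu.-integrable D (fun x => (f x)%:E).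
Proof.
move=> mD mf ff ig fg.
have mflim : measurable_fun D f by apply: measurable_fun_cvg mf ff.
apply: (le_integrable mD _ _ ig); first exact/measurable_EFinP.
move=> x Dx /=; rewrite lee_fin [leRHS]ger0_norm; last first.
  exact: le_trans (normr_ge0 _) (fg 0%N x Dx).
apply: (cvgr_to_le (cvg_norm (ff x Dx))).
by apply: nearW => n; exact: fg.
Qed.

Lemma Rdominated d (T : measurableType d) (nu : {measure set T -> \bar R})
    (D : set T) (f_ : nat -> T -> R) (f g : T -> R) : measurable D ->
  (forall n, measurable_fun D (f_ n)) ->
  (forall x, D x -> f_ n x @[n --> \oo] --> f x) ->
  nu.-integrable D (fun x => (g x)%:E) ->
  (forall n x, D x -> `|f_ n x| <= g x) ->
  Rintegral nu D (f_ n) @[n --> \oo] --> Rintegral nu D f.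
Proof.
move=> mD mf ff ig fg.
have If := dominated_integrable mD mf ff ig fg.
apply: fine_cvg; rewrite /Rintegral fineK; last exact: integrable_fin_num.
apply: (@dominated_cvg _ _ _ nu _ mD _ _ (fun x => (g x)%:E)) => //.
- by move=> n; exact/measurable_EFinP.
- by move=> x Dx; apply: cvg_EFin; [exact: nearW|exact: ff].
Qed.

Lemma cvgr_natD a : a + n%:R @[n --> \oo] --> (+oo%R : set_system R).
Proof. exact: cvg_comp cvgr_idn (cvg_addrl a). Qed.

(** The restrictions of f to [a, a + n] are dominated by |f|, so the formula on compact intervals
    passes to the limit without a sign condition; the integrands to come oscillate. *)
Lemma ftc_infty F f a (l : R) :
  (forall x, a <= x -> is_derive x 1 F (f x)) ->
  (forall x, a <= x -> {for x, continuous f}) ->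
  mu.-integrable `[a, +oo[ (fun x => (f x)%:E) ->
  F x @[x --> +oo%R] --> l ->
  Rintegral mu `[a, +oo[ f = l - F a.
Proof.
move=> dF cf If Fl.
have mD : measurable (`[a, +oo[%classic : set R) by [].
have mf : measurable_fun (`[a, +oo[%classic : set R) f.
  by apply/measurable_EFinP; exact: (measurable_int mu).
have ftcn n : Rintegral mu `[a, a + n%:R] f = F (a + n%:R) - F a.
  apply: ftc_itv; rewrite ?lerDl//.
  - by move=> x /andP[ax _]; exact: dF.
  - by move=> x /andP[ax _]; exact: cf.
have cvg1 n : Rintegral mu `[a, +oo[ (f \_ `[a, a + n%:R]) = F (a + n%:R) - F a.
  rewrite -ftcn -Rintegral_mkcondr setIidr//; exact: subset_itvl.
have h : Rintegral mu `[a, +oo[ (f \_ `[a, a + n%:R]) @[n --> \oo] --> Rintegral mu `[a, +oo[ f.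
  apply: (@Rdominated _ _ mu _ _ _ (fun x => `|f x|)) => //.
  - move=> n; apply/measurable_restrict => //.
    by apply: measurable_funS mf => // x [].
  - move=> x; rewrite /= in_itv/= andbT => ax.
    apply: cvg_near_cst; near=> n.
    rewrite patchT// inE/= in_itv/= ax/= -lerBlDl.
    by near: n; exact: nbhs_infty_ger.
  - exact: integrable_norm.
  - by move=> n x _; rewrite /patch; case: ifP => // _; rewrite normr0.
have h1 : F (a + n%:R) - F a @[n --> \oo] --> l - F a.
  apply: cvgB; last exact: cvg_cst.
  exact: cvg_comp (cvgr_natD a) Fl.
move: h; under eq_fun do rewrite cvg1.
by move=> h; apply: (cvg_unique _ h h1).
Unshelve. all: end_near. Qed.
End RealCalculus.

(** * Complex functions of a real variable and the exponential *)

Section ComplexDerive.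
Variable R : realType.
Local Notation C := R[i].
Implicit Types (f g : R -> C) (x : R).

Definition cderive f x (df : C) :=
  is_derive x 1 (fun y => complex.Re (f y)) (complex.Re df) /\
  is_derive x 1 (fun y => complex.Im (f y)) (complex.Im df).

Definition ccontinuous_at f x :=
  {for x, continuous (fun y => complex.Re (f y))} /\
  {for x, continuous (fun y => complex.Im (f y))}.

Lemma cderive_eq f x a b : cderive f x a -> a = b -> cderive f x b.
Proof. by move=> h <-. Qed.

Lemma cderive_cst (c : C) x : cderive (fun=> c) x 0.
Proof. by split; exact: isd_cst. Qed.

Lemma cderiveD f g x a b : cderive f x a -> cderive g x b ->
  cderive (fun y => f y + g y) x (a + b).
Proof.
move=> [f1 f2] [g1 g2]; split.
- by under eq_fun do rewrite cReD; rewrite cReD; exact: isd_add.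
- by under eq_fun do rewrite cImD; rewrite cImD; exact: isd_add.
Qed.

Lemma cderiveB f g x a b : cderive f x a -> cderive g x b ->
  cderive (fun y => f y - g y) x (a - b).
Proof.
move=> [f1 f2] [g1 g2]; split.
- by under eq_fun do rewrite cReB; rewrite cReB; exact: isd_sub.
- by under eq_fun do rewrite cImB; rewrite cImB; exact: isd_sub.
Qed.

Lemma cderiveM f g x a b : cderive f x a -> cderive g x b ->
  cderive (fun y => f y * g y) x (a * g x + f x * b).
Proof.
move=> [f1 f2] [g1 g2]; split.
- under eq_fun do rewrite cReM.
  apply: is_derive_eq (isd_sub (isd_mul f1 g1) (isd_mul f2 g2)) _.
  rewrite cReD !cReM; ring.
- under eq_fun do rewrite cImM.
  apply: is_derive_eq (isd_add (isd_mul f1 g2) (isd_mul f2 g1)) _.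
  rewrite cImD !cImM; ring.
Qed.

Lemma cderiveZ (c : C) f x a : cderive f x a ->
  cderive (fun y => c * f y) x (c * a).
Proof.
move=> h; apply: cderive_eq (cderiveM (cderive_cst c x) h) _.
by rewrite mul0r add0r.
Qed.

Lemma cderiveN f x (a : C) : cderive f x a -> cderive (fun y => - f y) x (- a).
Proof.
move=> h; have -> : (fun y => - f y) = (fun y => -1 * f y).
  by apply/funext => y; rewrite mulN1r.
exact: cderive_eq (cderiveZ (-1) h) (mulN1r _).
Qed.

Lemma cderive_real (u : R -> R) x a : is_derive x 1 u a ->
  cderive (fun y => (u y)%:C) x a%:C.
Proof. by move=> h; split => //=; exact: isd_cst. Qed.

Lemma cderive_comp f (u : R -> R) x a b : cderive f (u x) a -> is_derive x 1 u b ->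
  cderive (fun y => f (u y)) x (b%:C * a).
Proof.
move=> [f1 f2] hu; split.
- by rewrite cReM /= mul0r subr0; exact: isd_comp f1 hu.
- by rewrite cImM /= mul0r addr0; exact: isd_comp f2 hu.
Qed.

Lemma cderive_cont f x a : cderive f x a -> ccontinuous_at f x.
Proof. by move=> [h1 h2]; split; [exact: isd_cont h1|exact: isd_cont h2]. Qed.

Lemma eq_continuous_for (u v : R -> R) x : u =1 v ->
  {for x, continuous u} -> {for x, continuous v}.
Proof. by move=> /funext ->. Qed.

Lemma ccontinuousD f g x : ccontinuous_at f x -> ccontinuous_at g x ->
  ccontinuous_at (fun y => f y + g y) x.
Proof.
move=> [f1 f2] [g1 g2]; split.
- by apply: eq_continuous_for (fun y => esym (cReD (f y) (g y))) _; exact: cvgD.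
- by apply: eq_continuous_for (fun y => esym (cImD (f y) (g y))) _; exact: cvgD.
Qed.

Lemma ccontinuousM f g x : ccontinuous_at f x -> ccontinuous_at g x ->
  ccontinuous_at (fun y => f y * g y) x.
Proof.
move=> [f1 f2] [g1 g2]; split.
- apply: eq_continuous_for (fun y => esym (cReM (f y) (g y))) _.
  by apply: cvgB; exact: cvgM.
- apply: eq_continuous_for (fun y => esym (cImM (f y) (g y))) _.
  by apply: cvgD; exact: cvgM.
Qed.

Lemma ccontinuous_cst (c : C) x : ccontinuous_at (fun=> c) x.
Proof. by split; exact: cvg_cst. Qed.

Lemma ccontinuous_real (u : R -> R) x : {for x, continuous u} ->
  ccontinuous_at (fun y => (u y)%:C) x.
Proof. by move=> h; split => //=; exact: cvg_cst. Qed.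

Definition cexp (z : C) : C :=
  (expR (complex.Re z) * cos (complex.Im z)) +i*
  (expR (complex.Re z) * sin (complex.Im z)).

Lemma cexp0 : cexp 0 = 1.
Proof. by rewrite /cexp /= expR0 cos0 sin0 mulr1 mulr0. Qed.

Lemma cexpD z w : cexp (z + w) = cexp z * cexp w.
Proof.
apply: complexP; rewrite /cexp /= ?cReD ?cImD expRD ?cosD ?sinD; ring.
Qed.

Lemma cexp_real (x : R) : cexp x%:C = (expR x)%:C.
Proof. by rewrite /cexp /= cos0 sin0 mulr1 mulr0. Qed.

Lemma norm1_cexp z : norm1 (cexp z) <= 2 * expR (complex.Re z).
Proof.
rewrite /norm1 /= !normrM (ger0_norm (expR_ge0 _)) -mulrDr mulrC.
rewrite ler_wpM2r ?expR_ge0//.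
have := @cos_max R (complex.Im z); have := @sin_max R (complex.Im z); lra.
Qed.

Lemma cderive_exp (u : R -> C) x a : cderive u x a ->
  cderive (fun y => cexp (u y)) x (a * cexp (u x)).
Proof.
move=> [u1 u2].
have he : is_derive x 1 (fun y => expR (complex.Re (u y)))
    (complex.Re a * expR (complex.Re (u x))).
  by apply: isd_comp u1.
have hc : is_derive x 1 (fun y => cos (complex.Im (u y)))
    (complex.Im a * - sin (complex.Im (u x))).
  by apply: isd_comp u2.
have hs : is_derive x 1 (fun y => sin (complex.Im (u y)))
    (complex.Im a * cos (complex.Im (u x))).
  by apply: isd_comp u2.
split => /=.
- apply: is_derive_eq (isd_mul he hc) _; rewrite cReM /=; ring.
- apply: is_derive_eq (isd_mul he hs) _; rewrite cImM /=; ring.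
Qed.

(** The factor 2 arises because the mean value theorem is applied to each part separately, with
    different intermediate points. *)
Lemma cderive_mvt f (f' : R -> C) a b (B : R) : a <= b ->
  (forall x, a <= x <= b -> cderive f x (f' x)) ->
  (forall x, a <= x <= b -> norm1 (f' x) <= B) ->
  norm1 (f b - f a) <= 2 * B * (b - a).
Proof.
move=> ab df fB.
have h1 : `|complex.Re (f b) - complex.Re (f a)| <= B * (b - a).
  apply: (@mvt_le _ (fun y => complex.Re (f y)) (fun y => complex.Re (f' y))) => //.
  - by move=> x /df [].
  - by move=> x /fB; apply: le_trans; exact: Re_norm1.
have h2 : `|complex.Im (f b) - complex.Im (f a)| <= B * (b - a).
  apply: (@mvt_le _ (fun y => complex.Im (f y)) (fun y => complex.Im (f' y))) => //.
  - by move=> x /df [].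
  - by move=> x /fB; apply: le_trans; exact: Im_norm1.
by rewrite /norm1 cReB cImB; move: h1 h2; lra.
Qed.

End ComplexDerive.

(** * Antiderivatives and differentiation under the integral sign *)

Section ComplexIntegralCalculus.
Variable R : realType.
Local Notation C := R[i].
Local Notation mu := (@lebesgue_measure R).
Implicit Types (f F : R -> C) (a b : R).

Lemma ccontinuous_cintegrable f a b :
  (forall x, a <= x <= b -> ccontinuous_at f x) ->
  cintegrable mu `[a, b] f.
Proof.
by move=> cf; split; apply: continuous_itv_integrable => x /cf[].
Qed.

Lemma ccontinuous_cmeasurable f (D : set R) : measurable D ->
  (forall x, D x -> ccontinuous_at f x) -> cmeasurable D f.
Proof.
move=> mD cf; split; apply: subspace_continuous_measurable_fun => //;
 by apply: continuous_in_subspaceT => x; rewrite inE => /cf[].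
Qed.

Lemma cftc_itv F f a b : a <= b ->
  (forall x, a <= x <= b -> cderive F x (f x)) ->
  (forall x, a <= x <= b -> ccontinuous_at f x) ->
  cint mu `[a, b] f = F b - F a.
Proof.
move=> ab dF cf; apply: complexP; rewrite ?cReB ?cImB /=.
- by apply: (@ftc_itv _ (fun x => complex.Re (F x))) => // x xab;
    [have [] := dF _ xab|have [] := cf _ xab].
- by apply: (@ftc_itv _ (fun x => complex.Im (F x))) => // x xab;
    [have [] := dF _ xab|have [] := cf _ xab].
Qed.

Lemma cftc_infty F f a :
  (forall x, a <= x -> cderive F x (f x)) ->
  (forall x, a <= x -> ccontinuous_at f x) ->
  cintegrable mu `[a, +oo[ f ->
  norm1 (F x) @[x --> +oo%R] --> (0 : R) ->
  cint mu `[a, +oo[ f = - F a.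
Proof.
move=> dF cf [If1 If2] F0.
have Re0 : complex.Re (F x) @[x --> +oo%R] --> (0 : R).
  apply/cvgr0Pnorm_le => e e0; near=> x.
  apply: (le_trans (Re_norm1 _)).
  rewrite -[leLHS]ger0_norm ?norm1_ge0//.
  by near: x; apply: cvgr0_norm_le.
have Im0 : complex.Im (F x) @[x --> +oo%R] --> (0 : R).
  apply/cvgr0Pnorm_le => e e0; near=> x.
  apply: (le_trans (Im_norm1 _)).
  rewrite -[leLHS]ger0_norm ?norm1_ge0//.
  by near: x; apply: cvgr0_norm_le.
apply: complexP; rewrite ?cReN ?cImN /= -sub0r.
- by apply: (@ftc_infty _ (fun x => complex.Re (F x))) => // x xab;
    [have [] := dF _ xab|have [] := cf _ xab].
- by apply: (@ftc_infty _ (fun x => complex.Im (F x))) => // x xab;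
    [have [] := dF _ xab|have [] := cf _ xab].
Unshelve. all: end_near. Qed.

Lemma cderive_under d (Y : measurableType d) (nu : {measure set Y -> \bar R})
    (D : set Y) (F F' : R -> Y -> C) (a u v : R) (G : Y -> R) :
  measurable D -> u < a < v ->
  (forall x, u < x < v -> cintegrable nu D (F x)) ->
  (forall x y, u < x < v -> D y -> cderive (F^~ y) x (F' x y)) ->
  nu.-integrable D (fun y => (G y)%:E) ->
  (forall x y, u < x < v -> D y -> norm1 (F' x y) <= G y) ->
  cderive (fun x => cint nu D (F x)) a (cint nu D (F' a)).
Proof.
move=> mD uav iF dF iG FG.
have iG' : nu.-integrable D (EFin \o (fun y => `|G y|)) by exact: integrable_norm.
have oo x : `]u, v[%classic x -> u < x < v by rewrite /= in_itv.
have Ia : `]u, v[%classic a by rewrite /= in_itv.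
(* The projection [p] stands for the real or the imaginary part. *)
have aux (p : C -> R) :
  (forall x, u < x < v -> nu.-integrable D (EFin \o (fun y => p (F x y)))) ->
  (forall x y, u < x < v -> D y -> is_derive x 1 (fun x => p (F x y)) (p (F' x y))) ->
  (forall z, `|p z| <= norm1 z) ->
  is_derive a 1 (fun x => Rintegral nu D (fun y => p (F x y)))
    (Rintegral nu D (fun y => p (F' a y))).
  move=> ip dp pn.
  pose f x y := p (F x y).
  have d1 x y : u < x < v -> D y -> ('D_1 (f^~ y) x) = p (F' x y).
    by move=> xuv Dy; have [] := dp _ _ xuv Dy.
  have H1 : forall x, `]u, v[%classic x -> nu.-integrable D (EFin \o f x).
    by move=> x /oo; exact: ip.
  have H2 x y : `]u, v[%classic x -> D y -> derivable (f^~ y) x 1.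
    by move=> /oo xuv Dy; have [] := dp _ _ xuv Dy.
  have H3 x y : `]u, v[%classic x -> D y -> `|partial1of2 f x y| <= `|G y|.
    move=> /oo xuv Dy; rewrite partial1of2E d1//.
    by rewrite (le_trans (pn _))// (le_trans (FG _ _ xuv Dy))// ler_norm.
  have der := derivable_under_integral mD Ia H1 H2 (fun y => normr_ge0 (G y)) iG' H3.
  have := differentiation_under_integral mD Ia H1 H2 (fun y => normr_ge0 (G y)) iG' H3.
  rewrite derive1E => derE.
  apply: DeriveDef => //; rewrite derE.
  apply: eq_Rintegral => y; rewrite inE => Dy.
  by rewrite partial1of2E d1.
split => /=; apply: aux.
- by move=> x /iF[].
- by move=> x y xuv Dy; have [] := dF _ _ xuv Dy.
- exact: Re_norm1.
- by move=> x /iF[].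
- by move=> x y xuv Dy; have [] := dF _ _ xuv Dy.
- exact: Im_norm1.
Qed.

End ComplexIntegralCalculus.

(** * Entire power series *)

Section ComplexSequences.
Variable R : realType.
Local Notation C := R[i].
Implicit Types u v : nat -> C.

Definition ccvg u (l : C) :=
  (complex.Re (u n) @[n --> \oo] --> complex.Re l) /\
  (complex.Im (u n) @[n --> \oo] --> complex.Im l).

Lemma ccvg_unique u l l' : ccvg u l -> ccvg u l' -> l = l'.
Proof.
move=> [a b] [a' b']; apply: complexP;
  [exact: cvg_unique a a'|exact: cvg_unique b b'].
Qed.

Lemma ccvgD u v l l' : ccvg u l -> ccvg v l' -> ccvg (fun n => u n + v n) (l + l').
Proof.
move=> [a b] [a' b']; split.
- by rewrite cReD; under eq_fun do rewrite cReD; exact: cvgD.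
- by rewrite cImD; under eq_fun do rewrite cImD; exact: cvgD.
Qed.

Lemma ccvgM u v l l' : ccvg u l -> ccvg v l' -> ccvg (fun n => u n * v n) (l * l').
Proof.
move=> [a b] [a' b']; split.
- by rewrite cReM; under eq_fun do rewrite cReM; apply: cvgB; exact: cvgM.
- by rewrite cImM; under eq_fun do rewrite cImM; apply: cvgD; exact: cvgM.
Qed.

Lemma ccvg_cst (c : C) : ccvg (fun=> c) c.
Proof. by split; exact: cvg_cst. Qed.

Lemma ccvg_shiftS u l : ccvg (fun n => u n.+1) l -> ccvg u l.
Proof.
by move=> [a b]; split; [rewrite -(cvg_shiftS (fun n => complex.Re (u n)))
  |rewrite -(cvg_shiftS (fun n => complex.Im (u n)))].
Qed.

(** Passage from componentwise limits to the modulus topology, in which the Bessel series of the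
    statement are summed. *)
Lemma ccvg_limn u l : ccvg u l -> limn (u : nat -> R[i]^o) = l.
Proof.
move=> [a b]; apply: cvg_lim => //.
(* A positive complex tolerance has zero imaginary part. *)
apply/cvgrPdist_lt => -[e1 e2]; rewrite ltcE /= => /andP[/eqP -> e0].
have e20 : 0 < e1 / 2 by rewrite divr_gt0.
near=> n.
have h1 : `|complex.Re l - complex.Re (u n)| < e1 / 2.
  by near: n; move/cvgrPdist_lt : a; apply.
have h2 : `|complex.Im l - complex.Im (u n)| < e1 / 2.
  by near: n; move/cvgrPdist_lt : b; apply.
have -> : `|l - u n| = (normc (l - u n))%:C by [].
rewrite ltcR (le_lt_trans (normc_le_norm1 _))// /norm1 cReB cImB.
lra.
Unshelve. all: end_near. Qed.

End ComplexSequences.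

Section ComplexPowerSeries.
Variable R : realType.
Local Notation C := R[i].
Implicit Types a b : nat -> C.

(* Growth condition making the power series entire. *)
Definition exp_bounded a := exists A B : R,
  [/\ 0 <= A, 0 <= B & forall m, norm1 (a m) <= A * (B ^+ m / m`!%:R)].

Definition cps a (x : R) : C :=
  limn (pseries (fun m => complex.Re (a m)) x) +i*
  limn (pseries (fun m => complex.Im (a m)) x).

Definition cdiffs a (m : nat) : C := m.+1%:R * a m.+1.

Lemma Re_natM (n : nat) (z : C) : complex.Re (n%:R * z) = n%:R * complex.Re z.
Proof. by rewrite -(rmorph_nat (real_complex R)) cReM /= mul0r subr0. Qed.
Lemma Im_natM (n : nat) (z : C) : complex.Im (n%:R * z) = n%:R * complex.Im z.
Proof. by rewrite -(rmorph_nat (real_complex R)) cImM /= mul0r addr0. Qed.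

Lemma norm1_natM (n : nat) (z : C) : norm1 (n%:R * z) = n%:R * norm1 z.
Proof. by rewrite /norm1 Re_natM Im_natM !normrM ger0_norm// mulrDr. Qed.

Lemma exp_bounded_diffs a : exp_bounded a -> exp_bounded (cdiffs a).
Proof.
move=> [A [B [A0 B0 h]]]; exists (A * B), B; split=> //; first exact: mulr_ge0.
move=> m; rewrite norm1_natM.
have n0 : 0 < (m.+1%:R : R) by rewrite ltr0n.
have f0 : 0 < (m`!%:R : R) by rewrite ltr0n fact_gt0.
have := h m.+1; rewrite -(ler_pM2l n0) => /le_trans; apply.
rewrite factS natrM exprS le_eqVlt; apply/orP; left; apply/eqP; field.
by rewrite !gt_eqF.
Qed.

Lemma exp_bounded_Re_cvg a x : exp_bounded a ->
  cvgn (pseries (fun m => complex.Re (a m)) x) /\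
  cvgn (pseries (fun m => complex.Im (a m)) x).
Proof.
move=> [A [B [A0 B0 h]]].
have aux (p : C -> R) : (forall z, `|p z| <= norm1 z) ->
    cvgn (pseries (fun m => p (a m)) x).
  move=> pn; apply: normed_cvg.
  apply: (series_le_cvg (v_ := A *: exp_coeff (B * `|x|))).
  - by move=> n; exact: normr_ge0.
  - by move=> n; rewrite mulr_ge0// /exp_coeff/= divr_ge0// exprn_ge0// mulr_ge0.
  - move=> n; rewrite /exp_coeff /GRing.scale/= normrM normrX.
    rewrite (le_trans (ler_wpM2r _ (pn _)))// ?exprn_ge0//.
    rewrite (le_trans (ler_wpM2r _ (h _)))// ?exprn_ge0//.
    by rewrite exprMn -!mulrA (mulrC (n`!%:R^-1)).
  - by apply: is_cvg_seriesZ; exact: is_cvg_series_exp_coeff.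
by split; apply: aux; [exact: Re_norm1|exact: Im_norm1].
Qed.

Lemma cReXr (x : R) n : (x ^+ n)%:C = x%:C ^+ n.
Proof. by rewrite rmorphXn. Qed.

Lemma cps_cvg a x : exp_bounded a ->
  ccvg (fun n => \sum_(0 <= m < n) a m * x%:C ^+ m) (cps a x).
Proof.
move=> /exp_bounded_Re_cvg => /(_ x)[c1 c2]; split => /=.
- rewrite [X in X @ _ --> _](_ : _ = pseries (fun m => complex.Re (a m)) x).
    exact: c1.
  apply/funext => n; rewrite cRe_sum /pseries /series/=; apply: eq_bigr => i _.
  by rewrite -cReXr cReM /= mulr0 subr0.
- rewrite [X in X @ _ --> _](_ : _ = pseries (fun m => complex.Im (a m)) x).
    exact: c2.
  apply/funext => n; rewrite cIm_sum /pseries /series/=; apply: eq_bigr => i _.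
  by rewrite -cReXr cImM /= mulr0 add0r.
Qed.

Lemma cps_unique a x l : exp_bounded a ->
  ccvg (fun n => \sum_(0 <= m < n) a m * x%:C ^+ m) l -> cps a x = l.
Proof. by move=> ba; exact/ccvg_unique/cps_cvg. Qed.

Lemma eq_cps a b : a =1 b -> cps a =1 cps b.
Proof. by move=> ab x; rewrite (funext ab). Qed.

Lemma cps_derive a x : exp_bounded a -> cderive (cps a) x (cps (cdiffs a) x).
Proof.
move=> ba.
have bd := exp_bounded_diffs ba; have bdd := exp_bounded_diffs bd.
(* Termwise differentiation asks that the series and its first two formal derivatives converge at
   some point of larger modulus. *)
have xK : `|x| < `| `|x| + 1|.
  by rewrite [ltRHS]ger0_norm ?addr_ge0// ltrDl.
have dR c : pseries_diffs (fun m => complex.Re (c m)) =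
    (fun m => complex.Re (cdiffs c m)).
  by apply/funext => m; rewrite /pseries_diffs /cdiffs Re_natM.
have dI c : pseries_diffs (fun m => complex.Im (c m)) =
    (fun m => complex.Im (cdiffs c m)).
  by apply/funext => m; rewrite /pseries_diffs /cdiffs Im_natM.
have [a1 a2] := exp_bounded_Re_cvg (`|x| + 1) ba.
have [d1 d2] := exp_bounded_Re_cvg (`|x| + 1) bd.
have [e1 e2] := exp_bounded_Re_cvg (`|x| + 1) bdd.
split => /=.
- rewrite -dR; apply: (pseries_snd_diffs a1) xK; first by rewrite dR.
  by rewrite !dR.
- rewrite -dI; apply: (pseries_snd_diffs a2) xK; first by rewrite dI.
  by rewrite !dI.
Qed.

(** The Euler operator x d/dx acts on coefficients as multiplication by m; in this form Bessel's
    equation becomes a two-term recurrence. *)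
Lemma cps_shift a x : exp_bounded a -> exp_bounded (fun m => m%:R * a m) ->
  x%:C * cps (cdiffs a) x = cps (fun m => m%:R * a m) x.
Proof.
move=> ba bm; apply/esym/cps_unique => //; apply: ccvg_shiftS.
have := ccvgM (ccvg_cst x%:C) (cps_cvg x (exp_bounded_diffs ba)).
congr ccvg; apply/funext => n; rewrite big_nat_recl// mul0r mul0r add0r mulr_sumr.
by apply: eq_bigr => i _; rewrite /cdiffs exprS; ring.
Qed.

Lemma cpsD a b x : exp_bounded a -> exp_bounded b ->
  exp_bounded (fun m => a m + b m) ->
  cps (fun m => a m + b m) x = cps a x + cps b x.
Proof.
move=> ba bb bab; apply: cps_unique => //.
have := ccvgD (cps_cvg x ba) (cps_cvg x bb).
congr ccvg; apply/funext => n; rewrite -big_split/=.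
by apply: eq_bigr => i _; rewrite mulrDl.
Qed.

Lemma cpsZ (c : C) a x : exp_bounded a -> exp_bounded (fun m => c * a m) ->
  cps (fun m => c * a m) x = c * cps a x.
Proof.
move=> ba bb; apply: cps_unique => //.
have := ccvgM (ccvg_cst c) (cps_cvg x ba).
congr ccvg; apply/funext => n; rewrite mulr_sumr.
by apply: eq_bigr => i _; rewrite mulrA.
Qed.

Lemma cps0 a : exp_bounded a -> cps a 0 = a 0%N.
Proof.
move=> ba; apply: cps_unique => //; apply: ccvg_shiftS.
have := ccvg_cst (a 0%N); congr ccvg; apply/funext => n.
rewrite big_nat_recl// expr0 mulr1 big1 ?addr0// => i _.
by rewrite rmorph0 exprS mul0r mulr0.
Qed.

Lemma exp_boundedZ (c : C) a : exp_bounded a -> exp_bounded (fun m => c * a m).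
Proof.
move=> [A [B [A0 B0 h]]]; exists (norm1 c * A), B; split => //.
  by rewrite mulr_ge0// norm1_ge0.
move=> m; rewrite (le_trans (norm1M _ _))// -mulrA ler_wpM2l ?norm1_ge0//.
Qed.

Lemma exp_boundedD a b : exp_bounded a -> exp_bounded b ->
  exp_bounded (fun m => a m + b m).
Proof.
move=> [A [B [A0 B0 h]]] [A' [B' [A0' B0' h']]]; exists (A + A'), (B + B'); split.
- exact: addr_ge0.
- exact: addr_ge0.
- move=> m; rewrite (le_trans (norm1D _ _))// mulrDl lerD//.
  + rewrite (le_trans (h m))// ler_wpM2l// ler_wpM2r ?invr_ge0//.
    by rewrite lerXn2r// ?nnegrE ?addr_ge0// lerDl.
  + rewrite (le_trans (h' m))// ler_wpM2l// ler_wpM2r ?invr_ge0//.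
    by rewrite lerXn2r// ?nnegrE ?addr_ge0// lerDr.
Qed.

(** Since m <= 2^m, doubling the growth base absorbs the factor. *)
Lemma exp_bounded_nat a : exp_bounded a -> exp_bounded (fun m => m%:R * a m).
Proof.
move=> [A [B [A0 B0 h]]]; exists A, (2 * B); split => //; first exact: mulr_ge0.
move=> m; rewrite norm1_natM (le_trans (ler_wpM2l _ (h m)))//.
rewrite mulrCA ler_wpM2l// mulrA ler_wpM2r ?invr_ge0// exprMn ler_wpM2r ?exprn_ge0//.
by rewrite -natrX ler_nat ltnW// ltn_expl.
Qed.

End ComplexPowerSeries.

(** * Uniqueness for Bessel's equation *)

Lemma isd_expM (R : realType) (c x : R) :
  is_derive x 1 (fun y => expR (c * y)) (c * expR (c * x)).
Proof.
have h : is_derive x 1 (fun y : R => c * y) c.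
  apply: is_derive_eq (isd_mul (isd_cst c x) (isd_id x)) _.
  by rewrite mul0r add0r mulr1.
exact: (isd_comp (f := expR) _ h).
Qed.

Lemma isd_inv (R : realType) (r : R) : r != 0 ->
  is_derive r 1 (fun x : R => x^-1) (- r ^- 2).
Proof.
move=> r0; have h := is_deriveV (f := fun x : R => x) (v := 1) (t := 1) r0.
by have := h (is_derive_id _ _); rewrite /GRing.scale/= mulr1.
Qed.

Section BesselSystem.
Variable R : realType.
Local Notation C := R[i].

Definition sqn (z : C) : R := complex.Re z ^+ 2 + complex.Im z ^+ 2.

Lemma sqn_ge0 z : 0 <= sqn z.
Proof. by rewrite addr_ge0// sqr_ge0. Qed.

Lemma sqn_le_norm1 z : sqn z <= norm1 z ^+ 2.
Proof.
rewrite /sqn /norm1 sqrrD !real_normK ?num_real//.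
have : 0 <= `|complex.Re z| * `|complex.Im z| by rewrite mulr_ge0.
lra.
Qed.

Lemma sqn_eq0 z : sqn z = 0 -> z = 0.
Proof.
move=> /eqP; rewrite paddr_eq0 ?sqr_ge0// !sqrf_eq0 => /andP[/eqP a /eqP b].
exact: complexP.
Qed.

(* With [U = V / r = W'] the system reads [U' = - k2 W - U / r]; the singular
   term enters the derivative of [|W|^2 + |U|^2] with a favourable sign. *)
Lemma bessel_system_unique (k2 : C) (W V : R -> C) (A : R) :
  (forall r : R, 0 < r -> cderive W r (r^-1%:C * V r)) ->
  (forall r : R, 0 < r -> cderive V r (- (k2 * (r%:C * W r)))) ->
  (forall r : R, 0 < r <= 1 -> norm1 (W r) <= A * r) ->
  (forall r : R, 0 < r <= 1 -> norm1 (V r) <= A * r) ->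
  forall r : R, 0 < r -> W r = 0.
Proof.
move=> dW dV WA VA.
have A0 : 0 <= A.
  have := le_trans (norm1_ge0 _) (WA 1 _); rewrite mulr1; apply.
  by rewrite ltr01 lexx.
have k0 := norm1_ge0 k2; set N := norm1 k2 in k0.
(* Integrating V' = - k2 r W from a vanishing s improves the bound on V to order r^2, so that U = V
   / r also tends to 0. *)
have V2 (r : R) : 0 < r <= 1 -> norm1 (V r) <= 2 * (N * A) * r ^+ 2.
  move=> /andP[r0 r1].
  apply/ler_addgt0Pr => e e0.
  pose s := Num.min (r / 2) (e / (A + 1)).
  have s0 : 0 < s by rewrite lt_min !divr_gt0// ltr_wpDl.
  have sr : s < r.
    have : s <= r / 2 by rewrite ge_min lexx.
    by move: r0; lra.
  have As : A * s <= e.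
    have : s <= e / (A + 1) by rewrite ge_min lexx orbT.
    rewrite ler_pdivlMr ?ltr_wpDl// mulrDr mulr1 mulrC => /(le_trans _); apply.
    by rewrite lerDl ltW.
  have s1 : 0 < s <= 1 by rewrite s0 (le_trans (ltW sr)).
  have mvt : norm1 (V r - V s) <= 2 * (N * A * r ^+ 2) * (r - s).
    apply: (cderive_mvt (f' := fun r => - (k2 * (r%:C * W r)))) => //.
    - exact: ltW.
    - by move=> x /andP[sx xr]; apply: dV; exact: lt_le_trans sx.
    - move=> x /andP[sx xr]; have x0 := lt_le_trans s0 sx.
      have x1 := le_trans xr r1.
      rewrite norm1N (le_trans (norm1M _ _))// norm1_realM (ger0_norm (ltW x0)).
      rewrite -mulrA ler_wpM2l//.
      rewrite (le_trans (ler_wpM2l (ltW x0) (WA _ _))) ?x0//.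
      by rewrite mulrCA ler_wpM2l// -expr2 lerXn2r// nnegrE ltW//; exact: lt_le_trans xr.
  rewrite -(subrK (V s) (V r)) (le_trans (norm1D _ _))// lerD//; last first.
    exact: le_trans (VA _ s1) As.
  apply: (le_trans mvt); rewrite -[leRHS]mulr1 -(mulrA 2 (N * A)).
  rewrite ler_wpM2l//.
    by rewrite mulr_ge0// mulr_ge0 ?sqr_ge0// mulr_ge0.
  by rewrite lerBlDr (le_trans r1)// lerDl ltW.
pose U r := r^-1%:C * V r.
(* Growth rate of y: the cross term 2 Re (conj W U) costs at most y, the coupling through k2 at most
   2 N y, and the singular term is nonpositive. *)
pose K := 1 + 2 * N.
pose y r := sqn (W r) + sqn (U r).
have dU (r : R) : 0 < r -> cderive U r (- (k2 * W r) - r^-1%:C * U r).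
  move=> r0; have r0' : r != 0 by rewrite gt_eqF.
  have di : is_derive r 1 (fun x : R => x^-1) (- r ^- 2).
    exact: isd_inv.
  apply: cderive_eq (cderiveM (cderive_real di) (dV r r0)) _.
  rewrite /U expr2 invfM rmorphN !rmorphM/=.
  have : (r%:C)^-1 * r%:C = 1 :> C by rewrite mulVf// eq_complex/= eqxx andbT.
  rewrite fmorphV => h.
  rewrite mulrN (mulrCA _ k2) (mulrA _ r%:C) h mul1r.
  by rewrite addrC; congr (_ + _); rewrite mulNr mulrA.
pose y' r := 2 * (complex.Re (W r) * complex.Re (U r) +
    complex.Im (W r) * complex.Im (U r)) +
  2 * (complex.Re (U r) * complex.Re (- (k2 * W r) - r^-1%:C * U r) +
    complex.Im (U r) * complex.Im (- (k2 * W r) - r^-1%:C * U r)).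
have isd_sq (f : R -> R) (r a : R) : is_derive r 1 f a ->
    is_derive r 1 (fun x => f x ^+ 2) (2 * (f r * a)).
  move=> h; apply: is_derive_eq (isd_mul h h) _; ring.
have dy (r : R) : 0 < r -> is_derive r 1 y (y' r).
  move=> r0; have [w1 w2] := dW r r0; have [u1 u2] := dU r r0.
  apply: is_derive_eq (isd_add (isd_add (isd_sq _ _ _ w1) (isd_sq _ _ _ w2))
     (isd_add (isd_sq _ _ _ u1) (isd_sq _ _ _ u2))) _.
  by rewrite /y' /U; ring.
have y'le (r : R) : 0 < r -> y' r <= K * y r.
  move=> r0; rewrite /y' /K /y /sqn; move: (U r) (W r) => Ur Wr.
  rewrite !cReB !cImB !cReN !cImN !cReM !cImM /= !mul0r.
  have := Re_norm1 k2; have := Im_norm1 k2; rewrite -/N.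
  set a := complex.Re Wr; set b := complex.Im Wr.
  set c := complex.Re Ur; set d := complex.Im Ur.
  set p := complex.Re k2; set q := complex.Im k2.
  rewrite !ler_norml => /andP[q1 q2] /andP[p1 p2].
  have ri : 0 < r^-1 by rewrite invr_gt0.
  have h1 : 0 <= r^-1 * (c ^+ 2 + d ^+ 2) by rewrite mulr_ge0 ?addr_ge0 ?sqr_ge0// ltW.
  have h2 (s t n : R) : - N <= n -> n <= N -> - (2 * (n * (s * t))) <= N * (s ^+ 2 + t ^+ 2).
    move=> n1 n2; have : 0 <= (N - n) * (s - t) ^+ 2 by rewrite mulr_ge0 ?sqr_ge0// subr_ge0.
    have : 0 <= (N + n) * (s + t) ^+ 2 by rewrite mulr_ge0 ?sqr_ge0//; move: n1; lra.
    lra.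
  have := h2 c a p p1 p2; have := h2 d b p p1 p2.
  have := h2 d a q q1 q2; have := h2 c (- b) q q1 q2.
  have : 0 <= (a - c) ^+ 2 by rewrite sqr_ge0.
  have : 0 <= (b - d) ^+ 2 by rewrite sqr_ge0.
  move: h1; rewrite !sqrrB sqrrN; lra.
have UW0 (r : R) : 0 < r <= 1 -> y r <= (A ^+ 2 + (2 * (N * A)) ^+ 2) * r ^+ 2.
  move=> r01; have /andP[r0 r1] := r01; rewrite mulrDl; apply: lerD.
  - rewrite (le_trans (sqn_le_norm1 _))// -exprMn lerXn2r//.
    + by rewrite nnegrE norm1_ge0.
    + by rewrite nnegrE mulr_ge0// ltW.
    + exact: WA.
  - rewrite (le_trans (sqn_le_norm1 _))// -exprMn lerXn2r//.
    + by rewrite nnegrE norm1_ge0.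
    + by rewrite nnegrE !mulr_ge0// ltW.
    + rewrite /U norm1_realM ger0_norm ?invr_ge0 ?(ltW r0)// mulrC ler_pdivrMr//.
      by rewrite -mulrA -expr2; exact: V2.
(* Gronwall's argument started at the singular point: y e^(- K r) is nonincreasing and y is O(r^2),
   so letting s tend to 0 forces y to vanish. *)
have ymon (s r : R) : 0 < s -> s <= r -> y r * expR (- K * r) <= y s * expR (- K * s).
  move=> s0 sr.
  have dz (x : R) : 0 < x -> is_derive x 1 (fun x => y x * expR (- K * x))
      (y' x * expR (- K * x) + y x * (- K * expR (- K * x))).
    move=> x0; apply: isd_mul; first exact: dy.
    exact: isd_expM.
  have [||x] := MVT_segment (f := fun x => y x * expR (- K * x))
    (df := fun x => y' x * expR (- K * x) + y x * (- K * expR (- K * x))) sr.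
  - by move=> x; rewrite in_itv/= => /andP[sx _]; apply: dz; exact: lt_trans sx.
  - by apply: within_itv_cont => x /andP[sx _]; exact: isd_cont (dz _ (lt_le_trans s0 sx)).
  rewrite in_itv/= => /andP[sx _] e; rewrite -subr_le0 e.
  rewrite mulr_le0_ge0 ?subr_ge0// mulrA -mulrDl.
  rewrite mulr_le0_ge0 ?expR_ge0//.
  have := y'le x (lt_le_trans s0 sx); lra.
move=> r r0; apply: sqn_eq0; apply/eqP; rewrite eq_le sqn_ge0 andbT.
have yr0 : y r * expR (- K * r) <= 0.
  apply/ler_addgt0Pr => e e0; rewrite add0r.
  set B := A ^+ 2 + (2 * (N * A)) ^+ 2 in UW0.
  have B0 : 0 <= B by rewrite addr_ge0// sqr_ge0.
  pose s := Num.min (Num.min r 1) (e / (B + 1)).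
  have s0 : 0 < s by rewrite !lt_min r0 ltr01/= divr_gt0// ltr_wpDl.
  have sr : s <= r by rewrite !ge_min lexx.
  have s1 : 0 < s <= 1 by rewrite s0/= !ge_min lexx !orbT.
  rewrite (le_trans (ymon _ _ s0 sr))//.
  have K0 : 0 <= K by rewrite addr_ge0// mulr_ge0.
  have ex1 : expR (- K * s) <= 1 by rewrite -expR0 ler_expR mulNr oppr_le0 mulr_ge0// ltW.
  have y0 : 0 <= y s by rewrite addr_ge0 ?sqn_ge0.
  rewrite (le_trans (ler_wpM2l y0 ex1))// mulr1 (le_trans (UW0 _ s1))//.
  have s2 : s ^+ 2 <= s by rewrite expr2 -[leRHS]mulr1 ler_wpM2l ?(ltW s0)//; case/andP : s1.
  rewrite (le_trans (ler_wpM2l B0 s2))//.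
  have : s <= e / (B + 1) by rewrite ge_min lexx orbT.
  rewrite ler_pdivlMr ?ltr_wpDl// mulrDr mulr1 mulrC => /(le_trans _); apply.
  by rewrite lerDl ltW.
have : y r <= 0 by move: yr0; rewrite pmulr_lle0// expR_gt0.
by apply: le_trans; rewrite lerDl sqn_ge0.
Qed.

End BesselSystem.

(** * Series of the Hankel function *)

Local Ltac nonneg := do ?[by []|exact: ltW|apply: addr_ge0|apply: mulr_ge0].

Section ComplexBounds.
Variable R : realType.
Local Notation C := R[i].
Implicit Types (f : R -> C) (a b x y : R).

Lemma ccontinuous_bounded f a b :
  (forall x, a <= x <= b -> ccontinuous_at f x) ->
  exists2 B : R, 0 <= B & forall x, a <= x <= b -> norm1 (f x) <= B.
Proof.
move=> cf; have [ab|ba] := leP a b; last first.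
  by exists 0 => // x /andP[ax xb]; have := le_lt_trans (le_trans ax xb) ba; rewrite ltxx.
have cn : {within `[a, b], continuous (fun x => norm1 (f x))}.
  apply: within_itv_cont => x /cf[f1 f2].
  by apply: cvgD; apply: cvg_norm.
have [c _ cmax] := EVT_max ab cn.
exists (norm1 (f c)); first exact: norm1_ge0.
by move=> x xab; apply: cmax; rewrite in_itv.
Qed.

Lemma cps_lipschitz (a : nat -> C) (b : R) : exp_bounded a ->
  exists2 B : R, 0 <= B &
    forall x y, 0 <= x <= b -> 0 <= y <= b ->
      norm1 (cps a x - cps a y) <= B * `|x - y|.
Proof.
move=> ba.
have [B B0 hB] : exists2 B : R, 0 <= B &
    forall x, 0 <= x <= b -> norm1 (cps (cdiffs a) x) <= B.
  apply: ccontinuous_bounded => x _; apply: cderive_cont.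
  exact: cps_derive (exp_bounded_diffs ba).
exists (2 * B) => [|x y]; first exact: mulr_ge0.
wlog xy : x y / y <= x.
  move=> h hx hy; have [yx|/ltW xy] := leP y x; first exact: h.
  by rewrite norm1C distrC; exact: h.
move=> /andP[x0 xb] /andP[y0 yb]; rewrite (ger0_norm (_ : 0 <= x - y)) ?subr_ge0//.
apply: (cderive_mvt (f' := cps (cdiffs a))) => // z /andP[yz zx].
- exact: cps_derive.
- by apply: hB; rewrite (le_trans y0 yz) (le_trans zx xb).
Qed.

End ComplexBounds.

Section ClogScaling.
Variable R : realType.
Local Notation C := R[i].

Lemma normc_realM (z : C) (r : R) : 0 < r -> normc (z * r%:C) = normc z * r.
Proof.
move=> r0; rewrite normcM /=; congr (_ * _).
by rewrite expr0n addr0 sqrtr_sqr gtr0_norm.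
Qed.

(** A positive factor changes neither the sign of Im z nor the quotient Re z / |z|, so the argument
    is unaffected and only the modulus contributes. *)
Lemma clog_realM (z : C) (r : R) : z != 0 -> 0 < r ->
  clog (z * r%:C) = clog z + (ln r)%:C.
Proof.
move=> z0 r0.
have n0 : 0 < normc z.
  rewrite lt_neqAle eq_sym; apply/andP; split.
    by apply: contra z0 => /eqP /eq0_normc ->.
  by case: (z) => a b /=; exact: sqrtr_ge0.
have r0' : r != 0 by rewrite gt_eqF.
rewrite /clog /carg normc_realM// cReM cImM /= !mulr0 subr0 add0r pmulr_lge0//.
by rewrite invfM mulrACA divff// mulr1 lnM ?posrE//; apply: complexP => /=;
  rewrite ?addr0.
Qed.

End ClogScaling.

Section HankelSeries.
Variable R : realType.
Local Notation C := R[i].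
Variable k : C.
Hypothesis k0 : 0 < complex.Re k.
Hypothesis k1 : 0 <= complex.Im k.

Definition bessel_ratio : C := - (k / 2) ^+ 2.

(* Coefficients of [J_0(k r)] and of the non-logarithmic part of [pi/2 Y_0(k r)]
   as power series in [r ^+ 2]. *)
Definition J0_coef (m : nat) : C := bessel_ratio ^+ m / (m`!%:R) ^+ 2.
Definition Y0_coef (m : nat) : C := - ((series (@harmonic R) m)%:C * J0_coef m).

Lemma norm1X (z : C) n : norm1 (z ^+ n) <= norm1 z ^+ n.
Proof.
elim: n => [|n ih]; first by rewrite !expr0 (norm1_real 1) normr1.
rewrite !exprS (le_trans (norm1M _ _))// ler_wpM2l//; exact: norm1_ge0.
Qed.

Lemma natrC_inv (n : nat) : (n%:R : C)^-1 = (n%:R^-1)%:C.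
Proof. by rewrite fmorphV rmorph_nat. Qed.

Lemma J0_coefE m : J0_coef m = ((m`!%:R ^+ 2)^-1)%:C * bessel_ratio ^+ m.
Proof. by rewrite /J0_coef mulrC fmorphV rmorphXn rmorph_nat. Qed.

Lemma exp_bounded_J0 : exp_bounded J0_coef.
Proof.
exists 1, (norm1 bessel_ratio); split; rewrite ?norm1_ge0// => m.
have f1 : (1 : R) <= m`!%:R by rewrite ler1n fact_gt0.
have f0 := lt_le_trans ltr01 f1.
rewrite J0_coefE norm1_realM mul1r ger0_norm ?invr_ge0 ?sqr_ge0// mulrC.
apply: ler_pM; rewrite ?norm1_ge0 ?invr_ge0 ?sqr_ge0//; first exact: norm1X.
by rewrite lef_pV2 ?posrE ?exprn_gt0// expr2 ler_peMl// ltW.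
Qed.

(** A crude bound is enough, since the factorials absorb a factor m. *)
Lemma harmonic_le m : 0 <= series (@harmonic R) m <= m%:R.
Proof.
elim: m => [|m /andP[ih1 ih2]]; first by rewrite /series/= big_geq// lexx.
have h0 : 0 <= @harmonic R m by rewrite /harmonic/= invr_ge0.
have h1 : @harmonic R m <= 1 by rewrite /harmonic/= invf_le1 ?ltr0n// ler1n.
have -> : series (@harmonic R) m.+1 = series (@harmonic R) m + harmonic m.
  by rewrite /series/= big_nat_recr.
apply/andP; split; first exact: addr_ge0.
by rewrite -[m.+1%:R]natr1; exact: lerD.
Qed.

Lemma exp_bounded_Y0 : exp_bounded Y0_coef.
Proof.
have [A [B [A0 B0 h]]] := exp_bounded_nat exp_bounded_J0.
exists A, B; split => // m; apply: le_trans (h m).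
have /andP[h1 h2] := harmonic_le m.
by rewrite norm1N norm1_realM norm1_natM ger0_norm// ler_wpM2r ?norm1_ge0.
Qed.

(** Coefficient form of Bessel's equation (x d/dx)^2 J = rho x J in the variable x = r^2, where rho
    is [bessel_ratio]. *)
Lemma J0_coefS m : m.+1%:R ^+ 2 * J0_coef m.+1 = bessel_ratio * J0_coef m.
Proof.
rewrite /J0_coef factS natrM [bessel_ratio ^+ _]exprS.
have n0 : (m.+1%:R : C) != 0 by rewrite pnatr_eq0.
have f0 : (m`!%:R : C) != 0 by rewrite pnatr_eq0 -lt0n fact_gt0.
move: (m.+1%:R : C) (m`!%:R : C) n0 f0 => p q p0 q0.
by field; rewrite q0 p0.
Qed.

(** The increment 1 / (m + 1) of the harmonic numbers leaves an inhomogeneous term, the derivative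
    of the J_0 series, which the logarithm in [hank] will compensate. *)
Lemma Y0_coefS m : m.+1%:R ^+ 2 * Y0_coef m.+1 =
  bessel_ratio * Y0_coef m - cdiffs J0_coef m.
Proof.
have sS : series (@harmonic R) m.+1 = series (@harmonic R) m + m.+1%:R^-1.
  by rewrite /series/= big_nat_recr.
rewrite /Y0_coef /cdiffs sS rmorphD/=.
have n0 : (m.+1%:R : C) != 0 by rewrite pnatr_eq0.
have -> : (m.+1%:R^-1)%:C = (m.+1%:R : C)^-1 by rewrite natrC_inv.
have := J0_coefS m; set a := J0_coef m.+1; set b := J0_coef m => e.
move: (m.+1%:R : C) n0 e => p p0 e.
have -> : bessel_ratio * - ((series harmonic m)%:C * b) =
   - ((series harmonic m)%:C * (p ^+ 2 * a)).
  by rewrite e; ring.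
by field.
Qed.

Definition J0s := cps J0_coef.
Definition Y0s := cps Y0_coef.
(* [x d/dx] of the above. *)
Definition tJ0s := cps (fun m => m%:R * J0_coef m).
Definition tY0s := cps (fun m => m%:R * Y0_coef m).

Let bJ := exp_bounded_J0.
Let bY := exp_bounded_Y0.

Lemma J0s_derive x : x != 0 -> cderive J0s x (x^-1%:C * tJ0s x).
Proof.
move=> x0; apply: cderive_eq (cps_derive x bJ) _.
rewrite /tJ0s -cps_shift//; last exact: exp_bounded_nat.
by rewrite mulrA -rmorphM/= mulVf// mul1r.
Qed.

Lemma Y0s_derive x : x != 0 -> cderive Y0s x (x^-1%:C * tY0s x).
Proof.
move=> x0; apply: cderive_eq (cps_derive x bY) _.
rewrite /tY0s -cps_shift//; last exact: exp_bounded_nat.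
by rewrite mulrA -rmorphM/= mulVf// mul1r.
Qed.

Lemma tJ0s_derive x : cderive tJ0s x (bessel_ratio * J0s x).
Proof.
apply: cderive_eq (cps_derive x (exp_bounded_nat bJ)) _.
rewrite -cpsZ//; last exact: exp_boundedZ.
by apply: eq_cps => m; rewrite /cdiffs mulrA -expr2 J0_coefS.
Qed.

Lemma tY0s_derive x : x != 0 ->
  cderive tY0s x (bessel_ratio * Y0s x - x^-1%:C * tJ0s x).
Proof.
move=> x0; apply: cderive_eq (cps_derive x (exp_bounded_nat bY)) _.
rewrite /tJ0s -cps_shift//; last exact: exp_bounded_nat.
rewrite mulrA -rmorphM/= mulVf// mul1r -mulN1r.
have b1 := exp_boundedZ bessel_ratio bY.
have b2 := exp_boundedZ (-1) (exp_bounded_diffs bJ).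
rewrite -cpsZ// -(cpsZ (c := -1) _ (exp_bounded_diffs bJ))// -cpsD//.
  by apply: eq_cps => m; rewrite /cdiffs mulrA -expr2 Y0_coefS mulN1r.
exact: exp_boundedD.
Qed.

Lemma J0s0 : J0s 0 = 1.
Proof. by rewrite /J0s cps0// /J0_coef expr0 fact0 expr1n divr1. Qed.
Lemma Y0s0 : Y0s 0 = 0.
Proof. by rewrite /Y0s cps0// /Y0_coef /series/= big_geq// mul0r oppr0. Qed.
Lemma tJ0s0 : tJ0s 0 = 0.
Proof. by rewrite /tJ0s cps0 ?mul0r//; exact: exp_bounded_nat. Qed.
Lemma tY0s0 : tY0s 0 = 0.
Proof. by rewrite /tY0s cps0 ?mul0r//; exact: exp_bounded_nat. Qed.

Lemma ratio_powE (r : R) m : (-1) ^+ m * (k * r%:C / 2) ^+ (2 * m) =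
  bessel_ratio ^+ m * (r ^+ 2)%:C ^+ m.
Proof.
rewrite exprM -!exprMn; congr (_ ^+ _).
by rewrite /bessel_ratio rmorphXn/=; ring.
Qed.

Lemma besselJ0E (r : R) : besselJ0 (k * r%:C) = J0s (r ^+ 2).
Proof.
apply: ccvg_limn.
have := cps_cvg (r ^+ 2) bJ; congr ccvg; apply/funext => n.
by rewrite /series/=; apply: eq_bigr => m _; rewrite ratio_powE /J0_coef mulrAC.
Qed.

Lemma besselY0_seriesE (r : R) :
  limn (series (fun m : nat =>
     (-1) ^+ m.+1 * (series (@harmonic R) m)%:C * (k * r%:C / 2) ^+ (2 * m) /
     (m`!%:R) ^+ 2 : R[i]^o)) = Y0s (r ^+ 2).
Proof.
apply: ccvg_limn.
have := cps_cvg (r ^+ 2) bY; congr ccvg; apply/funext => n.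
rewrite /Y0_coef; move: (series (@harmonic R)) => H.
rewrite /series/=; apply: eq_bigr => m _.
rewrite [(-1) ^+ m.+1]exprS mulN1r !mulNr /J0_coef; congr (- _).
rewrite (mulrAC ((-1) ^+ m)) ratio_powE.
by move: (m`!%:R ^+ 2)^-1 => ?; ring.
Qed.

Definition hankel_const : C := clog (k / 2) + (euler_gamma R)%:C.

(* [pi/2 H_0(k r)] and [r d/dr] of it. *)
Definition hank (r : R) : C := (pi / 2)%:C * J0s (r ^+ 2) +
  'i%C * ((hankel_const + (ln r)%:C) * J0s (r ^+ 2) + Y0s (r ^+ 2)).
Definition thank (r : R) : C := (pi / 2)%:C * (2 * tJ0s (r ^+ 2)) +
  'i%C * (J0s (r ^+ 2) + (hankel_const + (ln r)%:C) * (2 * tJ0s (r ^+ 2))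
    + 2 * tY0s (r ^+ 2)).

Lemma k_neq0 : k != 0.
Proof. by apply: contraTneq k0 => ->; rewrite ltxx. Qed.

Lemma hankelE (r : R) : 0 < r ->
  hankel1_0 (k * r%:C) = (2 / pi)%:C * hank r.
Proof.
move=> r0; rewrite /hankel1_0 /besselY0 besselJ0E besselY0_seriesE.
have -> : clog (k * r%:C / 2) = clog (k / 2) + (ln r)%:C.
  rewrite mulrAC clog_realM// mulf_neq0// ?k_neq0//.
have e : (2 / pi)%:C * (pi / 2)%:C = 1 :> C.
  rewrite -rmorphM/= -[RHS]/(1%:C); congr (_%:C).
  by rewrite mulrA divfK ?divff ?lt0r_neq0 ?pi_gt0.
rewrite /hank /hankel_const [RHS]mulrDr (mulrA _ (pi / 2)%:C) e mul1r.
by congr (_ + _); rewrite mulrCA (addrAC _ _ (ln r)%:C).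
Qed.

Lemma cderive_sqr f x a : cderive f (x ^+ 2) a ->
  cderive (fun r : R => f (r ^+ 2)) x ((2 * x)%:C * a).
Proof.
move=> h; apply: (cderive_comp (u := fun r => r ^+ 2) h).
apply: is_derive_eq (isd_mul (isd_id x) (isd_id x)) _; ring.
Qed.

Lemma inv2r (x : R) : x != 0 -> 2 * x * (x ^+ 2)^-1 = 2 / x.
Proof. by move=> x0; field. Qed.

Lemma real2 : (2 : R)%:C = 2 :> C.
Proof. by rewrite rmorph_nat. Qed.

Lemma hankel_const_derive (r : R) : 0 < r ->
  cderive (fun r => hankel_const + (ln r)%:C) r r^-1%:C.
Proof.
move=> r0; apply: cderive_eq (cderiveD (cderive_cst _ _) (cderive_real _)) _.
- exact: is_derive1_ln.
- by rewrite add0r.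
Qed.

Lemma hank_derive (r : R) : 0 < r -> cderive hank r (r^-1%:C * thank r).
Proof.
move=> r0; have r0' : r != 0 by rewrite gt_eqF.
have r20 : r ^+ 2 != 0 by rewrite sqrf_eq0.
have dJ := cderive_sqr (J0s_derive r20).
have dY := cderive_sqr (Y0s_derive r20).
apply: cderive_eq (cderiveD (cderiveZ _ dJ)
  (cderiveZ _ (cderiveD (cderiveM (hankel_const_derive r0) dJ) dY))) _.
have e : (2 * r)%:C * (r ^- 2)%:C = 2 * r^-1%:C :> C.
  by rewrite -real2 -!rmorphM/= inv2r.
rewrite /thank !(mulrA (2 * r)%:C) e.
ring.
Qed.

(** With [hank_derive] this is Bessel's equation as a system. The terms in [tJ0s] divided by r have
    coefficients 2 from J_0, 2 from the logarithm and - 4 from [tY0s], and cancel. *)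
Lemma thank_derive (r : R) : 0 < r ->
  cderive thank r (- (k ^+ 2 * (r%:C * hank r))).
Proof.
move=> r0; have r0' : r != 0 by rewrite gt_eqF.
have r20 : r ^+ 2 != 0 by rewrite sqrf_eq0.
have dJ := cderive_sqr (J0s_derive r20).
have dtJ := cderiveZ 2 (cderive_sqr (tJ0s_derive (r ^+ 2))).
have dtY := cderiveZ 2 (cderive_sqr (tY0s_derive r20)).
apply: cderive_eq (cderiveD (cderiveZ _ dtJ)
  (cderiveZ _ (cderiveD (cderiveD dJ (cderiveM (hankel_const_derive r0) dtJ)) dtY))) _.
rewrite /hank.
have -> : k ^+ 2 = - (4 * bessel_ratio).
  by rewrite /bessel_ratio; field.
have -> : (2 * r)%:C = 2 * r%:C by rewrite rmorphM/= real2.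
have -> : (r ^+ 2)^-1%:C = r^-1%:C * r^-1%:C by rewrite -rmorphM/= -expr2 exprVn.
have e : r%:C * r^-1%:C = 1 :> C by rewrite -rmorphM/= divff.
move: (r%:C : C) (r^-1%:C : C) e => p q e.
set J := J0s _; set Y := Y0s _; set tJ := tJ0s _.
set L := hankel_const + _.
have -> : 2 * p * (q * q * tJ) = 2 * q * tJ.
  transitivity (p * q * (2 * q * tJ)); first by ring.
  by rewrite e mul1r.
have -> : 2 * (2 * p * (bessel_ratio * Y - q * q * tJ)) =
   4 * p * bessel_ratio * Y - 4 * q * tJ.
  transitivity (4 * p * bessel_ratio * Y - p * q * (4 * q * tJ)); first by ring.
  by rewrite e mul1r.
ring.
Qed.

Lemma ln_mul_le (r : R) : 0 < r <= 1 -> `|ln r| * r <= 1.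
Proof.
move=> /andP[r0 r1]; rewrite ler0_norm ?ln_le0// -lnV ?posrE//.
by rewrite -ler_pdivlMr// mul1r ltW// ln_sublinear// invr_gt0.
Qed.

(** The four power series are Lipschitz in x = r^2, so they differ from their values at 0 by O(r^2),
    which leaves room for the factor ln r. *)
Lemma hank_near0 : exists2 A : R, 0 <= A & forall r : R, 0 < r <= 1 ->
  norm1 (hank r - ((pi / 2)%:C + 'i%C * (hankel_const + (ln r)%:C))) <= A * r /\
  norm1 (thank r - 'i%C) <= A * r.
Proof.
have [BJ BJ0 hJ] := cps_lipschitz 1 bJ.
have [BY BY0 hY] := cps_lipschitz 1 bY.
have [CJ CJ0 gJ] := cps_lipschitz 1 (exp_bounded_nat bJ).
have [CY CY0 gY] := cps_lipschitz 1 (exp_bounded_nat bY).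
have p0 : 0 < pi / 2 :> R by rewrite divr_gt0// pi_gt0.
set p := (pi / 2 : R) in p0 *.
set h := norm1 hankel_const; have h0 : 0 <= h by exact: norm1_ge0.
exists (p * BJ + (h + 1) * BJ + BY + (2 * p * CJ + BJ + 2 * (h + 1) * CJ + 2 * CY)).
  have pp := ltW p0.
  nonneg.
move=> r r01; have /andP[r0 r1] := r01.
have r2 : r ^+ 2 <= r by rewrite expr2 -[leRHS]mulr1 ler_wpM2l// ltW.
have r20 : 0 <= r ^+ 2 <= 1 by rewrite sqr_ge0 (le_trans r2).
have r00 : 0 <= (0 : R) <= 1 by rewrite lexx ler01.
have := hJ _ _ r20 r00; have := hY _ _ r20 r00.
have := gJ _ _ r20 r00; have := gY _ _ r20 r00.
rewrite -/J0s -/Y0s -/tJ0s -/tY0s J0s0 Y0s0 tJ0s0 tY0s0 !subr0.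
rewrite (ger0_norm (sqr_ge0 r)).
set x := r ^+ 2; set a := tY0s x; set b := tJ0s x; set c := Y0s x; set d := J0s x - 1.
move=> na nb nc nd.
have X (B : R) (z : C) : 0 <= B -> norm1 z <= B * x -> norm1 z <= B * r.
  by move=> B0 /le_trans; apply; rewrite ler_wpM2l.
(* One of the two factors r in x absorbs the logarithm. *)
have L (B : R) (z : C) : 0 <= B -> norm1 z <= B * x ->
    norm1 ((hankel_const + (ln r)%:C) * z) <= (h + 1) * B * r.
  move=> B0 zB; rewrite (le_trans (norm1M _ _))//.
  rewrite (le_trans (ler_wpM2r _ (norm1D _ _))) ?norm1_ge0// norm1_real -/h.
  rewrite (mulrDl h `|ln r|) (mulrDl h 1) mul1r (mulrDl (h * B)) lerD//.
    by rewrite -mulrA ler_wpM2l//; exact: X.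
  rewrite (le_trans (ler_wpM2l _ zB))// mulrCA ler_wpM2l// /x expr2 mulrA.
  by rewrite ler_piMl ?(ltW r0)// ln_mul_le.
have n2 (z : C) : norm1 (2 * z) = 2 * norm1 z by rewrite norm1_natM.
have nI (z : C) : norm1 ('i%C * z) <= norm1 z.
  by rewrite (le_trans (norm1M _ _))// norm1_i mul1r.
have nP (z : C) : norm1 (p%:C * z) = p * norm1 z.
  by rewrite norm1_realM gtr0_norm.
have rr := ltW r0.
have Jd : J0s x = d + 1 by rewrite /d subrK.
split.
- have -> : hank r - (p%:C + 'i%C * (hankel_const + (ln r)%:C)) =
    p%:C * d + 'i%C * ((hankel_const + (ln r)%:C) * d + c).
    by rewrite /hank -/p -/x -/c Jd; move: (p%:C : C) (d : C) {nd Jd} => P d'; ring.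
  have l1 := L _ _ BJ0 nd; have l2 := X _ _ BY0 nc.
  have l3 := X _ _ BJ0 nd.
  rewrite (le_trans (norm1D _ _))// nP.
  rewrite (le_trans (lerD (lexx _) (le_trans (nI _) (norm1D _ _))))//.
  have l4 : p * norm1 d <= p * (BJ * r) by rewrite ler_wpM2l// ltW.
  have q1 : 0 <= p * CJ * r by nonneg.
  have q2 : 0 <= (h + 1) * CJ * r by nonneg.
  have q3 : 0 <= BJ * r by nonneg.
  have q4 : 0 <= CY * r by nonneg.
  lra.
- have -> : thank r - 'i%C = p%:C * (2 * b) +
     'i%C * (d + 2 * ((hankel_const + (ln r)%:C) * b) + 2 * a).
    by rewrite /thank -/p -/x -/b -/a Jd; move: (p%:C : C) (d : C) {nd Jd} => P d'; ring.
  have l1 := L _ _ CJ0 nb; have l2 := X _ _ CY0 na.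
  have l3 := X _ _ BJ0 nd; have l4 := X _ _ CJ0 nb.
  rewrite (le_trans (norm1D _ _))// nP.
  rewrite (le_trans (lerD (lexx _) (le_trans (nI _) (norm1D _ _))))//.
  have := norm1D d (2 * ((hankel_const + (ln r)%:C) * b)).
  rewrite !n2.
  have l5 : p * (2 * norm1 b) <= p * (2 * (CJ * r)) by rewrite ler_wpM2l ?(ltW p0)// ler_wpM2l.
  have q1 : 0 <= p * BJ * r by nonneg.
  have q2 : 0 <= (h + 1) * BJ * r by nonneg.
  have q3 : 0 <= BY * r by nonneg.
  lra.
Qed.

End HankelSeries.

(** * Laplace integrals *)

Section Laplace.
Variable R : realType.
Local Notation C := R[i].
Local Notation mu := (@lebesgue_measure R).
Local Notation D := (`[0, +oo[%classic : set R).

Lemma cvgr_expN (c : R) : 0 < c -> expR (- c * s) @[s --> +oo%R] --> (0 : R).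
Proof.
move=> c0; have h : c * s @[s --> +oo%R] --> (+oo%R : set_system R).
  by apply: gt0_cvgMry => //; exact: cvg_id.
have := cvg_comp _ _ h (@cvgr_expR R).
by apply: cvg_trans; apply: near_eq_cvg; near=> s; rewrite /= mulNr.
Unshelve. all: end_near. Qed.

Lemma integrable_expN (c : R) : 0 < c ->
  mu.-integrable D (fun s => (expR (- c * s))%:E).
Proof.
move=> c0; have c0' : c != 0 by rewrite gt_eqF.
have dF (s : R) : is_derive s 1 (fun s => - c^-1 * expR (- c * s)) (expR (- c * s)).
  apply: is_derive_eq (isd_mul (isd_cst (- c^-1) s) (isd_expM (- c) s)) _.
  by rewrite mul0r add0r mulrA mulrNN mulVf// mul1r.
have ce (s : R) : {for s, continuous (fun s => expR (- c * s))}.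
  exact: isd_cont (isd_expM (- c) s).
have me : measurable_fun D (fun s : R => expR (- c * s)).
  apply: subspace_continuous_measurable_fun => //.
  by apply: continuous_in_subspaceT => s _; exact: ce.
apply/integrableP; split; first exact/measurable_EFinP.
under eq_integral do rewrite /= ger0_norm ?expR_ge0//.
rewrite (@ge0_continuous_FTC2y _ _ (fun s => - c^-1 * expR (- c * s)) _ (- c^-1 * 0)).
- by rewrite -EFinB ltry.
- by move=> s _; exact: expR_ge0.
- by apply: continuous_in_subspaceT => s _; exact: ce.
- by apply: cvgMr; exact: cvgr_expN.
- by move=> s _; have [] := dF s.
- by apply: cvg_at_right_filter; exact: isd_cont (dF 0).
- by move=> s _; rewrite derive1E; have [] := dF s.
Qed.

(* Bound for [1 - s / sqrt (1 + s^2)]. *)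
Lemma integrable_inv_sqr : mu.-integrable D (fun s => (2 * ((1 + s) ^+ 2)^-1)%:E).
Proof.
have dF (s : R) : 0 <= s -> is_derive s 1 (fun s => - 2 * (1 + s)^-1) (2 * ((1 + s) ^+ 2)^-1).
  move=> s0; have s1 : 1 + s != 0 by rewrite gt_eqF// ltr_wpDr.
  have h : is_derive s 1 (fun s : R => 1 + s) 1.
    by apply: is_derive_eq (isd_add (isd_cst 1 s) (isd_id s)) _; rewrite add0r.
  apply: is_derive_eq (isd_mul (isd_cst (- 2) s) (isd_comp (isd_inv s1) h)) _.
  by rewrite mul0r add0r mul1r mulrNN.
have ce (s : R) : 0 <= s -> {for s, continuous (fun s : R => 2 * ((1 + s) ^+ 2)^-1)}.
  move=> s0; have s1 : (1 + s) ^+ 2 != 0 by rewrite sqrf_eq0 gt_eqF// ltr_wpDr.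
  apply: cvgMr; apply: cvgV => //; apply: cvgM; apply: cvgD;
    by [exact: cvg_cst|exact: cvg_id].
have me : measurable_fun D (fun s : R => 2 * ((1 + s) ^+ 2)^-1).
  apply: subspace_continuous_measurable_fun => //.
  by apply: continuous_in_subspaceT => s; rewrite inE/= in_itv/= andbT => s0; exact: ce.
apply/integrableP; split; first exact/measurable_EFinP.
under eq_integral do rewrite /= ger0_norm ?mulr_ge0 ?invr_ge0 ?sqr_ge0//.
rewrite (@ge0_continuous_FTC2y _ _ (fun s => - 2 * (1 + s)^-1) _ (- 2 * 0)).
- by rewrite -EFinB ltry.
- by move=> s _; rewrite mulr_ge0 ?invr_ge0 ?sqr_ge0.
- by apply: continuous_in_subspaceT => s; rewrite inE/= in_itv/= andbT => s0; exact: ce.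
- apply: cvgMr; apply/gtr0_cvgV0.
    by near=> s; rewrite ltr_wpDr.
  exact: cvg_addrl.
- by move=> s /ltW s0; have [] := dF s s0.
- by apply: cvg_at_right_filter; exact: isd_cont (dF 0 _).
- by move=> s; rewrite in_itv/= andbT => /ltW s0; rewrite derive1E; have [] := dF s s0.
Unshelve. all: end_near. Qed.

(** Growth slower than every exponential: exactly what makes the Laplace integrand integrable for
    all r > 0, and stable under multiplication by s, hence under differentiation in r. *)
Definition subexp (p : R -> C) := forall a : R, 0 < a ->
  exists2 B : R, 0 <= B & forall s : R, 0 <= s -> norm1 (p s) <= B * expR (a * s).

Lemma subexp_bounded (p : R -> C) (b : R) :
  (forall s : R, 0 <= s -> norm1 (p s) <= b) -> subexp p.
Proof.
move=> pb a a0; exists b; first exact: le_trans (norm1_ge0 _) (pb 0 (lexx _)).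
move=> s s0; rewrite (le_trans (pb _ s0))// ler_peMr//.
  exact: le_trans (norm1_ge0 _) (pb _ s0).
by rewrite -expR0 ler_expR mulr_ge0// ltW.
Qed.

Lemma subexpM_id (p : R -> C) (c : C) :
  subexp p -> subexp (fun s => c * s%:C * p s).
Proof.
move=> hp a a0; have a20 : 0 < a / 2 by rewrite divr_gt0.
have [B B0 hB] := hp _ a20.
exists (norm1 c * (2 / a) * B).
  by rewrite !mulr_ge0 ?norm1_ge0 ?invr_ge0// ltW.
move=> s s0; rewrite -mulrA (le_trans (norm1M _ _))// -!mulrA ler_wpM2l ?norm1_ge0//.
rewrite norm1_realM ger0_norm//.
have -> : expR (a * s) = expR (a / 2 * s) * expR (a / 2 * s).
  by rewrite -expRD; congr expR; field.
rewrite (le_trans (ler_wpM2l s0 (hB _ s0)))//.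
rewrite mulrCA [leRHS](_ : _ = B * (2 / a * expR (a / 2 * s) * expR (a / 2 * s))); last by ring.
rewrite ler_wpM2l// ler_wpM2r ?expR_ge0//.
rewrite mulrC -ler_pdivrMr ?divr_gt0// invf_div mulrC.
by have := expR_ge1Dx (a / 2 * s); lra.
Qed.

Variable k : C.
Hypothesis k0 : 0 < complex.Re k.

Definition lapl (p : R -> C) (r s : R) : C := p s * cexp (- (k * (r * s)%:C)).

Lemma norm1_cexp_lapl r s : norm1 (cexp (- (k * (r * s)%:C))) <=
  2 * expR (- (complex.Re k * r) * s).
Proof.
by rewrite (le_trans (norm1_cexp _))// cReN cReM /= mulr0 subr0 mulNr mulrA.
Qed.

Lemma cderive_cexp_lin (c : C) (x : R) :
  cderive (fun y : R => cexp (c * y%:C)) x (c * cexp (c * x%:C)).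
Proof.
apply: cderive_exp.
apply: cderive_eq (cderiveZ c (cderive_real (isd_id x))) _.
by rewrite mulr1.
Qed.

Lemma cexp_lapl_derive_s (r s : R) :
  cderive (fun s : R => cexp (- (k * (r * s)%:C))) s
    (- (k * r%:C) * cexp (- (k * (r * s)%:C))).
Proof.
have e (x : R) : - (k * (r * x)%:C) = - (k * r%:C) * x%:C.
  by rewrite rmorphM/= mulNr mulrA.
rewrite e; under eq_fun do rewrite e; exact: cderive_cexp_lin.
Qed.

Lemma cexp_lapl_derive_r (r s : R) :
  cderive (fun r : R => cexp (- (k * (r * s)%:C))) r
    (- (k * s%:C) * cexp (- (k * (r * s)%:C))).
Proof.
have e (x : R) : - (k * (x * s)%:C) = - (k * s%:C) * x%:C.
  by rewrite rmorphM/= mulNr mulrA mulrAC.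
rewrite e; under eq_fun do rewrite e; exact: cderive_cexp_lin.
Qed.

Lemma cmeasurable_lapl p (r : R) : cmeasurable D p -> cmeasurable D (lapl p r).
Proof.
move=> mp; apply: cmeasurableM => //.
apply: ccontinuous_cmeasurable => // s _; apply: cderive_cont.
exact: cexp_lapl_derive_s.
Qed.

Lemma cintegrable_lapl p (r : R) : cmeasurable D p -> subexp p -> 0 < r ->
  cintegrable mu D (lapl p r).
Proof.
move=> mp sp r0; have kr : 0 < complex.Re k * r by rewrite mulr_gt0.
have kr2 : 0 < complex.Re k * r / 2 by rewrite divr_gt0.
have [B B0 hB] := sp _ kr2.
apply: (@cintegrable_le _ _ _ mu D (lapl p r) (fun s : R => 2 * B * expR (- (complex.Re k * r / 2) * s))) => //.
- exact: cmeasurable_lapl.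
- by apply: integrableZ_fin => //; exact: integrable_expN.
- move=> s; rewrite /= in_itv/= andbT => s0.
  rewrite (le_trans (norm1M _ _))//.
  rewrite (le_trans (ler_pM (norm1_ge0 _) (norm1_ge0 _) (hB _ s0) (norm1_cexp_lapl _ _)))//.
  rewrite mulrACA (mulrC B) -expRD.
  rewrite le_eqVlt; apply/orP; left; apply/eqP; congr (_ * expR _).
  by field.
Qed.

Lemma lapl_derive p (r : R) : cmeasurable D p -> subexp p -> 0 < r ->
  cderive (fun r => cint mu D (lapl p r)) r
    (cint mu D (lapl (fun s => - k * s%:C * p s) r)).
Proof.
move=> mp sp r0.
have sp' := subexpM_id (- k) sp.
(* For x > r / 2 the exponential decays at rate at least Re k (r / 2); half of that rate pays for
   the growth of the weight. *)
have kr2 : 0 < complex.Re k * (r / 2) / 2 by rewrite divr_gt0// mulr_gt0// divr_gt0.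
have [B B0 hB] := sp' _ kr2.
apply: (@cderive_under _ _ _ mu D _ _ r (r / 2) (r + 1)
  (fun s : R => 2 * B * expR (- (complex.Re k * (r / 2) / 2) * s))) => //.
- by rewrite ltr_pdivrMr// mulrDr mulr1 ltrDl r0/= ltrDl.
- move=> x /andP[x0 _]; apply: cintegrable_lapl => //.
  by apply: lt_trans x0; rewrite divr_gt0.
- move=> x s _ _.
  apply: cderive_eq (cderiveZ (p s) (cexp_lapl_derive_r _ _)) _.
  by rewrite /lapl; ring.
- by apply: integrableZ_fin => //; exact: integrable_expN.
- move=> x s /andP[x0 _]; rewrite /= in_itv/= andbT => s0.
  rewrite (le_trans (norm1M _ _))//.
  rewrite (le_trans (ler_pM (norm1_ge0 _) (norm1_ge0 _) (hB _ s0) (norm1_cexp_lapl _ _)))//.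
  rewrite mulrACA (mulrC B) -expRD ler_wpM2l ?mulr_ge0//.
  rewrite ler_expR.
  have : complex.Re k * (r / 2) * s <= complex.Re k * x * s.
    by rewrite ler_wpM2r// ler_wpM2l// ltW.
  lra.
Qed.

Lemma lapl_cvg0 p (r : R) : subexp p -> 0 < r ->
  norm1 (lapl p r s) @[s --> +oo%R] --> (0 : R).
Proof.
move=> sp r0.
have kr2 : 0 < complex.Re k * r / 2 by rewrite divr_gt0// mulr_gt0.
have [B B0 hB] := sp _ kr2.
have h : 2 * B * expR (- (complex.Re k * r / 2) * s) @[s --> +oo%R] --> (0 : R).
  by rewrite -[0](mulr0 (2 * B)); apply: cvgMr; exact: cvgr_expN.
apply: (squeeze_cvgr _ (cvg_cst (0 : R)) h).
near=> s; rewrite norm1_ge0/=.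
have s0 : 0 <= s by near: s; exact: nbhs_pinfty_ge.
rewrite (le_trans (norm1M _ _))//.
rewrite (le_trans (ler_pM (norm1_ge0 _) (norm1_ge0 _) (hB _ s0) (norm1_cexp_lapl _ _)))//.
rewrite mulrACA (mulrC B) -expRD.
rewrite le_eqVlt; apply/orP; left; apply/eqP; congr (_ * expR _).
by field.
Unshelve. all: end_near. Qed.

End Laplace.

(** * The Laplace integral with weight 1 / sqrt (1 + s^2) *)

Section StruveWeight.
Variable R : realType.
Local Notation C := R[i].
Local Notation mu := (@lebesgue_measure R).
Local Notation D := (`[0, +oo[%classic : set R).
Implicit Types (s r : R).

Definition hyp s : R := Num.sqrt (1 + s ^+ 2).
Definition wgt s : R := (hyp s)^-1.

Lemma hyp_ge1 s : 1 <= hyp s.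
Proof. by rewrite -[leLHS]sqrtr1 ler_wsqrtr// lerDl sqr_ge0. Qed.

Lemma hyp_gt0 s : 0 < hyp s.
Proof. exact: lt_le_trans ltr01 (hyp_ge1 s). Qed.

Lemma hyp_sqr s : hyp s ^+ 2 = 1 + s ^+ 2.
Proof. by rewrite sqr_sqrtr// addr_ge0// sqr_ge0. Qed.

Lemma hyp_le s : 0 <= s -> hyp s <= 1 + s.
Proof.
move=> s0; rewrite -(@ler_pXn2r _ 2)// ?nnegrE ?(ltW (hyp_gt0 s)) ?addr_ge0//.
rewrite hyp_sqr sqrrD expr1n; lra.
Qed.

Lemma hyp_ge s : s <= hyp s.
Proof.
have [s0|/ltW s0] := leP 0 s; last exact: le_trans s0 (ltW (hyp_gt0 s)).
rewrite -(@ler_pXn2r _ 2)// ?nnegrE ?(ltW (hyp_gt0 s))// hyp_sqr; lra.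
Qed.

Lemma wgt_gt0 s : 0 < wgt s.
Proof. by rewrite invr_gt0 hyp_gt0. Qed.

Lemma wgt_le1 s : wgt s <= 1.
Proof. by rewrite invf_le1 ?hyp_gt0 ?hyp_ge1. Qed.

Lemma wgt_hyp s : wgt s * hyp s = 1.
Proof. by rewrite mulVf// gt_eqF ?hyp_gt0. Qed.

Lemma hypE s : hyp s = (1 + s ^+ 2) * wgt s.
Proof. by rewrite -hyp_sqr expr2 -mulrA (mulrC (hyp s) (wgt s)) wgt_hyp mulr1. Qed.

Lemma wgt_s_le1 s : s * wgt s <= 1.
Proof. by rewrite ler_pdivrMr ?hyp_gt0// mul1r hyp_ge. Qed.

(** With h = sqrt (1 + s^2): (h - s) (h + s) = 1 and (1 + s)^2 <= 2 h (h + s). *)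
Lemma onem_wgt_le s : 0 <= s -> 1 - s * wgt s <= 2 * ((1 + s) ^+ 2)^-1.
Proof.
move=> s0; have h0 := hyp_gt0 s; have s1 : 0 < 1 + s by rewrite ltr_wpDr.
rewrite ler_pdivlMr ?exprn_gt0// -(@ler_pM2r _ (hyp s))//.
have -> : (1 - s * wgt s) * (1 + s) ^+ 2 * hyp s = (hyp s - s) * (1 + s) ^+ 2.
  by rewrite -[hyp s - s](_ : hyp s - s * (wgt s * hyp s) = _); [ring|rewrite wgt_hyp mulr1].
have h2 : (1 + s) ^+ 2 <= 2 * (hyp s * (hyp s + s)).
  have := hyp_sqr s; have : 0 <= hyp s * s by rewrite mulr_ge0// ltW.
  have : 0 <= (1 - s) ^+ 2 by rewrite sqr_ge0.
  lra.
have h3 : 0 <= hyp s - s by rewrite subr_ge0 hyp_ge.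
rewrite (le_trans (ler_wpM2l h3 h2))// le_eqVlt; apply/orP; left; apply/eqP.
transitivity (2 * hyp s * (hyp s ^+ 2 - s ^+ 2)); first by ring.
by rewrite hyp_sqr; ring.
Qed.

Lemma hyp_derive s : is_derive s 1 hyp (s * wgt s).
Proof.
have p0 : 0 < 1 + s ^+ 2 by rewrite ltr_pwDl ?sqr_ge0.
have h : is_derive s 1 (fun s => 1 + s ^+ 2) (2 * s).
  apply: is_derive_eq (isd_add (isd_cst 1 s) (isd_mul (isd_id s) (isd_id s))) _; ring.
have := isd_comp (f := Num.sqrt) (g := fun s : R => 1 + s ^+ 2) (is_derive1_sqrt p0) h.
rewrite -/(hyp s) -/(wgt s) => /is_derive_eq; apply.
by rewrite /wgt; have := hyp_gt0 s => h0; field; rewrite gt_eqF.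
Qed.

Lemma wgt_continuous s : {for s, continuous wgt}.
Proof.
by apply: cvgV; [rewrite gt_eqF ?hyp_gt0|exact: isd_cont (hyp_derive s)].
Qed.

Lemma cmeasurable_wgt (A : set R) : measurable A -> cmeasurable A (fun s => (wgt s)%:C).
Proof.
move=> mA; apply: ccontinuous_cmeasurable => // s _.
by apply: ccontinuous_real; exact: wgt_continuous.
Qed.

Lemma subexp_wgt : subexp (fun s => (wgt s)%:C).
Proof.
apply: (subexp_bounded (b := 1)) => s _.
by rewrite norm1_real ger0_norm ?wgt_le1// ltW// wgt_gt0.
Qed.

Lemma subexp_hyp (c : C) : subexp (fun s => c * (hyp s)%:C).
Proof.
move=> a a0; exists (norm1 c * (1 + a^-1)).
  by rewrite mulr_ge0 ?norm1_ge0// addr_ge0// invr_ge0 ltW.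
move=> s s0; rewrite (le_trans (norm1M _ _))// -mulrA ler_wpM2l ?norm1_ge0//.
rewrite norm1_real (ger0_norm (ltW (hyp_gt0 s))) (le_trans (hyp_le s0))// mulrDl mul1r.
have e1 := expR_ge1Dx (a * s).
have as0 : 0 <= a * s by rewrite mulr_ge0// ltW.
apply: lerD; first by move: e1; lra.
by rewrite mulrC ler_pdivlMr// mulrC; move: e1; lra.
Qed.

Lemma cmeasurable_idM (A : set R) (c : C) (p : R -> C) : measurable A ->
  cmeasurable A p -> cmeasurable A (fun s => c * s%:C * p s).
Proof.
move=> mA mp; apply: cmeasurableM => //; apply: cmeasurableM.
  exact: cmeasurable_cst.
apply: ccontinuous_cmeasurable => // s _.
by apply: ccontinuous_real; exact: cvg_id.
Qed.

Variable k : C.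
Hypothesis k0 : 0 < complex.Re k.

(* [int_0^oo e^{-k r s} / sqrt (1 + s^2) ds] and [r d/dr] of it. *)
Definition Gint r : C := cint mu D (lapl k (fun s => (wgt s)%:C) r).
Definition tGint r : C :=
  r%:C * cint mu D (lapl k (fun s => - k * s%:C * (wgt s)%:C) r).

Let m0 : cmeasurable D (fun s => (wgt s)%:C).
Proof. exact: cmeasurable_wgt. Qed.
Let m1 : cmeasurable D (fun s => - k * s%:C * (wgt s)%:C).
Proof. exact: cmeasurable_idM. Qed.
Let m2 : cmeasurable D (fun s => - k * s%:C * (- k * s%:C * (wgt s)%:C)).
Proof. exact: cmeasurable_idM. Qed.
Let e0 := subexp_wgt.
Let e1 := subexpM_id (- k) e0.
Let e2 := subexpM_id (- k) e1.

Lemma Gint_derive r : 0 < r -> cderive Gint r (r^-1%:C * tGint r).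
Proof.
move=> r0; apply: cderive_eq (lapl_derive k0 m0 e0 r0) _.
by rewrite /tGint mulrA -rmorphM/= mulVf ?gt_eqF// mul1r.
Qed.

(* The integrand is the derivative of [- k sqrt (1 + s^2) e^{-k r s}]. *)
Lemma Gint_identity r : 0 < r ->
  cint mu D (lapl k (fun s => - k * s%:C * (wgt s)%:C) r) +
  r%:C * cint mu D (lapl k (fun s => - k * s%:C * (- k * s%:C * (wgt s)%:C)) r) +
  k ^+ 2 * (r%:C * Gint r) = k.
Proof.
move=> r0.
have i0 := cintegrable_lapl k0 m0 e0 r0.
have i1 := cintegrable_lapl k0 m1 e1 r0.
have i2 := cintegrable_lapl k0 m2 e2 r0.
have i2' := cintegrable_lapl k0 m2 e2 r0.
rewrite mulrA /Gint -!cintZ//.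
rewrite -cintD//; last exact: cintegrableZ.
rewrite -cintD//; last 2 first.
- by apply: cintegrableD => //; exact: cintegrableZ.
- exact: cintegrableZ.
(* Only the endpoint s = 0 contributes, with value k because [hyp 0] is 1. *)
rewrite (@cftc_infty _ (lapl k (fun s => - k * (hyp s)%:C) r)).
- rewrite /lapl /hyp expr0n addr0 sqrtr1 mulr0 mulr0 oppr0 cexp0 !mulr1.
  by rewrite opprK.
- move=> s _; apply: cderive_eq (cderiveM (cderiveZ (- k) (cderive_real (hyp_derive s)))
    (cexp_lapl_derive_s k r s)) _.
  have -> : (hyp s)%:C = (1 + s%:C ^+ 2) * (wgt s)%:C :> C.
    by rewrite hypE rmorphM rmorphD rmorph1 rmorphXn.
  have -> : (s * wgt s)%:C = s%:C * (wgt s)%:C :> C by rewrite rmorphM.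
  rewrite /lapl; move: (cexp _) (s%:C : C) ((wgt s)%:C : C) (r%:C : C) => *; ring.
- move=> s _.
  have cs : ccontinuous_at (fun s : R => s%:C) s by apply: ccontinuous_real; exact: cvg_id.
  have cw : ccontinuous_at (fun s : R => (wgt s)%:C) s.
    by apply: ccontinuous_real; exact: wgt_continuous.
  have cid (p : R -> C) : ccontinuous_at p s -> ccontinuous_at (fun s => - k * s%:C * p s) s.
    move=> cp; exact: ccontinuousM (ccontinuousM (ccontinuous_cst _ _) cs) cp.
  have ce p : ccontinuous_at p s -> ccontinuous_at (lapl k p r) s.
    move=> cp; exact: ccontinuousM cp (cderive_cont (cexp_lapl_derive_s k r s)).
  have cZ (c : C) p : ccontinuous_at p s -> ccontinuous_at (fun s => c * p s) s.
    move=> cp; exact: ccontinuousM (ccontinuous_cst c s) cp.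
  exact: ccontinuousD (ccontinuousD (ce _ (cid _ cw)) (cZ _ _ (ce _ (cid _ (cid _ cw)))))
    (cZ _ _ (ce _ cw)).
- apply: cintegrableD => //; last exact: cintegrableZ.
  by apply: cintegrableD => //; exact: cintegrableZ.
- exact: lapl_cvg0 (subexp_hyp _) r0.
Qed.

Lemma tGint_derive r : 0 < r -> cderive tGint r (k - k ^+ 2 * (r%:C * Gint r)).
Proof.
move=> r0.
apply: cderive_eq (cderiveM (cderive_real (isd_id r)) (lapl_derive k0 m1 e1 r0)) _.
by rewrite -[X in _ = X - _](Gint_identity r0) addrK mul1r.
Qed.

End StruveWeight.

(** * Angular integrals *)

Section AngularIntegral.
Variable R : realType.
Local Notation C := R[i].
Local Notation mu := (@lebesgue_measure R).
Local Notation D := (`[0, pi / 2]%classic : set R).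
Implicit Types (t r : R).
Variable k : C.
Hypothesis k0 : 0 < complex.Re k.
Hypothesis k1 : 0 <= complex.Im k.

Definition angl (p : R -> C) (r t : R) : C := p t * cexp ('i%C * k * (r * cos t)%:C).

Lemma angl_exp_derive_r r t : cderive (fun r => cexp ('i%C * k * (r * cos t)%:C)) r
  ('i%C * k * (cos t)%:C * cexp ('i%C * k * (r * cos t)%:C)).
Proof.
have e (x : R) : 'i%C * k * (x * cos t)%:C = 'i%C * k * (cos t)%:C * x%:C.
  by rewrite rmorphM/= (mulrC x%:C) mulrA.
rewrite e; under eq_fun do rewrite e; exact: cderive_cexp_lin.
Qed.

Lemma angl_exp_derive_t r t : cderive (fun t => cexp ('i%C * k * (r * cos t)%:C)) t
  ('i%C * k * (r * - sin t)%:C * cexp ('i%C * k * (r * cos t)%:C)).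
Proof.
have h : is_derive t 1 (fun t => r * cos t) (r * - sin t).
  apply: is_derive_eq (isd_mul (isd_cst r t) (is_derive_cos t)) _.
  by rewrite mul0r add0r.
exact: cderive_exp (cderiveZ _ (cderive_real h)).
Qed.

Definition everywhere_cont (p : R -> C) := forall t, ccontinuous_at p t.

Lemma everywhere_cont_cosM (c : C) p : everywhere_cont p ->
  everywhere_cont (fun t => c * (cos t)%:C * p t).
Proof.
move=> cp t.
have hc := ccontinuous_real (isd_cont (is_derive_cos t)).
exact: ccontinuousM (ccontinuousM (ccontinuous_cst _ _) hc) (cp t).
Qed.

Lemma angl_cont p r t : everywhere_cont p -> ccontinuous_at (angl p r) t.
Proof.
by move=> cp; exact: ccontinuousM (cp t) (cderive_cont (angl_exp_derive_t r t)).
Qed.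

Lemma cintegrable_angl p r : everywhere_cont p -> cintegrable mu D (angl p r).
Proof. by move=> cp; apply: ccontinuous_cintegrable => t _; exact: angl_cont. Qed.

Lemma norm1_angl_exp r t : norm1 (cexp ('i%C * k * (r * cos t)%:C)) <=
  2 * expR (- (complex.Im k * (r * cos t))).
Proof.
rewrite (le_trans (norm1_cexp _))// cReM cReM /= !mul0r mulr0 subr0 sub0r mul1r.
by rewrite mulNr.
Qed.

Lemma angl_derive p r : everywhere_cont p ->
  cderive (fun r => cint mu D (angl p r)) r
    (cint mu D (angl (fun t => 'i%C * k * (cos t)%:C * p t) r)).
Proof.
move=> cp; have cp' := everywhere_cont_cosM ('i%C * k) cp.
have [B B0 hB] : exists2 B : R, 0 <= B &
    forall t : R, 0 <= t <= pi / 2 -> norm1 ('i%C * k * (cos t)%:C * p t) <= B.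
  exact: ccontinuous_bounded.
apply: (@cderive_under _ _ _ mu D _ _ r (r - 1) (r + 1)
  (fun t => B * (2 * expR (complex.Im k * (`|r| + 1))))) => //.
- by rewrite ltrBlDr !ltrDl ltr01.
- by move=> x _; exact: cintegrable_angl.
- move=> x t _ _; apply: cderive_eq (cderiveZ (p t) (angl_exp_derive_r x t)) _.
  by rewrite /angl; ring.
- apply: continuous_itv_integrable => t _; exact: cvg_cst.
- move=> x t /andP[x0 x1]; rewrite /= in_itv/= => t01.
  rewrite (le_trans (norm1M _ _))//.
  apply: ler_pM; rewrite ?norm1_ge0//; first exact: hB.
  rewrite (le_trans (norm1_angl_exp _ _))// ler_wpM2l// ler_expR -mulrN ler_wpM2l//.
  rewrite (le_trans (ler_norm _))// normrN normrM.
  have hx : `|x| <= `|r| + 1.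
    by rewrite -(subrK r x) addrC (le_trans (ler_normD _ _))// lerD2l ler_norml; lra.
  by rewrite (le_trans (ler_piMr _ (cos_max t)))// normr_ge0.
Qed.

Definition Ein r : C := cint mu D (angl (fun=> 1) r).
Definition tEin r : C :=
  r%:C * cint mu D (angl (fun t => 'i%C * k * (cos t)%:C * 1) r).

Let c0 : everywhere_cont (fun=> 1). Proof. by move=> t; exact: ccontinuous_cst. Qed.
Let c1 := everywhere_cont_cosM ('i%C * k) c0.
Let c2 := everywhere_cont_cosM ('i%C * k) c1.

Lemma Ein_derive r : 0 < r -> cderive Ein r (r^-1%:C * tEin r).
Proof.
move=> r0; apply: cderive_eq (angl_derive r c0) _.
by rewrite /tEin mulrA -rmorphM/= mulVf ?gt_eqF// mul1r.
Qed.

(* The integrand is the derivative of [i k sin t e^{i k r cos t}]. *)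
Lemma Ein_identity r :
  cint mu D (angl (fun t => 'i%C * k * (cos t)%:C * 1) r) +
  r%:C * cint mu D (angl (fun t => 'i%C * k * (cos t)%:C * ('i%C * k * (cos t)%:C * 1)) r) +
  k ^+ 2 * (r%:C * Ein r) = 'i%C * k.
Proof.
have i0 := cintegrable_angl r c0.
have i1 := cintegrable_angl r c1.
have i2 := cintegrable_angl r c2.
rewrite mulrA /Ein -!cintZ//.
rewrite -cintD//; last exact: cintegrableZ.
rewrite -cintD//; last 2 first.
- by apply: cintegrableD => //; exact: cintegrableZ.
- exact: cintegrableZ.
rewrite (@cftc_itv _ (fun t => 'i%C * k * (sin t)%:C * cexp ('i%C * k * (r * cos t)%:C))).
- rewrite sin_pihalf cos_pihalf sin0 !mulr0 cexp0 mul0r subr0 mulr1.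
  by rewrite rmorph1 mulr1.
- by rewrite divr_ge0// pi_ge0.
- move=> t _; apply: cderive_eq (cderiveM (cderiveZ ('i%C * k)
     (cderive_real (is_derive_sin t))) (angl_exp_derive_t r t)) _.
  have -> : (r * - sin t)%:C = - (r%:C * (sin t)%:C) :> C by rewrite mulrN rmorphN rmorphM.
  have sc : (sin t)%:C * (sin t)%:C = 1 - (cos t)%:C * (cos t)%:C :> C.
    have := cos2Dsin2 t => cs.
    by apply: complexP => /=; [move: cs|]; lra.
  rewrite /angl; move: (cexp _) (r%:C : C) => e z.
  have i2' : 'i%C * 'i%C = -1 :> C by rewrite -expr2 sqr_i.
  move: ('i%C : C) i2' ((sin t)%:C : C) ((cos t)%:C : C) sc => j j2 s c sc.
  transitivity (j * k * c * e - j * j * k * k * z * (s * s) * e); first by ring.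
  rewrite sc j2.
  transitivity (j * k * c * e + (j * j) * (k * k * z * c * c * e) + k * k * z * e); last by ring.
  by rewrite j2; ring.
- move=> t _.
  have cZ (c : C) p : ccontinuous_at p t -> ccontinuous_at (fun s => c * p s) t.
    move=> cp; exact: ccontinuousM (ccontinuous_cst c t) cp.
  exact: ccontinuousD (ccontinuousD (angl_cont r t c1) (cZ _ _ (angl_cont r t c2)))
    (cZ _ _ (angl_cont r t c0)).
Qed.

Lemma tEin_derive r : cderive tEin r ('i%C * k - k ^+ 2 * (r%:C * Ein r)).
Proof.
apply: cderive_eq (cderiveM (cderive_real (isd_id r)) (angl_derive r c1)) _.
by rewrite -[X in _ = X - _](Ein_identity r) addrK mul1r.
Qed.

Definition Hint r : C := Ein r - 'i%C * Gint k r.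
Definition tHint r : C := tEin r - 'i%C * tGint k r.

Lemma Hint_derive r : 0 < r -> cderive Hint r (r^-1%:C * tHint r).
Proof.
move=> r0; apply: cderive_eq (cderiveB (Ein_derive r0) (cderiveZ 'i%C (Gint_derive k0 r0))) _.
by rewrite /tHint; ring.
Qed.

(** The inhomogeneous terms cancel: the angular integral leaves i k, and - i times the Laplace
    integral leaves - i k. *)
Lemma tHint_derive r : 0 < r -> cderive tHint r (- (k ^+ 2 * (r%:C * Hint r))).
Proof.
move=> r0; apply: cderive_eq (cderiveB (tEin_derive r) (cderiveZ 'i%C (tGint_derive k0 r0))) _.
by rewrite /Hint; ring.
Qed.

(** Since Im k >= 0 and cos t >= 0 on [0, pi/2], the exponentials are bounded uniformly in t and r
    >= 0, and so are the mean value estimates. *)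
Lemma Ein_near0 : exists2 A : R, 0 <= A & forall r, 0 < r <= 1 ->
  norm1 (Ein r - (pi / 2)%:C) <= A * r /\ norm1 (tEin r) <= A * r.
Proof.
have N0 := norm1_ge0 k; set N := norm1 k in N0.
have p0 : 0 <= pi / 2 :> R by rewrite divr_ge0// pi_ge0.
have muD : fine (mu D) = pi / 2.
  by rewrite lebesgue_measure_itv/= lte_fin divr_gt0 ?pi_gt0// sube0.
have mD : measurable D by [].
have icst (c : R) : mu.-integrable D (fun=> c%:E).
  by apply: continuous_itv_integrable => t _; exact: cvg_cst.
have ibnd (f : R -> C) (B : R) : cintegrable mu D f ->
    (forall t, 0 <= t <= pi / 2 -> norm1 (f t) <= B) -> norm1 (cint mu D f) <= B * (pi / 2).
  move=> If fB; have <- : Rintegral mu D (fun=> B) = B * (pi / 2).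
    by rewrite Rintegral_cst// muD.
  by apply: (norm1_cint_le (u := fun=> B) _ If (icst B)) => // t; rewrite /= in_itv/=; exact: fB.
have cosr t : 0 <= t <= pi / 2 -> 0 <= cos t <= 1.
  move=> /andP[t0 t1]; rewrite cos_le1 andbT; apply: cos_ge0_pihalf.
  by rewrite t1 andbT (le_trans _ t0)// oppr_le0.
have eb r t : 0 <= r -> 0 <= t <= pi / 2 -> norm1 (cexp ('i%C * k * (r * cos t)%:C)) <= 2.
  move=> r0 /cosr/andP[h0 h1]; rewrite (le_trans (norm1_angl_exp _ _))//.
  rewrite -[leRHS]mulr1 ler_wpM2l// -expR0 ler_expR oppr_le0.
  by rewrite mulr_ge0// mulr_ge0.
have mb (c : R) : 0 <= c <= 1 -> norm1 ('i%C * k * c%:C) <= N.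
  move=> /andP[h0 h1]; rewrite mulrC norm1_realM ger0_norm//.
  rewrite (le_trans (ler_wpM2l h0 (norm1M _ _)))// norm1_i mul1r.
  by rewrite ler_piMl.
have I1 : cintegrable mu D (fun=> 1) by split; exact: icst.
exists (4 * N * (pi / 2)); first nonneg.
move=> r /andP[r0 r1]; have r0' := ltW r0; split.
- have -> : Ein r - (pi / 2)%:C = cint mu D (fun t => angl (fun=> 1) r t - 1).
    rewrite (cintB _ (cintegrable_angl r c0) I1)//.
    congr (_ - _); apply: complexP => /=; by rewrite Rintegral_cst// ?mul1r ?mul0r// muD.
  rewrite mulrAC; apply: ibnd.
    exact: cintegrableB (cintegrable_angl r c0) I1.
  move=> t t01; rewrite /angl mul1r.
  (* The constant 1 is the exponential at r = 0, which opens the way to the mean value bound on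
     [0, r]. *)
  have -> : 1 = cexp ('i%C * k * (0 * cos t)%:C) by rewrite mul0r mulr0 cexp0.
  have := @cderive_mvt _ (fun r => cexp ('i%C * k * (r * cos t)%:C)) _ 0 r (2 * N) r0'
     (fun x _ => angl_exp_derive_r x t).
  rewrite subr0 (_ : 2 * (2 * N) * r = 4 * N * r); last by ring.
  apply => x /andP[x0 _]; rewrite (le_trans (norm1M _ _))// mulrC.
  by apply: ler_pM; rewrite ?norm1_ge0//; [exact: eb|exact/mb/cosr].
- rewrite /tEin norm1_realM ger0_norm// mulrC ler_wpM2r//.
  apply: ibnd; first exact: cintegrable_angl.
  move=> t t01; rewrite /angl mulr1 (le_trans (norm1M _ _))//.
  rewrite (le_trans (ler_pM (norm1_ge0 _) (norm1_ge0 _) (mb _ (cosr _ t01)) (eb _ _ r0' t01)))//.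
  by rewrite mulrC ler_wpM2r// ler_nat.
Qed.

End AngularIntegral.

(** * Behaviour at the origin and Euler's constant *)

Section GintNearZero.
Variable R : realType.
Local Notation C := R[i].
Local Notation mu := (@lebesgue_measure R).
Local Notation D := (`[0, +oo[%classic : set R).
Implicit Types (s r t : R).

Definition inv_sqr_mass : R := Rintegral mu D (fun s => 2 * ((1 + s) ^+ 2)^-1).

Lemma inv_sqr_mass_ge0 : 0 <= inv_sqr_mass.
Proof. by apply: Rintegral_ge0 => s _; rewrite mulr_ge0// invr_ge0 sqr_ge0. Qed.

Lemma norm1_cexp_lapl2 (k : C) r s : 0 < complex.Re k -> 0 <= r -> 0 <= s ->
  norm1 (cexp (- (k * (r * s)%:C))) <= 2.
Proof.
move=> k0 r0 s0; rewrite (le_trans (norm1_cexp_lapl _ _ _))//.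
rewrite -[leRHS]mulr1 ler_wpM2l// -expR0 ler_expR mulNr oppr_le0; nonneg.
Qed.

(** Serves to write the constant in [tGint_near0] as an integral of the same type as [tGint]. *)
Lemma lapl_one (k : C) r : 0 < complex.Re k -> 0 < r ->
  cint mu D (lapl k (fun=> k * r%:C) r) = 1.
Proof.
move=> k0 r0.
rewrite (@cftc_infty _ (lapl k (fun=> -1) r)).
- by rewrite /lapl mulr0 mulr0 oppr0 cexp0 mulr1 opprK.
- move=> s _; apply: cderive_eq (cderiveZ (-1) (cexp_lapl_derive_s k r s)) _.
  by rewrite /lapl; ring.
- by move=> s _; exact: ccontinuousM (ccontinuous_cst _ s) (cderive_cont (cexp_lapl_derive_s k r s)).
- apply: cintegrable_lapl => //.
  by apply: (subexp_bounded (b := norm1 (k * r%:C))).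
- by apply: lapl_cvg0 => //; apply: (subexp_bounded (b := norm1 (-1 : C))).
Qed.

(** After [lapl_one] the integrand is k r (1 - s / sqrt (1 + s^2)) e^(- k r s), and the bracket is
    integrable, so a full factor r comes out. *)
Lemma tGint_near0 (k : C) r : 0 < complex.Re k -> 0 < r ->
  norm1 (tGint k r + 1) <= 2 * norm1 k * inv_sqr_mass * r.
Proof.
move=> k0 r0; have r0' := ltW r0.
have mw := cmeasurable_wgt (R := R) (A := D) (measurable_itv _).
have i1 := cintegrable_lapl k0 (cmeasurable_idM (- k) (measurable_itv _) mw)
   (subexpM_id (- k) (@subexp_wgt R)) r0.
have i2 : cintegrable mu D (lapl k (fun=> k * r%:C) r).
  apply: cintegrable_lapl => //.
  by apply: (subexp_bounded (b := norm1 (k * r%:C))).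
rewrite -(lapl_one k0 r0) /tGint -cintZ// -cintD//; last exact: cintegrableZ.
have -> : 2 * norm1 k * inv_sqr_mass * r =
    Rintegral mu D (fun s => 2 * norm1 k * r * (2 * ((1 + s) ^+ 2)^-1)).
  by rewrite RintegralZl//; [rewrite mulrAC|exact: integrable_inv_sqr].
apply: norm1_cint_le => //.
- by apply: cintegrableD => //; exact: cintegrableZ.
- by apply: integrableZ_fin => //; exact: integrable_inv_sqr.
move=> s; rewrite /= in_itv/= andbT => s0.
have -> : r%:C * lapl k (fun s => - k * s%:C * (wgt s)%:C) r s + lapl k (fun=> k * r%:C) r s =
    (r * (1 - s * wgt s))%:C * (k * cexp (- (k * (r * s)%:C))).
  have -> : (r * (1 - s * wgt s))%:C = r%:C * (1 - s%:C * (wgt s)%:C) :> C.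
    by apply: complexP => /=; ring.
  by rewrite /lapl; move: (cexp _) => e; ring.
rewrite norm1_realM ger0_norm; last by rewrite mulr_ge0// subr_ge0 wgt_s_le1.
have h1 := onem_wgt_le s0.
have h2 : norm1 (k * cexp (- (k * (r * s)%:C))) <= norm1 k * 2.
  rewrite (le_trans (norm1M _ _))// ler_wpM2l ?norm1_ge0//.
  exact: norm1_cexp_lapl2.
have h3 : 0 <= 1 - s * wgt s by rewrite subr_ge0 wgt_s_le1.
rewrite (le_trans (ler_pM _ (norm1_ge0 _) (ler_wpM2l r0' h1) h2)) ?mulr_ge0//.
by rewrite le_eqVlt; apply/orP; left; apply/eqP; ring.
Qed.

(** As Im k >= 0, the sine of the argument is the nonnegative root Im k / |k|. *)
Lemma cexp_clog (k : C) : 0 < complex.Re k -> 0 <= complex.Im k ->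
  cexp (clog k) = k.
Proof.
case: k => a b /= a0 b0.
have n0 : 0 < Num.sqrt (a ^+ 2 + b ^+ 2).
  by rewrite sqrtr_gt0 ltr_wpDr ?sqr_ge0// exprn_gt0.
set n := Num.sqrt _ in n0 *.
have nn : n ^+ 2 = a ^+ 2 + b ^+ 2 by rewrite sqr_sqrtr// addr_ge0 ?sqr_ge0.
have h1 : -1 <= a / n <= 1.
  rewrite -ler_norml normrM (gtr0_norm (_ : 0 < n^-1)) ?invr_gt0//.
  rewrite ler_pdivrMr// mul1r -sqrtr_sqr ler_wsqrtr// lerDl sqr_ge0//.
have sn : Num.sqrt (1 - (a / n) ^+ 2) = b / n.
  have -> : 1 - (a / n) ^+ 2 = (b / n) ^+ 2.
    have n0' : n != 0 by rewrite gt_eqF.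
    rewrite !exprMn; apply: (mulIf (_ : n ^+ 2 != 0)); first by rewrite sqrf_eq0.
    by rewrite mulrBl mul1r exprVn !mulfVK ?sqrf_eq0// nn; ring.
  by rewrite sqrtr_sqr ger0_norm// divr_ge0// ltW.
rewrite /clog /carg /cexp /= b0 -/n lnK ?posrE// acosK// sin_acos// sn.
by congr (_ +i* _); rewrite mulrC divfK ?gt_eqF.
Qed.

Lemma carg_lt_pihalf (k : C) : 0 < complex.Re k -> 0 <= complex.Im k ->
  0 <= carg k < pi / 2.
Proof.
case: k => a b /= a0 b0.
have n0 : 0 < Num.sqrt (a ^+ 2 + b ^+ 2).
  by rewrite sqrtr_gt0 ltr_wpDr ?sqr_ge0// exprn_gt0.
rewrite /carg /= b0; set n := Num.sqrt _ in n0 *.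
have h1 : -1 <= a / n <= 1.
  rewrite -ler_norml normrM (gtr0_norm (_ : 0 < n^-1)) ?invr_gt0//.
  rewrite ler_pdivrMr// mul1r -sqrtr_sqr ler_wsqrtr// lerDl sqr_ge0//.
(* An argument of at least pi/2 would make sin (arg - pi/2) = - Re k / |k| nonnegative. *)
rewrite acos_ge0//= ltNge; apply/negP => h.
have : 0 <= sin (acos (a / n) - pi / 2).
  apply: sin_ge0_pi; rewrite subr_ge0 h/= lerBlDr.
  by rewrite (le_trans (acos_lepi h1))// lerDl divr_ge0// pi_ge0.
rewrite sinB cos_pihalf sin_pihalf mulr0 mulr1 sub0r acosK//.
by rewrite oppr_ge0 leNgt divr_gt0.
Qed.

(** In place of a contour rotation, k is joined to 1 by k_t = e^(t clog k). Since [Gint] depends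
    only on the product k r, its derivative in t is clog k times [tGint]; adding t clog k leaves a
    derivative of size O(r) by [tGint_near0]. *)
Lemma Gint_clog (k : C) r : 0 < complex.Re k -> 0 <= complex.Im k -> 0 < r ->
  norm1 (Gint k r - Gint 1 r + clog k) <=
    4 * norm1 (clog k) * expR `|ln (normc k)| * inv_sqr_mass * r *2.
Proof.
move=> k0 k1 r0; set l := clog k.
pose kt t : C := cexp (l * t%:C).
have Rekt t : complex.Re (kt t) = expR (ln (normc k) * t) * cos (carg k * t).
  by rewrite /kt /cexp /l /clog /= !mulr0 subr0 add0r.
have /andP[th0 th1] := carg_lt_pihalf k0 k1.
(* The path stays in the half plane Re > 0 because its argument is t times that of k. *)
have kt0 t : 0 <= t <= 1 -> 0 < complex.Re (kt t).
  move=> /andP[t0 t1]; rewrite Rekt mulr_gt0 ?expR_gt0// cos_gt0_pihalf//.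
  have : carg k * t <= carg k by rewrite ler_piMr.
  have : 0 <= carg k * t by rewrite mulr_ge0.
  have := pi_gt0 R; lra.
have dkt t : cderive kt t (l * kt t) by exact: cderive_cexp_lin.
have kt_norm t : 0 <= t <= 1 -> norm1 (kt t) <= 2 * expR `|ln (normc k)|.
  move=> /andP[t0 t1]; rewrite (le_trans (norm1_cexp _))// ler_wpM2l// ler_expR.
  rewrite cReM /= mulr0 subr0 (le_trans (ler_norm _))// normrM (ger0_norm t0).
  by rewrite ler_piMr.
have dG t : 0 <= t <= 1 -> cderive (fun t => Gint (kt t) r) t (l * tGint (kt t) r).
  move=> t01; have Rt := kt0 t t01.
  have ct : {for t, continuous (fun t => complex.Re (kt t))}.
    by have [] := cderive_cont (dkt t).
  have Rt2 : 0 < complex.Re (kt t) / 2 by rewrite divr_gt0.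
  move/cvgrPdist_lt : ct => /(_ _ Rt2)[e e00 he].
  have e0 : 0 < e := e00.
  (* Near t the decay rate stays above c, half of its value at t; half of c is then spent on the
     factor s that differentiation brings down. *)
  pose c := complex.Re (kt t) / 2 * r.
  have c0 : 0 < c by rewrite mulr_gt0.
  pose d := Num.min e 1.
  have d0 : 0 < d by rewrite lt_min e0 ltr01.
  have near_kt x : t - d < x < t + d ->
      complex.Re (kt t) / 2 <= complex.Re (kt x) /\ norm1 (kt x) <= 2 * expR (2 * `|ln (normc k)|).
    move=> /andP[x1 x2]; have de : d <= e by rewrite ge_min lexx.
    have dl : d <= 1 by rewrite ge_min lexx orbT.
    split.
      have bx : ball_ Num.norm t e x by rewrite /ball_ /= ltr_norml; lra.
      have hx : `|complex.Re (kt t) - complex.Re (kt x)| < complex.Re (kt t) / 2 := he x bx.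
      by move: hx; rewrite ltr_norml; lra.
    rewrite (le_trans (norm1_cexp _))// ler_wpM2l// ler_expR.
    rewrite cReM /= mulr0 subr0 (le_trans (ler_norm _))// normrM mulrC ler_wpM2r//.
    by move: t01 => /andP[t0 t1]; rewrite ler_norml; lra.
  pose K := norm1 l * (2 * expR (2 * `|ln (normc k)|)) * r.
  have K0 : 0 <= K.
    rewrite /K; do ?[by []|exact: norm1_ge0|exact: expR_ge0|exact: ltW|apply: mulr_ge0].
  apply: (cderive_eq (a := cint mu D (fun s => (wgt s)%:C *
     (- (l * kt t * (r * s)%:C) * cexp (- (kt t * (r * s)%:C)))))); last first.
    rewrite /tGint mulrA -cintZ//; last first.
      apply: cintegrable_lapl => //.
        by apply: cmeasurable_idM => //; exact: cmeasurable_wgt.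
      by apply: subexpM_id; exact: subexp_wgt.
    by apply: eq_cint => s _; rewrite /lapl (rmorphM _ r s)/=; ring.
  apply: (@cderive_under _ _ _ mu D (fun x s => (wgt s)%:C * cexp (- (kt x * (r * s)%:C)))
    (fun x s => (wgt s)%:C * (- (l * kt x * (r * s)%:C) * cexp (- (kt x * (r * s)%:C))))
    t (t - d) (t + d) (fun s => 2 * K * (2 / c) * expR (- (c / 2) * s))).
  - exact: measurable_itv.
  - by rewrite ltrBlDr !ltrDl d0.
  - move=> x /near_kt[h1 _]; apply: cintegrable_lapl => //.
    + exact: lt_le_trans h1.
    + exact: cmeasurable_wgt.
    + exact: subexp_wgt.
  - move=> x s _ _; apply: cderiveZ.
    have dk : cderive (fun x => - (kt x * (r * s)%:C)) x (- (l * kt x * (r * s)%:C)).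
      apply: cderiveN; apply: cderive_eq (cderiveM (dkt x) (cderive_cst (r * s)%:C x)) _.
      by rewrite mulr0 addr0.
    exact: cderive_exp.
  - by apply: integrableZ_fin => //; apply: integrable_expN; rewrite divr_gt0.
  - move=> x s /near_kt[h1 h2]; rewrite /= in_itv/= andbT => s0.
    rewrite norm1_realM ger0_norm ?(ltW (wgt_gt0 s))//.
    rewrite (le_trans (ler_piMl (norm1_ge0 _) (wgt_le1 s)))//.
    have rs0 : 0 <= r * s by rewrite mulr_ge0// ltW.
    rewrite mulNr norm1N (le_trans (norm1M _ _))//.
    have e1 : norm1 (l * kt x * (r * s)%:C) <= K * s.
      rewrite mulrC norm1_realM ger0_norm// mulrC /K -mulrA ler_wpM2r//.
      by rewrite (le_trans (norm1M _ _))// ler_wpM2l ?norm1_ge0.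
    have e2 : norm1 (cexp (- (kt x * (r * s)%:C))) <= 2 * expR (- c * s).
      rewrite (le_trans (norm1_cexp_lapl _ _ _))// ler_wpM2l// ler_expR !mulNr lerN2.
      by rewrite /c ler_wpM2r// ler_wpM2r// ltW.
    rewrite (le_trans (ler_pM (norm1_ge0 _) (norm1_ge0 _) e1 e2))//.
    have e3 : s * expR (- c * s) <= 2 / c * expR (- (c / 2) * s).
      have -> : - c * s = - (c / 2) * s + - (c / 2 * s) by field.
      rewrite expRD mulrCA mulrC ler_wpM2r ?expR_ge0// expRN.
      rewrite ler_pdivrMr ?expR_gt0// mulrC -ler_pdivrMr ?divr_gt0// invf_div mulrC.
      by have := expR_ge1Dx (c / 2 * s); lra.
    have : 0 <= 2 * K by rewrite mulr_ge0.
    move=> /ler_wpM2l/(_ _ _ e3); lra.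
have mvt := @cderive_mvt _ (fun t => Gint (kt t) r + l * t%:C)
   (fun t => l * (tGint (kt t) r + 1)) 0 1 (norm1 l * (2 * (2 * expR `|ln (normc k)|) * inv_sqr_mass * r)) ler01.
have kt1 : kt 1 = k by rewrite /kt rmorph1 mulr1 cexp_clog.
have kt00 : kt 0 = 1 by rewrite /kt rmorph0 mulr0 cexp0.
have -> : Gint k r - Gint 1 r + l = Gint (kt 1) r + l * 1%:C - (Gint (kt 0) r + l * 0%:C).
  by rewrite kt1 kt00 rmorph0 mulr0 addr0 [l * _]mulr1 addrAC.
rewrite (le_trans (mvt _ _))//.
- move=> t t01; apply: cderive_eq (cderiveD (dG t t01) (cderiveZ l (cderive_real (isd_id t)))) _.
  by rewrite rmorph1 mulrDr.
- move=> t t01; rewrite (le_trans (norm1M _ _))// ler_wpM2l ?norm1_ge0//.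
  rewrite (le_trans (tGint_near0 (kt0 t t01) r0))//.
  rewrite ler_wpM2r ?(ltW r0)// ler_wpM2r ?inv_sqr_mass_ge0// ler_wpM2l//.
  exact: kt_norm.
- by rewrite subr0 le_eqVlt; apply/orP; left; apply/eqP; ring.
Qed.

End GintNearZero.

(** * An integral for Euler's constant *)

Section EulerGamma.
Variable R : realType.
Local Notation mu := (@lebesgue_measure R).
Implicit Types (s r x y : R).

Lemma isd_exp (f : R -> R) x (a : R) n : is_derive x 1 f a ->
  is_derive x 1 (fun y => f y ^+ n.+1) (n.+1%:R * f x ^+ n * a).
Proof.
move=> h; elim: n => [|n ih]; first by rewrite expr0 !mul1r.
have -> : (fun y => f y ^+ n.+2) = (fun y => f y * f y ^+ n.+1).
  by apply/funext => y; rewrite exprS.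
apply: is_derive_eq (isd_mul h ih) _.
by rewrite -[n.+2%:R]natr1 exprS; ring.
Qed.

Lemma isd_sum (f df : nat -> R -> R) x n : (forall i, is_derive x 1 (f i) (df i x)) ->
  is_derive x 1 (fun y => \sum_(0 <= i < n) f i y) (\sum_(0 <= i < n) df i x).
Proof.
move=> h; elim: n => [|n ih].
  rewrite big_geq//; have -> : (fun y => \sum_(0 <= i < 0) f i y) = (fun=> 0).
    by apply/funext => y; rewrite big_geq.
  exact: isd_cst.
have -> : (fun y => \sum_(0 <= i < n.+1) f i y) = (fun y => \sum_(0 <= i < n) f i y + f n y).
  by apply/funext => y; rewrite big_nat_recr.
by rewrite big_nat_recr//=; exact: isd_add.
Qed.

(** With x = y / (n + 1), (1 - x^2) e^(- x) <= 1 - x <= e^(- x); raise this to the power n + 1 and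
    apply Bernoulli's inequality to the first factor. *)
Lemma exp_approx y n : 0 <= y <= n.+1%:R ->
  0 <= (1 - y / n.+1%:R) ^+ n.+1 /\
  (1 - y / n.+1%:R) ^+ n.+1 <= expR (- y) /\
  expR (- y) - (1 - y / n.+1%:R) ^+ n.+1 <= y ^+ 2 / n.+1%:R.
Proof.
move=> /andP[y0 yn]; have n0 : 0 < n.+1%:R :> R by rewrite ltr0n.
set x := y / n.+1%:R.
have x0 : 0 <= x by rewrite divr_ge0// ltW.
have x1 : x <= 1 by rewrite ler_pdivrMr// mul1r.
have ye : y = n.+1%:R * x by rewrite mulrC divfK// gt_eqF.
have b0 : 0 <= 1 - x by rewrite subr_ge0.
have ex : expR (- y) = expR (- x) ^+ n.+1.
  by rewrite -expRM_natl; congr expR; rewrite ye mulrN.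
have le1 : 1 - x <= expR (- x) by have := expR_ge1Dx (- x).
split; first exact: exprn_ge0.
split; first by rewrite ex lerXn2r// nnegrE// expR_ge0.
have le2 : (1 - x ^+ 2) * expR (- x) <= 1 - x.
  have -> : 1 - x ^+ 2 = (1 - x) * (1 + x) by ring.
  rewrite -mulrA ler_piMr// expRN ler_pdivrMr ?expR_gt0// mul1r.
  exact: expR_ge1Dx.
have x21 : x ^+ 2 <= 1 by rewrite expr_le1.
have le3 : (1 - x ^+ 2) ^+ n.+1 * expR (- y) <= (1 - x) ^+ n.+1.
  by rewrite ex -exprMn lerXn2r// nnegrE// mulr_ge0 ?expR_ge0 ?subr_ge0.
have bern m : 1 - m%:R * x ^+ 2 <= (1 - x ^+ 2) ^+ m.
  elim: m => [|m ih]; first by rewrite mul0r subr0 expr0.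
  rewrite [_ ^+ m.+1]exprS.
  have h := ler_wpM2l (_ : 0 <= 1 - x ^+ 2) ih; rewrite subr_ge0 in h.
  apply: le_trans (h x21); rewrite -natr1.
  have : 0 <= m%:R * (x ^+ 2 * x ^+ 2) by rewrite !mulr_ge0 ?sqr_ge0.
  lra.
have e1 : expR (- y) <= 1 by rewrite -expR0 ler_expR oppr_le0.
have nx : y ^+ 2 / n.+1%:R = n.+1%:R * x ^+ 2.
  by rewrite ye; field; rewrite gt_eqF.
rewrite nx.
have := ler_wpM2r (expR_ge0 (- y)) (bern n.+1).
have : 0 <= n.+1%:R * x ^+ 2 by rewrite mulr_ge0 ?sqr_ge0// ltW.
move=> p0; have := ler_wpM2l p0 e1; move: le3; lra.
Qed.

Variable r : R.
Hypothesis r0 : 0 < r.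

Definition gamma_fun s : R := if s < r^-1 then (1 - expR (- (r * s))) / s
  else - expR (- (r * s)) / s.

(** Geometric sum for (1 - (1 - r s / n)^n) / s, written so as to be regular at s = 0. *)
Let q (n : nat) s : R := \sum_(0 <= j < n) (r / n%:R) * (1 - r * s / n%:R) ^+ j.

Let qE n s : (0 < n)%N -> s != 0 -> q n s = (1 - (1 - r * s / n%:R) ^+ n) / s.
Proof.
move=> n0 s0; have n0' : n%:R != 0 :> R by rewrite pnatr_eq0 -lt0n.
rewrite /q -mulr_sumr; set x := 1 - r * s / n%:R.
have := subrX1 x n; rewrite -(big_mkord xpredT (fun i => x ^+ i)) => e.
have -> : 1 - x ^+ n = - (x ^+ n - 1) by rewrite opprB.
rewrite e; have -> : x - 1 = - (r * s / n%:R) by rewrite /x; ring.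
by move: (\sum_(_ <= _ < _) _) => S; field; rewrite s0 n0'.
Qed.

(** On [0, n / r] the base 1 - r s / n runs from 1 to 0, so the j-th power integrates to 1 / (j +
    1). *)
Let q_int (n : nat) : (0 < n)%N ->
  Rintegral mu `[0, n%:R / r] (q n) = series (@harmonic R) n.
Proof.
move=> n0; have n0' : n%:R != 0 :> R by rewrite pnatr_eq0 -lt0n.
have r0' : r != 0 by rewrite gt_eqF.
have dlin s : is_derive s 1 (fun s => 1 - r * s / n%:R) (- (r / n%:R)).
  have := isd_sub (isd_cst 1 s) (isd_mul (isd_mul (isd_cst r s) (isd_id s)) (isd_cst n%:R^-1 s)).
  move=> /is_derive_eq; apply; ring.
have dP s i : is_derive s 1 (fun s => - i.+1%:R^-1 * (1 - r * s / n%:R) ^+ i.+1)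
   ((r / n%:R) * (1 - r * s / n%:R) ^+ i).
  apply: is_derive_eq (isd_mul (isd_cst _ s) (isd_exp i (dlin s))) _.
  have i0 : i.+1%:R != 0 :> R by rewrite pnatr_eq0.
  rewrite mul0r add0r; set z := (1 - _) ^+ i.
  move: z (i.+1%:R : R) i0 => z p p0.
  transitivity (p^-1 * p * (r / n%:R * z)); last by rewrite mulVf// mul1r.
  by move: (r / n%:R) (p^-1) => a b; ring.
have dq s i : is_derive s 1 (fun s => (r / n%:R) * (1 - r * s / n%:R) ^+ i)
    ((r / n%:R) * (if i is j.+1 then i%:R * (1 - r * s / n%:R) ^+ j * - (r / n%:R) else 0)).
  case: i => [|i].
    apply: is_derive_eq (isd_mul (isd_cst _ s) (isd_cst 1 s)) _; rewrite mul0r add0r//.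
  apply: is_derive_eq (isd_mul (isd_cst _ s) (isd_exp i (dlin s))) _.
  by rewrite mul0r add0r.
pose F s := \sum_(0 <= i < n) - i.+1%:R^-1 * (1 - r * s / n%:R) ^+ i.+1.
have -> : Rintegral mu `[0, n%:R / r] (q n) = F (n%:R / r) - F 0.
  apply: (@ftc_itv _ F).
  - by rewrite divr_ge0// ltW.
  - by move=> s _; exact: (isd_sum (df := fun i s => (r / n%:R) * (1 - r * s / n%:R) ^+ i)).
  - by move=> s _; apply: isd_cont; apply: (isd_sum (df := fun i s => (r / n%:R) * (if i is j.+1 then i%:R * (1 - r * s / n%:R) ^+ j * - (r / n%:R) else 0))).
rewrite /F -sumrB; apply: eq_bigr => i _.
rewrite mulr0 mul0r subr0 expr1n mulr1 mulrCA divff// mulr1 divff// subrr.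
by rewrite expr0n mulr0 sub0r opprK.
Qed.

Let inv_int (n : nat) : (0 < n)%N ->
  Rintegral mu `[r^-1, n%:R / r] (fun s => s^-1) = ln n%:R.
Proof.
move=> n0; have n0' : 0 < n%:R :> R by rewrite ltr0n.
have ri : 0 < r^-1 by rewrite invr_gt0.
have -> : ln n%:R = ln (n%:R / r) - ln r^-1 by rewrite lnM ?posrE// addrK.
apply: (@ftc_itv _ (@ln R)).
- by rewrite ler_peMl ?(ltW ri)// ler1n.
- by move=> s /andP[s0 _]; apply: is_derive1_ln; exact: lt_le_trans s0.
- move=> s /andP[s0 _]; apply: isd_cont; apply: isd_inv; rewrite gt_eqF//.
  exact: lt_le_trans s0.
Qed.

Local Notation Dp := (`]0, +oo[%classic : set R).

Let q_cont n s : {for s, continuous (q n)}.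
Proof.
apply: (isd_cont (a := \sum_(0 <= j < n) (r / n%:R) *
   (if j is i.+1 then j%:R * (1 - r * s / n%:R) ^+ i * - (r / n%:R) else 0))).
apply: (isd_sum (df := fun j s => (r / n%:R) *
   (if j is i.+1 then j%:R * (1 - r * s / n%:R) ^+ i * - (r / n%:R) else 0))).
have dlin x : is_derive x 1 (fun s => 1 - r * s / n%:R) (- (r / n%:R)).
  have := isd_sub (isd_cst 1 x) (isd_mul (isd_mul (isd_cst r x) (isd_id x)) (isd_cst n%:R^-1 x)).
  move=> /is_derive_eq; apply; ring.
case=> [|j].
  by apply: is_derive_eq (isd_mul (isd_cst _ s) (isd_cst 1 s)) _; rewrite mul0r add0r.
apply: is_derive_eq (isd_mul (isd_cst _ s) (isd_exp j (dlin s))) _.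
by rewrite mul0r add0r.
Qed.

(** Its integral is H_n - ln n, and it tends to [gamma_fun] pointwise. *)
Let phi (n : nat) s : R :=
  (q n \_ `[0, n%:R / r]) s - ((fun s => s^-1) \_ `[r^-1, n%:R / r]) s.

Let mDp : measurable (Dp : set (measurableTypeR R)). Proof. exact: measurable_itv. Qed.
Let ri : 0 < r^-1. Proof. by rewrite invr_gt0. Qed.

Let int_q n : mu.-integrable `[0, n%:R / r] (fun s => (q n s)%:E).
Proof. by apply: continuous_itv_integrable => s _; exact: q_cont. Qed.

Let int_inv n : mu.-integrable `[r^-1, n%:R / r] (fun s : R => (s^-1)%:E).
Proof.
apply: continuous_itv_integrable => s /andP[s0 _].
by apply: isd_cont; apply: isd_inv; rewrite gt_eqF// (lt_le_trans ri).
Qed.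

Lemma integrable_patch (A B : set (measurableTypeR R)) (f : R -> R) : measurable A -> measurable B ->
  mu.-integrable B (fun s => (f s)%:E) ->
  mu.-integrable A (fun s => ((f \_ B) s)%:E).
Proof.
move=> mA mB If; apply: (@integrableS _ _ _ _ setT) => //.
have -> : (fun s => ((f \_ B) s)%:E) = ((EFin \o f) \_ B).
  by apply/funext => s; rewrite restrict_EFin.
exact: (iffLR (integrable_mkcond (mu := mu) (EFin \o f) mB) If).
Qed.

Let phi_int (n : nat) : (0 < n)%N ->
  Rintegral mu Dp (phi n) = series (@harmonic R) n - ln n%:R.
Proof.
move=> n0; have n0' : 0 < n%:R :> R by rewrite ltr0n.
rewrite RintegralB//; [|exact: integrable_patch..].
rewrite -!Rintegral_mkcondr; congr (_ - _).
- have -> : (Dp `&` `[0, n%:R / r]%classic) = `]0, n%:R / r]%classic.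
    apply/seteqP; split => s /=; rewrite !in_itv/= andbT.
      by move=> [-> /andP[_ ->]].
    by move=> /andP[s0 s1]; rewrite s0 (ltW s0) s1.
  rewrite Rintegral_itv_obnd_cbnd ?q_int//.
  by apply: integrableS (int_q n) => // s; rewrite /= !in_itv/= => /andP[/ltW -> ->].
- have -> : (Dp `&` `[r^-1, n%:R / r]%classic) = `[r^-1, n%:R / r]%classic.
    apply/setIidr => s /=; rewrite !in_itv/= andbT => /andP[s0 _].
    exact: lt_le_trans s0.
  exact: inv_int.
Qed.

Let phiE n s : 0 < s -> r * s <= n.+1%:R ->
  phi n.+1 s = gamma_fun s + (expR (- (r * s)) - (1 - r * s / n.+1%:R) ^+ n.+1) / s.
Proof.
move=> s0 sn; have s0' : s != 0 by rewrite gt_eqF.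
have sn' : s <= n.+1%:R / r by rewrite ler_pdivlMr// mulrC.
rewrite /phi patchT; last by rewrite inE/= in_itv/= (ltW s0) sn'.
rewrite qE// /gamma_fun; have [sr|rs] := ltP s r^-1.
- rewrite patchN; last by apply/negP; rewrite inE/= in_itv/= leNgt sr.
  by rewrite subr0 -mulrDl; congr (_ / _); ring.
- rewrite patchT; last by rewrite inE/= in_itv/= rs sn'.
  by move: (s^-1) ((1 - _) ^+ n.+1) (expR _) => a b c; ring.
Qed.

Let phi_meas n : measurable_fun (Dp : set (measurableTypeR R)) (phi n.+1).
Proof.
apply: measurable_funB; apply/measurable_restrict => //.
    apply: measurable_funS (measurable_itv `[0, n.+1%:R / r]) _ _; first by move=> s [].
    by apply/measurable_EFinP; exact: measurable_int (int_q n.+1).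
  apply: measurable_funS (measurable_itv `[r^-1, n.+1%:R / r]) _ _; first by move=> s [].
  by apply/measurable_EFinP; exact: measurable_int (int_inv n.+1).
Qed.

Let phi_cvg s : Dp s -> phi n.+1 s @[n --> \oo] --> gamma_fun s.
Proof.
rewrite /= in_itv/= andbT => s0; have r0' := ltW r0.
  have rs0 : 0 <= r * s by rewrite mulr_ge0// ltW.
  apply/cvgrPdist_le => e e0; near=> n.
  have n0 : 0 < n.+1%:R :> R by rewrite ltr0n.
  have h1 : r * s <= n.+1%:R.
    rewrite (@le_trans _ _ n%:R)// ?ler_nat//.
    by near: n; exact: nbhs_infty_ger.
  rewrite phiE// opprD addNKr normrN normrM normfV (gtr0_norm s0) ler_pdivrMr//.
  have [|_ [h2 h3]] := @exp_approx (r * s) n; first by rewrite rs0 h1.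
  rewrite ger0_norm ?subr_ge0// (le_trans h3)//.
  have es : 0 < e * s by rewrite mulr_gt0.
  rewrite ler_pdivrMr// -ler_pdivrMl// (@le_trans _ _ n%:R)// ?ler_nat//.
  by near: n; exact: nbhs_infty_ger.
Unshelve. all: end_near. Qed.

(** Below 1 / r the sum [q] is at most r, and e times e^(- r s) is at least 1; between 1 / r and the
    end of the interval |phi| is at most e^(- r s) / s <= r e^(- r s); beyond, phi vanishes. *)
Let dom s : R := r * expR 1 * expR (- r * s).

Let int_dom : mu.-integrable Dp (fun s => (dom s)%:E).
Proof.
  apply: integrableZ_fin; first exact: measurable_itv.
  by apply: integrableS (integrable_expN r0) => // s; rewrite /= !in_itv/= !andbT => /ltW.
Qed.

Let phi_le n s : Dp s -> `|phi n.+1 s| <= dom s.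
Proof.
rewrite /= in_itv/= andbT /dom => s0; have r0' := ltW r0.
  have s0' : s != 0 by rewrite gt_eqF.
  have rs0 : 0 <= r * s by rewrite mulr_ge0// ltW.
  have n0 : 0 < n.+1%:R :> R by rewrite ltr0n.
  have B0 : 0 <= r * expR 1 * expR (- r * s) by rewrite !mulr_ge0 ?expR_ge0.
  have [sn|ns] := leP (r * s) n.+1%:R; last first.
    have sn' : n.+1%:R / r < s by rewrite ltr_pdivrMr// mulrC.
    rewrite /phi !patchN ?subrr ?normr0//; apply/negP; rewrite inE/= in_itv/= => /andP[_];
      by rewrite leNgt sn'.
  have sn' : s <= n.+1%:R / r by rewrite ler_pdivlMr// mulrC.
  have [|h1 [h2 h3]] := @exp_approx (r * s) n; first by rewrite rs0 sn.
  have x1 : (1 - r * s / n.+1%:R) ^+ n.+1 <= 1.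
    by rewrite (le_trans h2)// -expR0 ler_expR oppr_le0.
  rewrite /phi patchT; last by rewrite inE/= in_itv/= (ltW s0) sn'.
  have [sr|rs] := ltP s r^-1.
  + rewrite patchN; last by apply/negP; rewrite inE/= in_itv/= leNgt sr.
    rewrite subr0.
    have b j : 0 <= r / n.+1%:R * (1 - r * s / n.+1%:R) ^+ j <= r / n.+1%:R.
      have p0 : 0 <= r / n.+1%:R by rewrite divr_ge0// ltW.
      have y0 : 0 <= 1 - r * s / n.+1%:R by rewrite subr_ge0 ler_pdivrMr// mul1r.
      rewrite mulr_ge0 ?exprn_ge0//= ler_piMr// exprn_ile1// gerBl.
      by rewrite divr_ge0// ltW.
    have q0 : 0 <= q n.+1 s by apply: sumr_ge0 => j _; case/andP: (b j).
    rewrite ger0_norm// (@le_trans _ _ r)//.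
      rewrite (le_trans (ler_sum _ (fun j _ => proj2 (andP (b j)))))//.
      by rewrite sumr_const_nat subn0 -[leLHS]mulr_natr divfK// gt_eqF.
    rewrite -mulrA ler_peMr// -expRD -[leLHS]expR0 ler_expR mulNr subr_ge0.
    by rewrite -ler_pdivlMl// mulr1 ltW.
  + rewrite patchT; last by rewrite inE/= in_itv/= rs sn'.
    rewrite qE// -[X in _ - X]mul1r -mulrBl addrC addKr mulNr normrN.
    rewrite ger0_norm; last by rewrite divr_ge0// ltW.
    have s1 : s^-1 <= r by rewrite -[r]invrK lef_pV2// posrE.
    rewrite (le_trans (ler_pM h1 _ h2 s1)) ?invr_ge0 ?(ltW s0)//.
    rewrite mulrC mulNr ler_wpM2r ?expR_ge0// ler_peMr//.
    by rewrite -[leLHS]expR0 ler_expR.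
Qed.

Lemma integrable_gamma_fun : mu.-integrable Dp (fun s => (gamma_fun s)%:E).
Proof.
exact: dominated_integrable mDp phi_meas phi_cvg int_dom phi_le.
Qed.

Lemma euler_gammaE : euler_gamma R = Rintegral mu Dp gamma_fun.
Proof.
(* The shift avoids n = 0, where r s / n and ln n take default values. *)
apply: cvg_lim => //; rewrite -(cvg_shiftn 1) /=.
have -> : (fun n => series (@harmonic R) (n + 1)%N - ln (n + 1)%:R) =
    (fun n => Rintegral mu Dp (phi n.+1)).
  by apply/funext => n; rewrite addn1 phi_int.
exact: Rdominated mDp phi_meas phi_cvg int_dom phi_le.
Qed.

End EulerGamma.

Section FiniteIntegrable.
Context d (T : measurableType d) (R : realType).
Variables (mu : {measure set T -> \bar R}) (D : set T) (f g : T -> R).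
Hypothesis mD : measurable D.
Hypothesis If : mu.-integrable D (fun x => (f x)%:E).
Hypothesis Ig : mu.-integrable D (fun x => (g x)%:E).

Lemma integrableD_fin : mu.-integrable D (fun x => (f x + g x)%:E).
Proof. exact: (integrableD mD If Ig). Qed.

Lemma integrableB_fin : mu.-integrable D (fun x => (f x - g x)%:E).
Proof. exact: (integrableB mD If Ig). Qed.

End FiniteIntegrable.

(** * The Laplace integral for k = 1 near the origin *)

Section Gint1.
Variable R : realType.
Local Notation C := R[i].
Local Notation mu := (@lebesgue_measure R).
Local Notation D := (`[0, +oo[%classic : set (measurableTypeR R)).
Local Notation Dp := (`]0, +oo[%classic : set (measurableTypeR R)).
Implicit Types (s r : R).

Let wexp r s : R := wgt s * expR (- (r * s)).

Let lapl1E r s : lapl 1 (fun s => (wgt s)%:C) r s = (wexp r s)%:C.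
Proof.
rewrite /lapl mul1r -rmorphN cexp_real.
by rewrite -rmorphM.
Qed.

Let integrable_wexp r : 0 < r -> mu.-integrable D (fun s => (wexp r s)%:E).
Proof.
move=> r0.
have [h _] := @cintegrable_lapl _ 1 ltr01 (fun s => (wgt s)%:C) r
  (cmeasurable_wgt (measurable_itv _)) (@subexp_wgt R) r0.
apply: eq_integrable h => // s _; by rewrite lapl1E.
Qed.

Let Gint1E r : 0 < r -> Gint 1 r = (Rintegral mu Dp (wexp r))%:C.
Proof.
move=> r0; rewrite Rintegral_itv_obnd_cbnd; last first.
  by apply: integrableS (integrable_wexp r0) => // s; rewrite /= !in_itv/= !andbT => /ltW.
transitivity (cint mu D (fun s => (wexp r s)%:C)).
  by apply: eq_cint => s _; exact: lapl1E.
by apply: complexP => //=; rewrite /Rintegral integral0_eq.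
Qed.

Let asinh_int (a : R) : 0 <= a -> Rintegral mu `[0, a] (@wgt R) = ln (a + hyp a).
Proof.
move=> a0.
have pos s : 0 <= s -> 0 < s + hyp s by move=> s0; rewrite ltr_wpDl// hyp_gt0.
have -> : ln (a + hyp a) = ln (a + hyp a) - ln (0 + hyp 0).
  by rewrite /hyp expr0n addr0 sqrtr1 add0r ln1 subr0.
apply: (@ftc_itv _ (fun s => ln (s + hyp s))) => //.
- move=> s /andP[s0 _].
  have h := isd_comp (f := @ln R) (g := fun s => s + hyp s) (is_derive1_ln (pos s s0))
    (isd_add (isd_id s) (hyp_derive s)).
  apply: is_derive_eq h _.
  rewrite -[X in X + _](wgt_hyp s) (mulrC s) -mulrDr addrC -mulrA divff ?mulr1//.
  by rewrite gt_eqF// pos.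
- by move=> s _; exact: wgt_continuous.
Qed.

Let wgt_le_inv s : 0 < s -> 0 <= s^-1 - wgt s.
Proof.
by move=> s0; rewrite subr_ge0 lef_pV2 ?posrE ?hyp_gt0// hyp_ge.
Qed.

(** Because asinh (1 / r) + ln r = ln (1 + sqrt (1 + r^2)), which tends to ln 2. *)
Let asinh_near0 r : 0 < r <= 1 -> `|ln (r^-1 + hyp r^-1) + ln r - ln 2| <= r.
Proof.
move=> /andP[r0 r1]; have ri : 0 < r^-1 by rewrite invr_gt0.
have h1 := hyp_gt0 r^-1; have rh : r * hyp r^-1 = hyp r.
  rewrite /hyp -{1}[r]gtr0_norm// -sqrtr_sqr -sqrtrM ?sqr_ge0// mulrDr mulr1 -exprMn.
  by rewrite divff ?gt_eqF// expr1n addrC.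
have e : ln (r^-1 + hyp r^-1) + ln r = ln (1 + hyp r).
  rewrite -lnM ?posrE ?addr_gt0// mulrC mulrDr divff ?gt_eqF// rh//.
rewrite e; have p2 : 0 < 1 + hyp r by rewrite addr_gt0// hyp_gt0.
rewrite -ln_div ?posrE//.
have l1 : 1 <= (1 + hyp r) / 2 by rewrite ler_pdivlMr// mul1r; have := hyp_ge1 r; lra.
rewrite ger0_norm ?ln_ge0//.
have l2 : (1 + hyp r) / 2 <= 1 + r / 2.
  by rewrite ler_pdivrMr//; have := hyp_le (ltW r0); lra.
have p3 : 0 < 1 + r / 2 by lra.
rewrite (@le_trans _ _ (ln (1 + r / 2)))//.
  by rewrite ler_ln ?posrE// divr_gt0.
rewrite (le_trans (le_ln1Dx _))//; lra.
Qed.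

(** Add the integral for Euler's constant and subtract that of [wgt] over [0, 1 / r]. On either side
    of the cut 1 / r the integrand becomes 1 / s - 1 / sqrt (1 + s^2) times a factor of absolute
    value at most r s, and s times that difference is integrable. *)
Lemma Gint1_near0 r : 0 < r <= 1 ->
  norm1 (Gint 1 r + (ln r - ln 2 + euler_gamma R)%:C) <= (inv_sqr_mass R + 1) * r.
Proof.
move=> r01; have /andP[r0 r1] := r01; have r0' := ltW r0.
have ri : 0 < r^-1 by rewrite invr_gt0.
have iw : mu.-integrable Dp (fun s => (wexp r s)%:E).
  by apply: integrableS (integrable_wexp r0) => // s; rewrite /= !in_itv/= !andbT => /ltW.
have ig : mu.-integrable Dp (fun s => (gamma_fun r s)%:E) := integrable_gamma_fun r0.
have iw0 : mu.-integrable `[0, r^-1] (fun s => (wgt s)%:E).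
  by apply: continuous_itv_integrable => s _; exact: wgt_continuous.
have ip : mu.-integrable Dp (fun s => (((@wgt R) \_ `[0, r^-1[) s)%:E).
  apply: integrable_patch => //.
  by apply: integrableS iw0 => // s; rewrite /= !in_itv/= => /andP[-> /ltW ->].
have ie : Rintegral mu Dp ((@wgt R) \_ `[0, r^-1[) = ln (r^-1 + hyp r^-1).
  rewrite -asinh_int ?(ltW ri)// -Rintegral_mkcondr.
  have -> : (Dp `&` `[0, r^-1[%classic) = `]0, r^-1[%classic.
    apply/seteqP; split => s /=; rewrite !in_itv/= andbT.
      by move=> [-> /andP[_ ->]].
    by move=> /andP[s0 s1]; rewrite s0 (ltW s0) s1.
  rewrite Rintegral_itv_bndo_bndc ?Rintegral_itv_obnd_cbnd//.
    by apply: integrableS iw0 => // s; rewrite /= !in_itv/= => /andP[/ltW -> ->].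
  by apply: integrableS iw0 => // s; rewrite /= !in_itv/= => /andP[/ltW -> /ltW ->].
have iwg : mu.-integrable Dp (fun s => (wexp r s + gamma_fun r s)%:E).
  exact: integrableD_fin.
have key : `|Rintegral mu Dp (wexp r) + euler_gamma R - ln (r^-1 + hyp r^-1)| <= inv_sqr_mass R * r.
  rewrite (euler_gammaE r0) -ie -RintegralD// -RintegralB//.
  have im : mu.-integrable Dp (fun s => (r * (2 * ((1 + s) ^+ 2)^-1))%:E).
    apply: integrableZ_fin => //; apply: integrableS (@integrable_inv_sqr R) => // s.
    by rewrite /= !in_itv/= !andbT => /ltW.
  have it : mu.-integrable Dp (fun s => (wexp r s + gamma_fun r s - ((@wgt R) \_ `[0, r^-1[) s)%:E).
    exact: integrableB_fin.
  rewrite (le_trans (le_normr_Rintegral _ it))//.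
  have -> : inv_sqr_mass R * r = Rintegral mu Dp (fun s => r * (2 * ((1 + s) ^+ 2)^-1)).
    rewrite RintegralZl//; last first.
      by apply: integrableS (@integrable_inv_sqr R) => // s; rewrite /= !in_itv/= !andbT => /ltW.
    rewrite mulrC Rintegral_itv_obnd_cbnd//.
    by apply: integrableS (@integrable_inv_sqr R) => // s; rewrite /= !in_itv/= !andbT => /ltW.
  apply: le_Rintegral => //; first exact: integrable_norm.
  move=> s; rewrite /= in_itv/= andbT => s0.
  have s0' : s != 0 by rewrite gt_eqF.
  have h1 := onem_wgt_le (ltW s0); have h2 := wgt_le_inv s0.
  have h3 : 1 - s * wgt s = s * (s^-1 - wgt s) by rewrite mulrBr divff.
  have rs0 : 0 <= r * s by rewrite mulr_ge0// ltW.
  have bnd (c : R) : 0 <= c -> c <= r * s -> c * (s^-1 - wgt s) <= r * (2 / (1 + s) ^+ 2).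
    move=> c0 cr; rewrite (le_trans (ler_wpM2r h2 cr))// -mulrA ler_wpM2l// -h3//.
  have e1 : expR (- (r * s)) <= 1 by rewrite -expR0 ler_expR oppr_le0.
  have e0 := expR_ge0 (- (r * s)).
  have e2 : 1 - expR (- (r * s)) <= r * s by have := expR_ge1Dx (- (r * s)); lra.
  rewrite /wexp /gamma_fun; have [sr|rs] := ltP s r^-1.
  - rewrite patchT; last by rewrite inE/= in_itv/= (ltW s0) sr.
    rewrite [X in `|X|](_ : _ = (1 - expR (- (r * s))) * (s^-1 - wgt s)); last by ring.
    by rewrite ger0_norm; [apply: bnd => //; rewrite subr_ge0|rewrite mulr_ge0// subr_ge0].
  - rewrite patchN; last by apply/negP; rewrite inE/= in_itv/= ltNge rs andbF.
    (* Outside its set a restriction takes the default value [point], which is 0 in R. *)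
    rewrite -[point]/(0 : R) subr0.
    rewrite [X in `|X|](_ : _ = - (expR (- (r * s)) * (s^-1 - wgt s))); last by ring.
    rewrite normrN ger0_norm; last exact: mulr_ge0.
    apply: bnd => //; rewrite (le_trans e1)//.
    by rewrite mulrC -ler_pdivrMr// mul1r.
have as0 := asinh_near0 r01.
rewrite (Gint1E r0) -rmorphD norm1_real.
rewrite [X in `|X|](_ : _ = (Rintegral mu Dp (wexp r) + euler_gamma R - ln (r^-1 + hyp r^-1)) +
  (ln (r^-1 + hyp r^-1) + ln r - ln 2)); last by ring.
by rewrite (le_trans (ler_normD _ _))// mulrDl mul1r lerD.
Qed.

End Gint1.

(** * The Hankel function as a superposition of exponentials *)

Section HankelIntegral.
Variable R : realType.
Local Notation C := R[i].
Variable k : C.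
Hypothesis k0 : 0 < complex.Re k.
Hypothesis k1 : 0 <= complex.Im k.

Lemma hankel_const_split : hankel_const k =
  clog k - (ln 2)%:C + (euler_gamma R)%:C.
Proof.
rewrite /hankel_const; congr (_ + _).
have -> : k / 2 = k * (2^-1)%:C by rewrite natrC_inv.
rewrite clog_realM ?invr_gt0 ?k_neq0// lnV ?posrE//.
by rewrite rmorphN.
Qed.

(** Up to O(r), [Gint k] is - clog k - ln r + ln 2 - gamma, and [hankel_const k] is clog k - ln 2 +
    gamma: the constants match. *)
Lemma Hint_near0 : exists2 A : R, 0 <= A & forall r : R, 0 < r <= 1 ->
  norm1 (Hint k r - ((pi / 2)%:C + 'i%C * (hankel_const k + (ln r)%:C))) <= A * r /\
  norm1 (tHint k r - 'i%C) <= A * r.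
Proof.
have [A A0 hA] := Ein_near0 k1.
have N0 := norm1_ge0 k; have M0 := inv_sqr_mass_ge0 R; have L0 := norm1_ge0 (clog k).
pose B := 4 * norm1 (clog k) * expR `|ln (normc k)| * inv_sqr_mass R * 2.
have B0 : 0 <= B.
  by do ?[by []|exact: expR_ge0|apply: mulr_ge0].
have nI (z : C) : norm1 ('i%C * z) <= norm1 z.
  by rewrite (le_trans (norm1M _ _))// norm1_i mul1r.
exists (A + (B + (inv_sqr_mass R + 1)) + 2 * norm1 k * inv_sqr_mass R).
  by do ?[by []|apply: addr_ge0|apply: mulr_ge0].
move=> r r01; have /andP[r0 r1] := r01; have r0' := ltW r0.
have [a1 a2] := hA r r01.
have t1 := tGint_near0 k0 r0.
split.
- have b1 := Gint_clog k0 k1 r0; have b2 := Gint1_near0 r01.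
  have -> : Hint k r - ((pi / 2)%:C + 'i%C * (hankel_const k + (ln r)%:C)) =
    (Ein k r - (pi / 2)%:C) - 'i%C * ((Gint k r - Gint 1 r + clog k) +
      (Gint 1 r + (ln r - ln 2 + euler_gamma R)%:C)).
    rewrite hankel_const_split /Hint rmorphD rmorphB/=.
    by move: ((pi / 2)%:C : C) => P; ring.
  rewrite (le_trans (norm1B _ _))// !mulrDl.
  have b1' : norm1 (Gint k r - Gint 1 r + clog k) <= B * r.
    by rewrite (le_trans b1)// le_eqVlt; apply/orP; left; apply/eqP; rewrite /B; ring.
  have q1 : 0 <= 2 * norm1 k * inv_sqr_mass R * r by rewrite !mulr_ge0.
  have := nI ((Gint k r - Gint 1 r + clog k) + (Gint 1 r + (ln r - ln 2 + euler_gamma R)%:C)).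
  have := norm1D (Gint k r - Gint 1 r + clog k) (Gint 1 r + (ln r - ln 2 + euler_gamma R)%:C).
  move: a1 b1' b2 q1; rewrite !mulrDl; lra.
- have -> : tHint k r - 'i%C = tEin k r - 'i%C * (tGint k r + 1) by rewrite /tHint; ring.
  rewrite (le_trans (norm1B _ _))// !mulrDl.
  have q1 : 0 <= B * r by rewrite mulr_ge0.
  have q2 : 0 <= inv_sqr_mass R * r by rewrite mulr_ge0.
  have := nI (tGint k r + 1).
  move: a2 t1 q1 q2; lra.
Qed.

(* Both sides solve Bessel's equation in [r] and have the same leading
   behaviour at [r = 0]. *)
Lemma hank_Hint (r : R) : 0 < r -> hank k r = Hint k r.
Proof.
move=> r0; apply/eqP; rewrite -subr_eq0; apply/eqP.
have [A A0 hA] := hank_near0 k; have [B B0 hB] := Hint_near0.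
have dW (x : R) : 0 < x -> cderive (fun r => hank k r - Hint k r) x (x^-1%:C * (thank k x - tHint k x)).
  move=> x0; have h1 := @hank_derive _ k x x0; have h2 := Hint_derive k0 k1 x0.
  rewrite mulrBr; exact: (cderiveB h1 h2).
have dV (x : R) : 0 < x -> cderive (fun r => thank k r - tHint k r) x (- (k ^+ 2 * (x%:C * (hank k x - Hint k x)))).
  move=> x0; have h1 := @thank_derive _ k x x0; have h2 := tHint_derive k0 k1 x0.
  apply: cderive_eq (cderiveB h1 h2) _.
  by move: (hank k x) (Hint k x) (x%:C : C) => a b c; ring.
have bW (x : R) : 0 < x <= 1 -> norm1 (hank k x - Hint k x) <= (A + B) * x.
  move=> x01; have [a _] := hA x x01; have [b _] := hB x x01.
  rewrite mulrDl; set z := (pi / 2)%:C + _ in a b.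
  have -> : hank k x - Hint k x = (hank k x - z) - (Hint k x - z).
    by move: (hank k x) (Hint k x) z {a b} => a b z; ring.
  by rewrite (le_trans (norm1B _ _))// lerD.
have bV (x : R) : 0 < x <= 1 -> norm1 (thank k x - tHint k x) <= (A + B) * x.
  move=> x01; have [_ a] := hA x x01; have [_ b] := hB x x01.
  rewrite mulrDl.
  have -> : thank k x - tHint k x = (thank k x - 'i%C) - (tHint k x - 'i%C).
    by move: (thank k x) (tHint k x) => c d; ring.
  by rewrite (le_trans (norm1B _ _))// lerD.
exact: (@bessel_system_unique _ (k ^+ 2) _ _ (A + B) dW dV bW bV r r0).
Qed.

End HankelIntegral.

(** * Singularity of the kernel *)

Section ImproperBound.
Variable R : realType.
Local Notation mu := (@lebesgue_measure R).

(** Exhaust ]a, b[ by compact intervals: on each the integral is a difference of two values of F,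
    and monotone convergence concludes. The singular endpoints are never touched. *)
Lemma antiderivative_bound (F f : R -> R) (a b B : R) : a < b ->
  (forall s : R, a < s < b -> is_derive s 1 F (f s)) ->
  (forall s : R, a < s < b -> {for s, continuous f}) ->
  (forall s : R, a < s < b -> 0 <= f s) ->
  (forall s : R, a < s < b -> `|F s| <= B) ->
  (\int[mu]_(s in `]a, b[) (f s)%:E <= (2 * B)%:E)%E.
Proof.
move=> ab dF cf f0 FB.
(* The index n + 2 keeps the margin at most half of the length, so the intervals are nonempty. *)
pose e (n : nat) : R := (b - a) / n.+2%:R.
have e0 n : 0 < e n by rewrite divr_gt0// subr_gt0.
have e2 n : e n <= (b - a) / 2.
  by rewrite ler_pM2l ?subr_gt0// lef_pV2 ?posrE// ler_nat.
have een m n : (m <= n)%N -> e n <= e m.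
  by move=> mn; rewrite ler_pM2l ?subr_gt0// lef_pV2 ?posrE// ler_nat !ltnS.
pose A (n : nat) : set (measurableTypeR R) := `[a + e n, b - e n]%classic.
have AI n (s : R) : A n s -> a < s < b.
  rewrite /A /= in_itv/= => /andP[s1 s2]; have := e0 n; lra.
have UA : \bigcup_n A n = `]a, b[%classic.
  apply/seteqP; split => s /=; first by move=> [n _ /AI]; rewrite in_itv.
  rewrite in_itv/= => /andP[s1 s2].
  pose m := Num.min (s - a) (b - s).
  have m0 : 0 < m by rewrite lt_min !subr_gt0 s1.
  exists (Num.trunc ((b - a) / m)) => //; rewrite /A /= in_itv/=.
  have em : e (Num.trunc ((b - a) / m)) <= m.
    rewrite ler_pdivrMr// mulrC -ler_pdivrMr// (le_trans (ltW (truncnS_gt _)))//.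
    by rewrite ler_nat.
  by have : m <= s - a /\ m <= b - s; [rewrite !ge_min !lexx orbT|lra].
rewrite -UA.
have cvgI : (\int[mu]_(s in A n) (f s)%:E)%E @[n --> \oo] -->
    (\int[mu]_(s in \bigcup_n A n) (f s)%:E)%E.
  apply: ge0_nondecreasing_set_cvg_integral.
  - move=> m n mn; apply/subsetPset => s; rewrite /A /= !in_itv/=.
    have := een _ _ mn; lra.
  - by move=> n; exact: measurable_itv.
  - move=> n; apply/measurable_EFinP.
    apply: subspace_continuous_measurable_fun; first exact: measurable_itv.
    by apply: within_itv_cont => s sI; apply: cf; apply: (AI n); rewrite /A /= in_itv.
  - by move=> n s As; rewrite lee_fin; exact: f0 (AI _ _ As).
rewrite -(cvg_lim _ cvgI)//; apply: lime_le; first by apply/cvg_ex; eexists; exact: cvgI.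
apply: nearW => n.
have sI s : a + e n <= s <= b - e n -> a < s < b.
  by move=> h; apply: (AI n); rewrite /A /= in_itv.
have If : mu.-integrable (A n) (fun s => (f s)%:E).
  by apply: continuous_itv_integrable => s /sI; exact: cf.
have ab' : a + e n <= b - e n by have := e2 n; lra.
rewrite -(@fineK _ (\int[mu]_(s in A n) (f s)%:E)%E); last first.
  by apply: integrable_fin_num => //; exact: measurable_itv.
rewrite lee_fin -[leLHS]/(Rintegral mu `[a + e n, b - e n] f).
have -> : Rintegral mu `[a + e n, b - e n] f = F (b - e n) - F (a + e n).
  by apply: ftc_itv => // s /sI; [exact: dF|exact: cf].
have h1 := FB _ (sI (b - e n) _); have h2 := FB _ (sI (a + e n) _).
have := ler_normB (F (b - e n)) (F (a + e n)).
have := ler_norm (F (b - e n) - F (a + e n)).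
have := h1 _; have := h2 _; rewrite !lexx ab' => /(_ isT) ? /(_ isT) ?; lra.
Qed.

End ImproperBound.

(** * Uniform integrability of the inverse square root of the distance *)

Section InverseSqrt.
Variable R : realType.
Local Notation mu := (@lebesgue_measure R).
Implicit Types a b x y : R.

(* Vanishes for [x <= 0]. *)
Definition rsqrt x : R := (Num.sqrt x)^-1.

Lemma rsqrt_ge0 x : 0 <= rsqrt x. Proof. by rewrite invr_ge0 sqrtr_ge0. Qed.

Lemma rsqrt_le a b : 0 < a <= b -> rsqrt b <= rsqrt a.
Proof.
move=> /andP[a0 ab]; have b0 : 0 < b by exact: lt_le_trans ab.
by rewrite lef_pV2 ?posrE ?sqrtr_gt0// ler_wsqrtr.
Qed.

Lemma sqrt_rsqrt x : 0 < x -> Num.sqrt x * rsqrt x = 1.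
Proof. by move=> x0; rewrite divff// gt_eqF// sqrtr_gt0. Qed.

Lemma sqrt_rsqrt_ge1 a b : 0 < a <= b -> 1 <= Num.sqrt b * rsqrt a.
Proof.
move=> /andP[a0 ab]; rewrite -(sqrt_rsqrt a0).
by rewrite ler_wpM2r ?rsqrt_ge0// ler_wsqrtr.
Qed.

Lemma measurable_rsqrt : measurable_fun setT rsqrt.
Proof.
have -> : [set: R] = `]-oo, 0]%classic `|` `]0, +oo[%classic.
  apply/seteqP; split => // x _ /=; rewrite !in_itv/= andbT.
  by case: (leP x 0) => h; [left|right].
apply/measurable_funU; [exact: measurable_itv|exact: measurable_itv|split].
- apply: eq_measurable_fun (@measurable_cst _ _ _ _ _ (0 : R)) => x.
  by rewrite inE/= in_itv/= => x0; rewrite /rsqrt ler0_sqrtr// invr0.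
- apply: open_continuous_measurable_fun; first exact: interval_open.
  move=> x; rewrite inE/= in_itv/= andbT => x0.
  apply: cvgV; first by rewrite gt_eqF// sqrtr_gt0.
  exact: sqrt_continuous.
Qed.

(** The sign c treats both sides of the singularity at once, with antiderivative 2 c sqrt (c (y -
    a)). *)
Let rsqrt_side (c a u v L : R) : c ^+ 2 = 1 -> u < v ->
  (forall y, u < y < v -> 0 < c * (y - a) < L) ->
  (\int[mu]_(y in `]u, v[) (rsqrt (c * (y - a)))%:E <= (4 * Num.sqrt L)%:E)%E.
Proof.
move=> c1 uv cy.
have -> : 4 * Num.sqrt L = 2 * (2 * Num.sqrt L) by ring.
have nc : `|c| = 1.
  by apply/eqP; rewrite -(@eqrXn2 _ 2)// real_normK ?num_real// c1 expr1n.
apply: (@antiderivative_bound _ (fun y : R => 2 * c * Num.sqrt (c * (y - a)))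
  (fun y : R => rsqrt (c * (y - a))) u v (2 * Num.sqrt L) uv).
- move=> y /cy/andP[h _].
  have dd := isd_comp (f := @Num.sqrt R) (g := fun y => c * (y - a)) (is_derive1_sqrt h)
    (isd_mul (isd_cst c y) (isd_sub (isd_id y) (isd_cst a y))).
  apply: is_derive_eq (isd_mul (isd_cst (2 * c) y) dd) _.
  rewrite /rsqrt subr0 mul0r !add0r mul0r add0r mulr1 invfM.
  rewrite [LHS](_ : _ = c ^+ 2 * (2 / 2) / Num.sqrt (c * (y - a))); last by ring.
  by rewrite c1 divff ?mul1r.
- move=> y /cy/andP[h _].
  apply: cvgV; first by rewrite gt_eqF// sqrtr_gt0.
  apply: continuous_comp; last exact: sqrt_continuous.
  by apply: cvgM; [exact: cvg_cst|apply: cvgB; [exact: cvg_id|exact: cvg_cst]].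
- by move=> y _; exact: rsqrt_ge0.
- move=> y /cy/andP[y1 y2]; rewrite normrM normrM nc mulr1 !ger0_norm ?sqrtr_ge0//.
  by rewrite ler_wpM2l// ler_wsqrtr// ltW.
Qed.

Lemma measurable_rsqrt_dist x (D : set (measurableTypeR R)) :
  measurable_fun D (fun y : R => rsqrt `|x - y|).
Proof.
apply: (@measurable_funS _ _ _ _ setT) => //.
apply: (measurableT_comp measurable_rsqrt).
apply: (measurableT_comp (@normr_measurable _ setT)).
by apply: measurable_funB => //; exact: measurable_cst.
Qed.

Let rsqrt_dist_int (M x : R) : 0 < M -> - M <= x <= M ->
  (\int[mu]_(y in `[(- M)%R, M]) (rsqrt `|x - y|)%:E <= (8 * Num.sqrt (3 * M))%:E)%E.
Proof.
(* The interval ]x - 3 M, x + 3 M[ contains [- M, M] for every x of it, endpoints included, and is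
   symmetric about x, so the bound does not depend on x. *)
move=> M0 /andP[x1 x2]; pose L := 3 * M.
have L0 : 0 < L by rewrite /L; lra.
have mf (D : set (measurableTypeR R)) : measurable_fun D (fun y : R => (rsqrt `|x - y|)%:E).
  by apply/measurable_EFinP; exact: measurable_rsqrt_dist.
have p0 (y : R) : (0 <= (rsqrt `|x - y|)%:E)%E by rewrite lee_fin rsqrt_ge0.
apply: (@le_trans _ _ (\int[mu]_(y in `](x - L)%R, (x + L)%R[) (rsqrt `|x - y|)%:E)%E).
  apply: ge0_subset_integral => //.
  by move=> y; rewrite /= !in_itv/= /L; lra.
have -> : `]x - L, x + L[%classic = `]x - L, x]%classic `|` `]x, x + L[%classic.
  by apply: itv_bndbnd_setU; rewrite ?bnd_simp; lra.
rewrite ge0_integral_setU//; last first.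
  apply/eqP/seteqP; split => // y /=; rewrite !in_itv/=; lra.
have -> : 8 * Num.sqrt (3 * M) = 4 * Num.sqrt L + 4 * Num.sqrt L by rewrite /L; ring.
rewrite [leRHS]EFinD.
have le_eq (a b : \bar R) : a = b -> (a <= b)%E by move=> ->.
apply: (@leeD R).
- rewrite -integral_itv_bndo_bndc; last exact: mf.
  apply: (@le_trans _ _ (\int[mu]_(y in `](x - L)%R, x[) (rsqrt (-1 * (y - x)))%:E)%E).
    apply: le_eq; apply: eq_integral => y; rewrite inE/= in_itv/= => h.
    by congr (rsqrt _)%:E; rewrite gtr0_norm; lra.
  apply: rsqrt_side; [by rewrite sqrrN expr1n|lra|move=> y; lra].
- apply: (@le_trans _ _ (\int[mu]_(y in `]x, (x + L)%R[) (rsqrt (1 * (y - x)))%:E)%E).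
    apply: le_eq; apply: eq_integral => y; rewrite inE/= in_itv/= => h.
    by congr (rsqrt _)%:E; rewrite ltr0_norm; lra.
  apply: rsqrt_side; [by rewrite expr1n|lra|move=> y; lra].
Qed.

Lemma integrable_rsqrt_dist (M x : R) : 0 < M -> - M <= x <= M ->
  mu.-integrable `[- M, M] (fun y => (rsqrt `|x - y|)%:E).
Proof.
move=> M0 xM; apply/integrableP; split.
  by apply/measurable_EFinP; exact: measurable_rsqrt_dist.
apply: le_lt_trans (ltry (8 * Num.sqrt (3 * M))).
apply: le_trans (rsqrt_dist_int M0 xM); rewrite le_eqVlt; apply/orP; left; apply/eqP.
by apply: eq_integral => y _; rewrite /= ger0_norm// rsqrt_ge0.
Qed.

Lemma Rintegral_rsqrt_dist (M x : R) : 0 < M -> - M <= x <= M ->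
  Rintegral mu `[- M, M] (fun y => rsqrt `|x - y|) <= 8 * Num.sqrt (3 * M).
Proof.
move=> M0 xM; rewrite -lee_fin /Rintegral fineK ?rsqrt_dist_int//.
by apply: integrable_fin_num => //; exact: integrable_rsqrt_dist.
Qed.

End InverseSqrt.

(** * Hoelder estimates degenerating at the origin *)

Section SqrtHolder.
Variable R : realType.
Local Notation C := R[i].
Implicit Types (a b r : R) (f g : R -> C).

Definition lip_on L f := exists2 A : R, 0 <= A & forall a b,
  0 < a <= L -> 0 < b <= L -> norm1 (f a - f b) <= A * `|a - b|.

(** With a = |x - z| and b = |y - z| the bound is sqrt |x - y| times a function of z whose integral
    is uniformly bounded: this makes the potential Hoelder of exponent 1/2. *)
Definition sqrt_holder L f := exists2 A : R, 0 <= A & forall a b,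
  0 < a <= L -> 0 < b <= L ->
  norm1 (f a - f b) <= A * (Num.sqrt `|a - b| * (rsqrt a + rsqrt b)).

(** Compare with the value at L, a constant that sqrt L / sqrt a >= 1 absorbs. *)
Lemma sqrt_holder_bound L f : sqrt_holder L f ->
  exists2 A : R, 0 <= A & forall a, 0 < a <= L -> norm1 (f a) <= A * rsqrt a.
Proof.
move=> [A A0 hA]; have L0 : 0 <= Num.sqrt L by exact: sqrtr_ge0.
have n0 := norm1_ge0 (f L).
exists (2 * A * Num.sqrt L + norm1 (f L) * Num.sqrt L).
  by rewrite addr_ge0// ?mulr_ge0.
move=> a /andP[a0 aL]; have L1 : 0 < L <= L by rewrite lexx andbT (lt_le_trans a0).
have := hA a L; rewrite a0 aL L1 => /(_ isT isT) h.
have r1 : rsqrt L <= rsqrt a by apply: rsqrt_le; rewrite a0.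
have r2 : 1 <= Num.sqrt L * rsqrt a by apply: sqrt_rsqrt_ge1; rewrite a0.
have s1 : Num.sqrt `|a - L| <= Num.sqrt L.
  by rewrite ler_wsqrtr// ler0_norm; lra.
have ra := rsqrt_ge0 a; have rL := rsqrt_ge0 L.
have h1 : Num.sqrt `|a - L| * (rsqrt a + rsqrt L) <= Num.sqrt L * (rsqrt a + rsqrt a).
  by apply: ler_pM => //; [exact: addr_ge0|exact: lerD].
have h2 := ler_wpM2l A0 h1.
have h3 : norm1 (f L) <= norm1 (f L) * (Num.sqrt L * rsqrt a) by rewrite ler_peMr.
have h4 : norm1 (f a) <= norm1 (f a - f L) + norm1 (f L).
  by rewrite -{1}[f a](subrK (f L)) norm1D.
rewrite [leRHS](_ : _ = A * (Num.sqrt L * (rsqrt a + rsqrt a)) + norm1 (f L) * (Num.sqrt L * rsqrt a)); last by ring.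
lra.
Qed.

Lemma lip_sqrt_holder L f : lip_on L f -> sqrt_holder L f.
Proof.
move=> [A A0 hA]; have L0 : 0 <= Num.sqrt L by exact: sqrtr_ge0.
exists (A * (Num.sqrt L * Num.sqrt L)); first by rewrite !mulr_ge0.
move=> a b aL bL; rewrite (le_trans (hA _ _ aL bL))// -!mulrA ler_wpM2l//.
have /andP[a0 a1] := aL; have /andP[b0 b1] := bL.
have s1 : Num.sqrt `|a - b| <= Num.sqrt L.
  by rewrite ler_wsqrtr// ler_norml; lra.
have s0 := sqrtr_ge0 `|a - b|.
have r1 : 1 <= Num.sqrt L * (rsqrt a + rsqrt b).
  rewrite mulrDr (le_trans (sqrt_rsqrt_ge1 aL))// lerDl mulr_ge0// rsqrt_ge0//.
rewrite -{1}[`|a - b|]sqr_sqrtr//; set s := Num.sqrt _ in s1 s0 *.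
set q := rsqrt a + rsqrt b in r1 *; set t := Num.sqrt L in s1 r1 *.
apply: (@le_trans _ _ (s * (t * (t * q)))).
  by rewrite expr2 ler_wpM2l// -[leLHS]mulr1 ler_pM.
by rewrite le_eqVlt; apply/orP; left; apply/eqP; ring.
Qed.

Lemma sqrt_holderD L f g : sqrt_holder L f -> sqrt_holder L g ->
  sqrt_holder L (fun r => f r + g r).
Proof.
move=> [A A0 hA] [B B0 hB]; exists (A + B); first exact: addr_ge0.
move=> a b aL bL; rewrite opprD addrACA (le_trans (norm1D _ _))// mulrDl.
by rewrite lerD// ?hA// hB.
Qed.

Lemma sqrt_holderZ L (c : C) f : sqrt_holder L f -> sqrt_holder L (fun r => c * f r).
Proof.
move=> [A A0 hA]; exists (norm1 c * A); first by rewrite mulr_ge0// norm1_ge0.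
move=> a b aL bL; rewrite -mulrBr (le_trans (norm1M _ _))// -mulrA.
by rewrite ler_wpM2l ?norm1_ge0// hA.
Qed.

(** Leibniz: the variation of f meets a bounded g, and the variation of g, of order |a - b| <= sqrt
    L sqrt |a - b|, meets f of size 1 / sqrt b. *)
Lemma sqrt_holderM L f g : sqrt_holder L f -> lip_on L g ->
  sqrt_holder L (fun r => f r * g r).
Proof.
move=> hf [B B0 hB]; have [A A0 hA] := hf; have [A' A'0 hA'] := sqrt_holder_bound hf.
have L0 : 0 <= Num.sqrt L by exact: sqrtr_ge0.
have gL0 := norm1_ge0 (g L).
exists (A * (norm1 (g L) + B * (Num.sqrt L * Num.sqrt L)) + A' * B * Num.sqrt L).
  by do ?[by []|apply: addr_ge0|apply: mulr_ge0].
move=> a b aL bL; have /andP[a0 a1] := aL; have /andP[b0 b1] := bL.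
have LL : 0 < L <= L by rewrite lexx andbT (lt_le_trans a0).
have Lsq : Num.sqrt L * Num.sqrt L = L.
  by rewrite -expr2 sqr_sqrtr// ltW//; case/andP: LL.
have s1 : Num.sqrt `|a - b| <= Num.sqrt L.
  by rewrite ler_wsqrtr// ler_norml; lra.
have s0 := sqrtr_ge0 `|a - b|.
have ga : norm1 (g a) <= norm1 (g L) + B * L.
  rewrite -{1}[g a](subrK (g L)) (le_trans (norm1D _ _))// addrC lerD2l.
  by rewrite (le_trans (hB _ _ aL LL))// ler_wpM2l// ler0_norm; lra.
have h1 : norm1 ((f a - f b) * g a) <=
    A * (Num.sqrt `|a - b| * (rsqrt a + rsqrt b)) * (norm1 (g L) + B * L).
  by rewrite (le_trans (norm1M _ _))// ler_pM ?norm1_ge0// hA.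
have h2 : norm1 (f b * (g a - g b)) <= A' * rsqrt b * (B * `|a - b|).
  by rewrite (le_trans (norm1M _ _))// ler_pM ?norm1_ge0// ?hA' ?hB.
have -> : f a * g a - f b * g b = (f a - f b) * g a + f b * (g a - g b).
  by ring.
apply: (le_trans (norm1D _ _)); rewrite Lsq [leRHS]mulrDl; apply: lerD.
  by rewrite (le_trans h1)// le_eqVlt; apply/orP; left; apply/eqP; ring.
rewrite (le_trans h2)//; have ra := rsqrt_ge0 a; have rb := rsqrt_ge0 b.
have e : `|a - b| <= Num.sqrt L * Num.sqrt `|a - b|.
  by rewrite -{1}[`|a - b|]sqr_sqrtr// expr2 ler_wpM2r.
apply: (@le_trans _ _ (A' * B * (rsqrt b * `|a - b|))).
  by rewrite le_eqVlt; apply/orP; left; apply/eqP; ring.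
rewrite -[leRHS]mulrA; apply: ler_wpM2l; first exact: mulr_ge0.
rewrite mulrA mulrC; apply: ler_pM => //; first by rewrite lerDr.
Qed.

(** For u <= v write v / u = 1 + t^2 with t = sqrt (v - u) / sqrt u; then ln (1 + t^2) <= 2 ln (1 +
    t) <= 2 t. *)
Lemma ln_sqrt_holder L : sqrt_holder L (fun r : R => (ln r)%:C).
Proof.
exists 2 => // a b /andP[a0 _] /andP[b0 _].
rewrite -rmorphB norm1_real.
have main (u v : R) : 0 < u <= v ->
    `|ln u - ln v| <= 2 * (Num.sqrt `|u - v| * (rsqrt u + rsqrt v)).
  move=> /andP[u0 uv]; have v0 : 0 < v by exact: lt_le_trans uv.
  rewrite (distrC u v) (ger0_norm (_ : 0 <= v - u)) ?subr_ge0//.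
  pose t := Num.sqrt (v - u) * rsqrt u.
  have t0 : 0 <= t by rewrite mulr_ge0 ?sqrtr_ge0 ?rsqrt_ge0.
  have hv : v / u = 1 + t ^+ 2.
    rewrite exprMn sqr_sqrtr ?subr_ge0// exprVn sqr_sqrtr ?ltW//.
    by rewrite mulrBl divff ?gt_eqF//; ring.
  rewrite distrC ger0_norm; last by rewrite subr_ge0 ler_ln ?posrE.
  rewrite -ln_div ?posrE// hv.
  apply: (@le_trans _ _ (2 * t)).
    apply: (@le_trans _ _ (ln ((1 + t) ^+ 2))).
      rewrite ler_ln ?posrE; [|nra|nra].
      by rewrite sqrrD expr1n mul1r; nra.
    have t1 : 0 < 1 + t by lra.
    rewrite lnXn// -(mulr_natl (ln _)) ler_wpM2l// le_ln1Dx//; lra.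
  by rewrite ler_wpM2l// /t ler_wpM2l ?sqrtr_ge0// lerDl rsqrt_ge0.
have [ab|/ltW ba] := leP a b; first by apply: main; rewrite a0.
by rewrite distrC (distrC a) addrC [X in _ * (_ * X)]addrC addrC; apply: main; rewrite b0.
Qed.

End SqrtHolder.

Section HankelBounds.
Variable R : realType.
Local Notation C := R[i].
Variable k : C.

Let lip_sqr (a : nat -> C) (L : R) : exp_bounded a -> 0 < L -> lip_on L (fun r : R => cps a (r ^+ 2)).
Proof.
move=> ba L0; have [B B0 hB] := cps_lipschitz (L ^+ 2) ba.
exists (B * (2 * L)); first by rewrite !mulr_ge0// ltW.
move=> x y /andP[x0 xL] /andP[y0 yL].
have sq (z : R) : 0 < z -> z <= L -> 0 <= z ^+ 2 <= L ^+ 2.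
  by move=> z0 zL; apply/andP; split; nra.
rewrite (le_trans (hB _ _ (sq _ x0 xL) (sq _ y0 yL)))// -[leRHS]mulrA ler_wpM2l//.
rewrite subr_sqr normrM mulrC ler_wpM2r// ger0_norm; lra.
Qed.

Lemma sqrt_holder_hank (L : R) : 0 < L -> sqrt_holder L (hank k).
Proof.
move=> L0.
have lJ := lip_sqr (exp_bounded_J0 k) L0; have lY := lip_sqr (exp_bounded_Y0 k) L0.
have hJ := lip_sqrt_holder lJ; have hY := lip_sqrt_holder lY.
have hl := sqrt_holderM (ln_sqrt_holder L) lJ.
have := sqrt_holderD (sqrt_holderZ (pi / 2)%:C hJ) (sqrt_holderZ 'i%C
  (sqrt_holderD (sqrt_holderD (sqrt_holderZ (hankel_const k) hJ) hl) hY)).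
congr sqrt_holder; apply/funext => r; by rewrite /hank (mulrDl (hankel_const k)).
Qed.

Lemma cmeasurable_hank (D : set (measurableTypeR R)) : cmeasurable D (hank k).
Proof.
have mcps (a : nat -> C) : exp_bounded a -> cmeasurable [set: R] (fun r : R => cps a (r ^+ 2)).
  move=> ba; apply: ccontinuous_cmeasurable => // x _.
  have d2 := isd_mul (isd_id x) (isd_id x).
  have h := cderive_comp (f := cps a) (u := fun y => y * y) (cps_derive _ ba) d2.
  exact: cderive_cont h.
have mJ := mcps _ (exp_bounded_J0 k); have mY := mcps _ (exp_bounded_Y0 k).
have mc c := @cmeasurable_cst _ (measurableTypeR R) R setT c.
have ml := cmeasurable_real (measurable_ln (R := R)).
have m : cmeasurable [set: R] (hank k).
  apply: cmeasurableD; first by apply: cmeasurableM.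
  apply: cmeasurableM => //; apply: cmeasurableD => //; apply: cmeasurableM => //.
  exact: cmeasurableD.
by case: m => m1 m2; split; [apply: measurable_funS m1|apply: measurable_funS m2].
Qed.

End HankelBounds.

(** * Energy identity for one exponential *)

Section Conjugate.
Variable R : realType.
Local Notation C := R[i].
Implicit Types z w : C.

Lemma conjcE z : conjc z = complex.Re z -i* complex.Im z.
Proof. by case: z. Qed.

Lemma norm1_conjc z : norm1 (conjc z) = norm1 z.
Proof. by rewrite conjcE /norm1/= normrN. Qed.

Lemma mul_conjc z : conjc z * z = (sqn z)%:C.
Proof. by rewrite conjcE; apply: complexP; rewrite ?cReM ?cImM /sqn/=; ring. Qed.

(** The left-hand side is the derivative of conj(q) f under f' = a q and q' = a f - 2 s. *)
Lemma conjc_energy (a f q s : C) :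
  conjc (a * f - (s + s)) * f + conjc q * (a * q) =
  conjc a * (sqn f)%:C + a * (sqn q)%:C - (conjc s * f + conjc s * f).
Proof.
case: a f q s => [a1 a2] [f1 f2] [q1 q2] [s1 s2].
by apply: complexP; rewrite /sqn/=; ring.
Qed.

Lemma Re_energy (a c z : C) (F Q : R) :
  complex.Re (c * (conjc a * F%:C + a * Q%:C - (z + z))) =
  complex.Re (c * conjc a) * F + complex.Re (c * a) * Q - 2 * complex.Re (c * z).
Proof. by case: a c z => [a1 a2] [c1 c2] [z1 z2] /=; ring. Qed.

Lemma cderive_conjc (f : R -> C) (x : R) (a : C) : cderive f x a ->
  cderive (fun y => conjc (f y)) x (conjc a).
Proof.
move=> [f1 f2].
have -> : (fun y => conjc (f y)) = (fun y => complex.Re (f y) -i* complex.Im (f y)).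
  by apply/funext => y; rewrite conjcE.
rewrite conjcE; split => //=; exact: is_deriveN.
Qed.

Lemma ccontinuous_conjc (f : R -> C) (x : R) : ccontinuous_at f x ->
  ccontinuous_at (fun y => conjc (f y)) x.
Proof.
move=> [f1 f2].
have -> : (fun y => conjc (f y)) = (fun y => complex.Re (f y) -i* complex.Im (f y)).
  by apply/funext => y; rewrite conjcE.
by split => //=; exact: cvgN.
Qed.

Lemma cmeasurable_conjc d (T : measurableType d) (D : set T) (f : T -> C) :
  cmeasurable D f -> cmeasurable D (fun y => conjc (f y)).
Proof.
move=> [f1 f2].
have -> : (fun y => conjc (f y)) = (fun y => complex.Re (f y) -i* complex.Im (f y)).
  by apply/funext => y; rewrite conjcE.
split => //=; exact: measurableT_comp.
Qed.

End Conjugate.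

Lemma ccontinuous_comp (R : realType) (f : R -> R[i]) (u : R -> R) (x : R) :
  ccontinuous_at f (u x) -> {for x, continuous u} ->
  ccontinuous_at (fun y => f (u y)) x.
Proof.
move=> [f1 f2] cu; split.
- exact: (@continuous_comp _ _ _ u (fun y => complex.Re (f y))).
- exact: (@continuous_comp _ _ _ u (fun y => complex.Im (f y))).
Qed.

Lemma eq_ccontinuous (R : realType) (f g : R -> R[i]) (x : R) : f =1 g ->
  ccontinuous_at f x -> ccontinuous_at g x.
Proof. by move=> /funext ->. Qed.

Section Primitive.
Variable R : realType.
Local Notation C := R[i].
Local Notation mu := (@lebesgue_measure R).

Lemma primitive (f : R -> R) (a b : R) : (forall x, {for x, continuous f}) ->
  exists F : R -> R, forall x, a <= x <= b -> is_derive x 1 F (f x).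
Proof.
(* Integrating from a - 1 makes every point of the closed interval [a, b] an interior one. *)
move=> cf; exists (fun x => Rintegral mu `[(a - 1), x] f) => x /andP[ax xb].
have xu : x < b + 1 by lra.
have If : mu.-integrable `[(a - 1), (b + 1)] (EFin \o f).
  by apply: continuous_itv_integrable.
have ax' : a - 1 < x by lra.
have [h1 h2] := continuous_FTC1_closed xu If ax' (cf x).
by apply: (DeriveDef h1); rewrite -derive1E; exact: h2.
Qed.

Lemma cprimitive (f : R -> C) (a b : R) : (forall x, ccontinuous_at f x) ->
  exists F : R -> C, forall x, a <= x <= b -> cderive F x (f x).
Proof.
move=> cf; have [F hF] := primitive a b (fun x => (cf x).1).
have [G hG] := primitive a b (fun x => (cf x).2).
by exists (fun x => F x +i* G x) => x xab; split; [exact: hF|exact: hG].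
Qed.

Lemma cint_itv_split (f : R -> C) (a x b : R) : a <= x <= b ->
  cintegrable mu `[a, b] f -> cint mu `[a, b] f = cint mu `[a, x] f + cint mu `[x, b] f.
Proof.
move=> /andP[ax xb] [i1 i2].
have main (u : R -> R) : mu.-integrable `[a, b] (fun t => (u t)%:E) ->
    Rintegral mu `[a, b] u = Rintegral mu `[a, x] u + Rintegral mu `[x, b] u.
  move=> iu; have := Rintegral_itvB (f := u) (a := BLeft a) (b := BRight b) (x := x) iu.
  rewrite !bnd_simp => /(_ ax xb) h.
  have e : Rintegral mu `]x, b] u = Rintegral mu `[x, b] u.
    apply: Rintegral_itv_obnd_cbnd.
    by apply: integrableS iu => // t; rewrite /= !in_itv/=; lra.
  by rewrite -e -h addrC subrK.
by apply: complexP => /=; rewrite ?cReD ?cImD /=; apply: main.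
Qed.

End Primitive.

Section WaveEnergy.
Variable R : realType.
Local Notation C := R[i].
Local Notation mu := (@lebesgue_measure R).
Variables (M : R) (sigma : R -> C) (a : C).
Hypothesis M0 : 0 < M.
Hypothesis csigma : forall x, ccontinuous_at sigma x.

Definition wave (x : R) : C :=
  cint mu `[- M, M] (fun y => sigma y * cexp (- (a * `|x - y|%:C))).

Let e (x : R) : C := cexp (a * x%:C).
Let e' (x : R) : C := cexp (- (a * x%:C)).

Let de x : cderive e x (a * e x).
Proof.
apply: (cderive_exp (u := fun y : R => a * y%:C)).
apply: cderive_eq (cderiveZ a (cderive_real (isd_id x))) _.
by rewrite mulr1.
Qed.

Let de' x : cderive e' x (- (a * e' x)).
Proof.
apply: cderive_eq (cderive_exp (cderiveN (cderiveZ a (cderive_real (isd_id x))))) _.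
by rewrite /e' mulr1 mulNr.
Qed.

Let ee' x : e x * e' x = 1.
Proof. by rewrite /e /e' -cexpD subrr cexp0. Qed.

(** Cutting the integral at y = x resolves |x - y| and separates the variables; P and N are
    antiderivatives of the two halves. *)
Let wave_split : exists P N : R -> C, [/\
  forall x, - M <= x <= M -> cderive P x (e x * sigma x),
  forall x, - M <= x <= M -> cderive N x (e' x * sigma x) &
  forall x, - M <= x <= M ->
    wave x = e' x * (P x - P (- M)) + e x * (N M - N x)].
Proof.
have ce x := cderive_cont (de x); have ce' x := cderive_cont (de' x).
have c1 x := ccontinuousM (ce x) (csigma x); have c2 x := ccontinuousM (ce' x) (csigma x).
have [P hP] := cprimitive (- M) M c1; have [N hN] := cprimitive (- M) M c2.
exists P, N; split => // x /andP[x1 x2].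
have cabs y : {for y, continuous (fun y : R => `|x - y|)}.
  apply: continuous_comp; last exact: norm_continuous.
  by apply: cvgB; [exact: cvg_cst|exact: cvg_id].
have cw y : ccontinuous_at (fun y => sigma y * cexp (- (a * `|x - y|%:C))) y.
  have h := @ccontinuous_comp _ e' (fun y : R => `|x - y|) y (ce' `|x - y|) (cabs y).
  exact: (ccontinuousM (csigma y) h).
rewrite /wave (@cint_itv_split _ _ _ x); [|by rewrite x1|exact: ccontinuous_cintegrable].
congr (_ + _).
- transitivity (cint mu `[- M, x] (fun y => e' x * (e y * sigma y))).
    apply: eq_cint => y; rewrite inE/= in_itv/= => /andP[y1 y2].
    rewrite ger0_norm ?subr_ge0// rmorphB mulrBr opprB cexpD -/(e y) -/(e' x).
    by move: (e y) (e' x) => u v; ring.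
  rewrite cintZ//; last exact: ccontinuous_cintegrable.
  congr (_ * _); apply: cftc_itv => // y /andP[y1 y2]; apply: hP.
  by rewrite y1 (le_trans y2).
- transitivity (cint mu `[x, M] (fun y => e x * (e' y * sigma y))).
    apply: eq_cint => y; rewrite inE/= in_itv/= => /andP[y1 y2].
    rewrite distrC ger0_norm ?subr_ge0// rmorphB mulrBr opprB cexpD -/(e x) -/(e' y).
    by move: (e x) (e' y) => u v; ring.
  rewrite cintZ//; last exact: ccontinuous_cintegrable.
  congr (_ * _); apply: cftc_itv => // y /andP[y1 y2]; apply: hN.
  by rewrite y2 (le_trans x1).
Qed.

Let sqn_int (f : R -> C) : (forall x, - M <= x <= M -> ccontinuous_at f x) ->
  cintegrable mu `[- M, M] (fun x => (sqn (f x))%:C) /\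
  exists2 F : R, 0 <= F & cint mu `[- M, M] (fun x => (sqn (f x))%:C) = F%:C.
Proof.
move=> cf; split.
  apply: ccontinuous_cintegrable => x xM; have := cf x xM => cx.
  have := ccontinuousM (ccontinuous_conjc cx) cx.
  by congr ccontinuous_at; apply/funext => y; rewrite mul_conjc.
exists (Rintegral mu `[- M, M] (fun x => sqn (f x))).
  by apply: Rintegral_ge0 => x _; exact: sqn_ge0.
by apply: complexP => //=; rewrite /Rintegral integral0_eq.
Qed.

(** The weight c makes c conj(a) purely imaginary, which removes the integral of |f|^2 from the real
    part. What remains is nonnegative, and of it only the endpoint M is kept. *)
Lemma wave_energy (c : C) : complex.Re (c * conjc a) = 0 -> 0 <= complex.Re (c * a) ->
  0 <= complex.Re c ->
  complex.Re c * sqn (wave M) <=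
  2 * complex.Re (c * cint mu `[- M, M] (fun x => conjc (sigma x) * wave x)).
Proof.
move=> ca0 ca1 c0; have [P [N [hP hN hw]]] := wave_split.
pose f x := e' x * (P x - P (- M)) + e x * (N M - N x).
pose q x := e x * (N M - N x) - e' x * (P x - P (- M)).
have df x : - M <= x <= M -> cderive f x (a * q x).
  move=> xM; have d1 := cderiveM (de' x) (cderiveB (hP x xM) (cderive_cst (P (- M)) x)).
  have d2 := cderiveM (de x) (cderiveB (cderive_cst (N M) x) (hN x xM)).
  apply: cderive_eq (cderiveD d1 d2) _; rewrite /q.
  by move: (e x) (e' x) (sigma x) (P x) (P (- M)) (N M) (N x) => u v s p p' n n'; ring.
have dq x : - M <= x <= M -> cderive q x (a * f x - (sigma x + sigma x)).
  move=> xM; have d1 := cderiveM (de' x) (cderiveB (hP x xM) (cderive_cst (P (- M)) x)).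
  have d2 := cderiveM (de x) (cderiveB (cderive_cst (N M) x) (hN x xM)).
  apply: cderive_eq (cderiveB d2 d1) _; rewrite /f.
  have -> : sigma x + sigma x = (sigma x + sigma x) * (e x * e' x) by rewrite ee' mulr1.
  by move: (e x) (e' x) (sigma x) (P x) (P (- M)) (N M) (N x) => u v s p p' n n'; ring.
have cf x (xM : - M <= x <= M) := cderive_cont (df x xM).
have cq x (xM : - M <= x <= M) := cderive_cont (dq x xM).
have [iF [F F0 eF]] := sqn_int cf; have [iQ [Q Q0 eQ]] := sqn_int cq.
have cs x : - M <= x <= M -> ccontinuous_at (fun y => conjc (sigma y) * f y) x.
  by move=> xM; exact: ccontinuousM (ccontinuous_conjc (csigma x)) (cf x xM).
have iS : cintegrable mu `[- M, M] (fun y => conjc (sigma y) * f y).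
  exact: ccontinuous_cintegrable.
have MM : - M <= M by apply: (@le_trans _ _ 0); rewrite ?oppr_le0 ltW.
set I := cint mu `[- M, M] (fun x => conjc (sigma x) * wave x).
have eI : cint mu `[- M, M] (fun y => conjc (sigma y) * f y) = I.
  by apply: eq_cint => x; rewrite inE/= in_itv/= => xM; rewrite hw.
have key : conjc a * F%:C + a * Q%:C - (I + I) = - (sqn (f M) + sqn (f (- M)))%:C.
  (* At M the second summand of f vanishes and at - M the first, so q is - f and f there. *)
  have e1 : conjc (q M) * f M - conjc (q (- M)) * f (- M) = - (sqn (f M) + sqn (f (- M)))%:C.
    have -> : q M = - f M by rewrite /q /f subrr mulr0 add0r addr0.
    have -> : q (- M) = f (- M) by rewrite /q /f subrr mulr0 add0r subr0.
    by rewrite !conjcE; apply: complexP; rewrite ?cReB ?cImB ?cReM ?cImM ?cReN ?cImN /sqn/=; ring.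
  have iD : cintegrable mu `[- M, M]
      (fun x => conjc a * (sqn (f x))%:C + a * (sqn (q x))%:C).
    by apply: cintegrableD => //; exact: cintegrableZ.
  have iSS : cintegrable mu `[- M, M]
      (fun x => conjc (sigma x) * f x + conjc (sigma x) * f x) by exact: cintegrableD.
  rewrite -e1 -eF -eQ -eI -!cintZ// -!cintD//; [|exact: cintegrableZ|exact: cintegrableZ].
  rewrite -cintB//.
  apply: (@cftc_itv _ (fun x => conjc (q x) * f x) _ _ _ MM) => x xM.
  - apply: cderive_eq (cderiveM (cderive_conjc (dq x xM)) (df x xM)) _.
    exact: conjc_energy.
  - have g1 := ccontinuousM (ccontinuous_conjc (cf x xM)) (cf x xM).
    have g2 := ccontinuousM (ccontinuous_conjc (cq x xM)) (cq x xM).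
    have g3 := ccontinuousM (ccontinuous_cst (- 1) x) (ccontinuousD (cs x xM) (cs x xM)).
    have g := ccontinuousD (ccontinuousD (ccontinuousM (ccontinuous_cst (conjc a) x) g1)
      (ccontinuousM (ccontinuous_cst a x) g2)) g3.
    apply: eq_ccontinuous g => y.
    by rewrite (mul_conjc (f y)) (mul_conjc (q y)) mulN1r.
have MM1 : - M <= M <= M by rewrite lexx andbT.
rewrite hw// -/(f M).
have s0 := sqn_ge0 (f (- M)).
have := congr1 (fun z => complex.Re (c * z)) key.
rewrite Re_energy ca0 mul0r add0r mulrN cReN (cReM c _%:C) /= mulr0 subr0 mulrDr => h.
have h1 : 0 <= complex.Re (c * a) * Q by exact: mulr_ge0.
have h2 : 0 <= complex.Re c * sqn (f (- M)) by exact: mulr_ge0.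
lra.
Qed.

End WaveEnergy.

(** * Superposition of exponential kernels *)

Section ComplexFubini.
Context d1 d2 (T1 : measurableType d1) (T2 : measurableType d2) (R : realType).
Variable m1 : {sigma_finite_measure set T1 -> \bar R}.
Variable m2 : {sigma_finite_measure set T2 -> \bar R}.
Local Notation C := R[i].
Local Notation m12 := (m1 \x m2)%E.

Lemma prod_integrable (u : T1 * T2 -> R) (U : T1 -> R) : measurable_fun setT u ->
  (forall x, (\int[m2]_y `|(u (x, y))%:E| <= (U x)%:E)%E) ->
  m1.-integrable setT (fun x => (U x)%:E) ->
  m12.-integrable setT (fun z => (u z)%:E).
Proof.
move=> mu' hU iU.
have mE : measurable_fun setT (fun z => (u z)%:E) by exact/measurable_EFinP.
apply/(integrable12ltyP m1 m2 mE).
have U0 x : (0 <= (U x)%:E)%E by apply: le_trans (hU x); exact: integral_ge0.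
apply: (@le_lt_trans _ _ (\int[m1]_x (U x)%:E)%E).
  apply: ge0_le_integral => //.
  - by move=> x _; exact: integral_ge0.
  - apply: (measurable_fun_fubini_tonelli_F (fun z => `|(u z)%:E|%E)) => //.
    exact: measurableT_comp.
  - by have := measurable_int _ iU.
have := integrable_fin_num measurableT iU.
by rewrite fin_numE => /andP[_]; rewrite ltey.
Qed.

Let real12 (u : T1 * T2 -> R) : m12.-integrable setT (fun z => (u z)%:E) ->
  (forall x, m2.-integrable setT (fun y => (u (x, y))%:E)) ->
  m1.-integrable setT (fun x => (Rintegral m2 setT (fun y => u (x, y)))%:E) /\
  Rintegral m1 setT (fun x => Rintegral m2 setT (fun y => u (x, y))) =
  Rintegral m12 setT u.
Proof.
move=> iu iu2.
have e : (fun x => (Rintegral m2 setT (fun y => u (x, y)))%:E) =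
    fubini_F m2 (fun z => (u z)%:E).
  apply/funext => x; rewrite /Rintegral fineK//.
  by apply: integrable_fin_num => //; exact: iu2.
rewrite e; split; first exact: (integrable_fubini_F iu).
by rewrite {1}/Rintegral e (integral12_prod_meas1 iu).
Qed.

Let real21 (u : T1 * T2 -> R) : m12.-integrable setT (fun z => (u z)%:E) ->
  (forall y, m1.-integrable setT (fun x => (u (x, y))%:E)) ->
  m2.-integrable setT (fun y => (Rintegral m1 setT (fun x => u (x, y)))%:E) /\
  Rintegral m2 setT (fun y => Rintegral m1 setT (fun x => u (x, y))) =
  Rintegral m12 setT u.
Proof.
move=> iu iu2.
have e : (fun y => (Rintegral m1 setT (fun x => u (x, y)))%:E) =
    fubini_G m1 (fun z => (u z)%:E).
  apply/funext => x; rewrite /Rintegral fineK//.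
  by apply: integrable_fin_num => //; exact: iu2.
rewrite e; split.
  have mE := measurable_int _ iu.
  apply/integrableP; split; first exact: (measurable_fubini_G (m2 := m2) iu).
  apply: le_lt_trans ((integrable21ltyP m1 m2 mE).1 iu).
  apply: ge0_le_integral => //.
  - by apply: measurableT_comp => //; exact: (measurable_fubini_G (m2 := m2) iu).
  - apply: (measurable_fun_fubini_tonelli_G (fun z => `|(u z)%:E|%E)) => //.
    exact: measurableT_comp.
  - by move=> y _; apply: le_abse_integral => //; exact: (measurable_int _ (iu2 y)).
by rewrite {1}/Rintegral e (integral21_prod_meas1 iu).
Qed.

(** Slices are integrable for every x rather than almost every x, so that the inner real integral
    agrees pointwise with the extended one. *)
Lemma cfubini12 (F : T1 * T2 -> C) : cintegrable m12 setT F ->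
  (forall x, cintegrable m2 setT (fun y => F (x, y))) ->
  cintegrable m1 setT (fun x => cint m2 setT (fun y => F (x, y))) /\
  cint m1 setT (fun x => cint m2 setT (fun y => F (x, y))) = cint m12 setT F.
Proof.
move=> [i1 i2] hF.
have [a1 a2] := real12 i1 (fun x => (hF x).1).
have [b1 b2] := real12 i2 (fun x => (hF x).2).
by split; [split|apply: complexP].
Qed.

Lemma cfubini21 (F : T1 * T2 -> C) : cintegrable m12 setT F ->
  (forall y, cintegrable m1 setT (fun x => F (x, y))) ->
  cintegrable m2 setT (fun y => cint m1 setT (fun x => F (x, y))) /\
  cint m2 setT (fun y => cint m1 setT (fun x => F (x, y))) = cint m12 setT F.
Proof.
move=> [i1 i2] hF.
have [a1 a2] := real21 i1 (fun x => (hF x).1).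
have [b1 b2] := real21 i2 (fun x => (hF x).2).
by split; [split|apply: complexP].
Qed.

Lemma prod_cintegrable (F : T1 * T2 -> C) (u : T1 * T2 -> R) (U : T1 -> R) :
  cmeasurable setT F -> measurable_fun setT u ->
  (forall z, norm1 (F z) <= u z) ->
  (forall x, (\int[m2]_y `|(u (x, y))%:E| <= (U x)%:E)%E) ->
  m1.-integrable setT (fun x => (U x)%:E) -> cintegrable m12 setT F.
Proof.
move=> mF mu' Fu hU iU; apply: (cintegrable_le (u := u)) => //.
exact: prod_integrable iU.
Qed.

End ComplexFubini.

(* The library only equips the product of two measures with a measure structure. *)
Section ProductSigmaFinite.
Context d1 d2 (T1 : measurableType d1) (T2 : measurableType d2) (R : realType).
Variable m1 : {sigma_finite_measure set T1 -> \bar R}.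
Variable m2 : {sigma_finite_measure set T2 -> \bar R}.

Definition prod_measure : set (T1 * T2) -> \bar R := (m1 \x m2)%E.

HB.instance Definition _ := Measure.on prod_measure.

Lemma prod_measure_sigma_finite : sigma_finite setT prod_measure.
Proof.
have /sigma_finiteP[F [TF ndF Foo]] := sigma_finiteT m1.
have /sigma_finiteP[H [TH ndH Hoo]] := sigma_finiteT m2.
exists (fun n => F n `*` H n).
  apply/seteqP; split => [[x y] _|//].
  have [i _ Fx] : (\bigcup_n F n) x by rewrite -TF.
  have [j _ Hy] : (\bigcup_n H n) y by rewrite -TH.
  exists (i + j)%N => //; split => /=.
    by have /subsetPset := ndF _ _ (leq_addr j i); apply.
  by have /subsetPset := ndH _ _ (leq_addl i j); apply.
move=> n; have [mF oF] := Foo n; have [mH oH] := Hoo n.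
split; first exact: measurableX.
rewrite /prod_measure product_measure1E//.
by rewrite lte_mul_pinfty// ge0_fin_numE.
Qed.

HB.instance Definition _ := Measure_isSigmaFinite.Build _ _ _ prod_measure
  prod_measure_sigma_finite.

End ProductSigmaFinite.

Section Indicator.
Variable R : realType.
Local Notation C := R[i].
Local Notation TR := (measurableTypeR R).
Local Notation mu := (@lebesgue_measure R).
Implicit Types (A : set TR) (f g : TR -> C).

(** Domains become factors of the integrand, so Fubini's theorem can be applied on full product
    spaces. *)
Definition ind (A : set R) (x : R) : C := (\1_A x)%:C.

Lemma indT (A : set R) x : A x -> ind A x = 1.
Proof. by move=> Ax; rewrite /ind indicE mem_set. Qed.
Lemma indF (A : set R) x : ~ A x -> ind A x = 0.
Proof. by move=> Ax; rewrite /ind indicE memNset. Qed.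

Lemma norm1_ind_le (A : set R) x (z : C) : norm1 (ind A x * z) <= norm1 z.
Proof.
have [Ax|Ax] := pselect (A x); first by rewrite indT// mul1r.
by rewrite indF// mul0r norm1_0 norm1_ge0.
Qed.

Lemma cmeasurable_ind A : measurable A -> cmeasurable [set: TR] (ind A).
Proof. by move=> mA; apply: cmeasurable_real; exact: measurable_indic. Qed.

Let real_ind (A : set R) (u : R -> R) : (u \_ A) = (fun x => \1_A x * u x).
Proof.
apply/funext => x; rewrite patchE indicE; case: ifPn => // _; rewrite ?mul1r//.
by rewrite mul0r.
Qed.

Let ReM (A : set R) x (z : C) : complex.Re (ind A x * z) = \1_A x * complex.Re z.
Proof. by rewrite cReM/= mul0r subr0. Qed.
Let ImM (A : set R) x (z : C) : complex.Im (ind A x * z) = \1_A x * complex.Im z.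
Proof. by rewrite cImM/= mul0r addr0. Qed.

Lemma cint_ind A f : cint mu setT (fun x => ind A x * f x) = cint mu A f.
Proof.
apply: complexP => /=; rewrite [RHS]Rintegral_mkcond real_ind.
- by apply: eq_Rintegral => x _; rewrite ReM.
- by apply: eq_Rintegral => x _; rewrite ImM.
Qed.

Lemma integrable_ind A (u : TR -> R) : measurable A ->
  mu.-integrable A (fun x => (u x)%:E) ->
  mu.-integrable setT (fun x => (\1_A x * u x)%:E).
Proof.
move=> mA iu; have := integrable_patch measurableT mA iu.
by apply: eq_integrable => // x _; rewrite real_ind.
Qed.

Lemma Rintegral_ind A (u : TR -> R) :
  Rintegral mu setT (fun x => \1_A x * u x) = Rintegral mu A u.
Proof. by rewrite [RHS]Rintegral_mkcond real_ind. Qed.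

Lemma cintegrable_ind A f : measurable A -> cintegrable mu A f ->
  cintegrable mu setT (fun x => ind A x * f x).
Proof.
move=> mA [f1 f2]; split.
- by apply: eq_integrable (integrable_ind mA f1) => // x _; rewrite ReM.
- by apply: eq_integrable (integrable_ind mA f2) => // x _; rewrite ImM.
Qed.

(** A point is null. This disposes of the diagonal, where the value of the kernel carries no
    meaning. *)
Lemma cint_point A f g (x : R) : measurable A -> cmeasurable A g ->
  (forall y : R, A y -> y <> x -> f y = g y) -> cint mu A f = cint mu A g.
Proof.
move=> mA [g1 g2] fg.
have mx : measurable (A `\ x : set TR) by exact: measurableD.
have main (u v : R -> R) : measurable_fun A v ->
    (forall y : R, A y -> y <> x -> u y = v y) -> Rintegral mu A u = Rintegral mu A v.
  move=> mv uv; rewrite /Rintegral; congr fine.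
  have mv' : measurable_fun (A `\ x) (fun y => (v y)%:E).
    by apply/measurable_EFinP; apply: measurable_funS mv => // y [].
  have mu' : measurable_fun (A `\ x) (fun y => (u y)%:E).
    by apply: eq_measurable_fun mv' => y; rewrite inE => -[Ay yx]; rewrite uv.
  rewrite -(integral_setD1 mx mu') -(integral_setD1 mx mv').
  by apply: eq_integral => y; rewrite inE => -[Ay yx]; rewrite uv.
by apply: complexP; apply: main => // y Ay yx; rewrite fg.
Qed.

End Indicator.

Lemma cmeasurable_comp d1 d2 (T1 : measurableType d1) (T2 : measurableType d2)
    (R : realType) (f : T2 -> R[i]) (u : T1 -> T2) :
  cmeasurable setT f -> measurable_fun setT u -> cmeasurable setT (fun x => f (u x)).
Proof.
move=> [f1 f2] mu'; split.
- exact: (measurableT_comp f1).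
- exact: (measurableT_comp f2).
Qed.

Lemma Rintegral_itv_cst (R : realType) (a b c : R) : a <= b ->
  Rintegral lebesgue_measure `[a, b] (fun=> c) = c * (b - a).
Proof.
move=> ab; rewrite mulrBr; apply: (@ftc_itv _ (fun x => c * x)) => // x _.
- by apply: is_derive_eq (isd_mul (isd_cst c x) (isd_id x)) _; rewrite mul0r add0r mulr1.
- exact: cvg_cst.
Qed.

(** * The quadratic form of a superposed kernel *)

Section Superposition.
Variable R : realType.
Local Notation C := R[i].
Local Notation TR := (measurableTypeR R).
Local Notation mu := (@lebesgue_measure R).
Local Notation mu2 := (prod_measure mu mu).
Variables (M A B S : R) (tau : R -> C) (D : set TR) (Phi : R -> R -> C).
Hypothesis M0 : 0 < M.
Hypothesis mD : measurable D.
Hypothesis ctau : forall x, ccontinuous_at tau x.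
Hypothesis A0 : 0 <= A.
Hypothesis B0 : 0 <= B.
Hypothesis S0 : 0 <= S.
Hypothesis tauS : forall x, - M <= x <= M -> norm1 (tau x) <= S.
Hypothesis mPhi : cmeasurable setT (fun p : TR * TR => Phi p.1 p.2).
Hypothesis bPhi : forall r t, 0 <= r -> D t -> norm1 (Phi r t) <= B.
Hypothesis iPhi : forall r, 0 < r <= 2 * M -> cintegrable mu D (Phi r) /\
  Rintegral mu D (fun t => norm1 (Phi r t)) <= A * rsqrt r.

Local Notation X := (`[- M, M]%classic : set TR).
Local Notation off := (~` [set 0] : set TR).

(* Vanishes on the diagonal, where the kernels below are singular. *)
Definition quad_weight (z : TR * TR) : C := conjc (ind X z.1 * tau z.1) * (ind X z.2 * tau z.2) *
  ind off (z.1 - z.2).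

Local Notation w := quad_weight.

(** The form <kappa tau, tau> on the segment, off the diagonal. *)
Definition quad (kappa : R -> R -> C) : C :=
  cint mu setT (fun x => cint mu setT (fun y => w (x, y) * kappa x y)).

(** Without integrability the iterated integral takes default values and linearity in the kernel is
    lost. *)
Definition quad_ok (kappa : R -> R -> C) :=
  (forall x, cintegrable mu setT (fun y => w (x, y) * kappa x y)) /\
  cintegrable mu setT (fun x => cint mu setT (fun y => w (x, y) * kappa x y)).

Lemma quad_okZ (c : C) kappa : quad_ok kappa ->
  quad_ok (fun x y => c * kappa x y) /\
  quad (fun x y => c * kappa x y) = c * quad kappa.
Proof.
move=> [h1 h2].
have e x : (fun y => w (x, y) * (c * kappa x y)) = (fun y => c * (w (x, y) * kappa x y)).
  by apply/funext => y; rewrite mulrCA.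
have e2 : (fun x => cint mu setT (fun y => w (x, y) * (c * kappa x y))) =
    (fun x => c * cint mu setT (fun y => w (x, y) * kappa x y)).
  by apply/funext => x; rewrite e cintZ//; exact: h1.
split; last by rewrite /quad e2 cintZ.
split => [x|]; first by rewrite e; apply: cintegrableZ => //; exact: h1.
by rewrite e2; exact: cintegrableZ.
Qed.

Lemma quad_okD kappa1 kappa2 : quad_ok kappa1 -> quad_ok kappa2 ->
  quad (fun x y => kappa1 x y + kappa2 x y) = quad kappa1 + quad kappa2.
Proof.
move=> [h1 h2] [g1 g2]; rewrite /quad -cintD//; congr cint; apply/funext => x.
rewrite -cintD//.
by congr cint; apply/funext => y; rewrite mulrDr.
Qed.

Let XE (x : R) : X x <-> - M <= x <= M. Proof. by rewrite /= in_itv. Qed.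

Let cm_tau : cmeasurable [set: TR] tau.
Proof. by apply: ccontinuous_cmeasurable. Qed.

Let m_off : measurable off. Proof. by apply: measurableC. Qed.

Let m_sub : measurable_fun [set: TR * TR] (fun z : TR * TR => z.1 - z.2).
Proof. by apply: measurable_funB. Qed.

Let m_dist : measurable_fun [set: TR * TR] (fun z : TR * TR => `|z.1 - z.2|).
Proof. exact: (measurableT_comp (@normr_measurable _ setT) m_sub). Qed.

Let cm_w : cmeasurable setT w.
Proof.
have m1 : cmeasurable [set: TR] (fun x => ind X x * tau x).
  by apply: cmeasurableM => //; apply: cmeasurable_ind.
apply: cmeasurableM; first apply: cmeasurableM.
- apply: cmeasurable_conjc; exact: (cmeasurable_comp m1 measurable_fst).
- exact: (cmeasurable_comp m1 measurable_snd).
- exact: (cmeasurable_comp (cmeasurable_ind m_off) m_sub).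
Qed.

Let mX : measurable X. Proof. exact: measurable_itv. Qed.

Let w0 x y : ~ [/\ X x, X y & x <> y] -> w (x, y) = 0.
Proof.
move=> h; rewrite /quad_weight /=.
have [Xx|nX] := pselect (X x); last by rewrite (indF nX) mul0r conjc0 !mul0r.
have [Xy|nX] := pselect (X y); last by rewrite (indF nX) mul0r mulr0 mul0r.
rewrite (@indF _ off) ?mulr0// => n0; apply: h; split => // e.
by apply: n0; rewrite e subrr.
Qed.

Lemma eq_quad (kappa1 kappa2 : R -> R -> C) :
  (forall x y, x <> y -> kappa1 x y = kappa2 x y) -> quad kappa1 = quad kappa2.
Proof.
move=> h; congr cint; apply/funext => x; congr cint; apply/funext => y.
have [->|/eqP xy] := eqVneq x y; last by rewrite h.
by rewrite w0 ?mul0r// => -[].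
Qed.

Let w_le x y : norm1 (w (x, y)) <= S ^+ 2 * (\1_X x * \1_X y).
Proof.
have [[Xx Xy xy]|/w0 ->] := pselect [/\ X x, X y & x <> y]; last first.
  by rewrite norm1_0 mulr_ge0// ?sqr_ge0// mulr_ge0.
rewrite /quad_weight /= (indT Xx) (indT Xy) !indicE !mem_set// !mulr1 !mul1r mulrC.
rewrite (le_trans (norm1_ind_le _ _ _))// (le_trans (norm1M _ _))// norm1_conjc expr2.
by rewrite ler_pM ?norm1_ge0// tauS//; exact/XE.
Qed.

Let int_ind_le (E : set TR) (u v : TR -> R) (b : R) : measurable E ->
  mu.-integrable E (fun t => (u t)%:E) -> Rintegral mu E u <= b ->
  measurable_fun setT v -> (forall t, `|v t| <= \1_E t * u t) ->
  (\int[mu]_t `|(v t)%:E| <= b%:E)%E.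
Proof.
move=> mE iu ub mv vu; have iE := integrable_ind mE iu.
apply: (@le_trans _ _ (\int[mu]_t (\1_E t * u t)%:E)%E).
  apply: ge0_le_integral => //.
  - by apply: measurableT_comp => //; exact/measurable_EFinP.
  - by have := measurable_int _ iE.
  - by move=> t _; rewrite lee_fin vu.
rewrite -(@fineK _ (\int[mu]_t (\1_E t * u t)%:E)%E); last first.
  exact: integrable_fin_num.
rewrite lee_fin -/(Rintegral mu setT (fun t => \1_E t * u t)).
by rewrite Rintegral_ind.
Qed.

Let G (z : (TR * TR) * TR) : C := w z.1 * (ind D z.2 * Phi `|z.1.1 - z.1.2| z.2).

Let cm_G : cmeasurable setT G.
Proof.
apply: cmeasurableM; first exact: (cmeasurable_comp cm_w measurable_fst).
apply: cmeasurableM.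
  exact: (cmeasurable_comp (cmeasurable_ind mD) measurable_snd).
apply: (cmeasurable_comp mPhi (u := fun z : TR * TR * TR => (`|z.1.1 - z.1.2|, z.2))).
apply: measurable_fun_pair => //.
exact: (measurableT_comp m_dist measurable_fst).
Qed.

Let pair1 x : measurable_fun [set: TR] (fun y : TR => (x, y) : TR * TR).
Proof. exact: measurable_fun_pair. Qed.

Let U (z : TR * TR) : R := S ^+ 2 * (\1_X z.1 * \1_X z.2) * (A * rsqrt `|z.1 - z.2|).
Let V (z : TR * TR) : R := S ^+ 2 * (\1_X z.1 * \1_X z.2) * B.

Let m_ind1 : measurable_fun setT (fun z : TR * TR => S ^+ 2 * (\1_X z.1 * \1_X z.2) : R).
Proof.
have mI : measurable_fun [set: TR] (\1_X : TR -> R) by exact: measurable_indic.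
apply: measurable_funM => //; apply: measurable_funM.
  exact: (measurableT_comp mI measurable_fst).
exact: (measurableT_comp mI measurable_snd).
Qed.

Let mU : measurable_fun setT U.
Proof.
apply: measurable_funM => //; apply: measurable_funM => //.
exact: (measurableT_comp (@measurable_rsqrt R) m_dist).
Qed.

Let mV : measurable_fun setT V. Proof. exact: measurable_funM. Qed.

Let c0 (x y : R) : 0 <= S ^+ 2 * (\1_X x * \1_X y) :> R.
Proof. by rewrite mulr_ge0 ?sqr_ge0// mulr_ge0. Qed.

Let U0 z : 0 <= U z.
Proof. by case: z => x y; rewrite mulr_ge0 ?c0// mulr_ge0// rsqrt_ge0. Qed.

Let V0 z : 0 <= V z.
Proof. by case: z => x y; rewrite mulr_ge0 ?c0. Qed.

Let rangeXY x y : X x -> X y -> x <> y -> 0 < `|x - y| <= 2 * M.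
Proof.
move=> /XE h1 /XE h2 /eqP xy; rewrite normr_gt0 subr_eq0 xy/= ler_norml; lra.
Qed.

Let G_int z : (\int[mu]_t `|(norm1 (G (z, t)))%:E| <= (U z)%:E)%E.
Proof.
case: z => x y; have mG : measurable_fun [set: TR] (fun t => norm1 (G ((x, y), t))).
  apply: measurable_norm1; apply: (cmeasurable_comp cm_G (u := fun t => ((x, y), t))).
  exact: measurable_fun_pair.
have [[Xx Xy xy]|/w0 h] := pselect [/\ X x, X y & x <> y]; last first.
  rewrite (eq_integral (fun=> 0%E)) ?integral0 ?lee_fin ?U0// => t _.
  by rewrite /G /= h mul0r norm1_0 normr0.
have [iP iA] := iPhi (rangeXY Xx Xy xy).
have iN := integrable_norm1 mD iP.
have iSN := integrableZ_fin (S ^+ 2) mD iN.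
apply: (int_ind_le (E := D) mD iSN) => //.
- rewrite RintegralZl// /U /= !indicE !mem_set// !mulr1.
  by rewrite ler_wpM2l ?sqr_ge0.
- move=> t; rewrite ger0_norm ?norm1_ge0// /G /=.
  have [Dt|nD] := pselect (D t); last first.
    by rewrite (indF nD) mul0r mulr0 norm1_0 indicE memNset// mul0r.
  rewrite (indT Dt) mul1r indicE mem_set// mul1r (le_trans (norm1M _ _))//.
  rewrite ler_wpM2r ?norm1_ge0// (le_trans (w_le _ _))// ler_piMr ?sqr_ge0//.
Qed.

Let ind1 x : X x -> \1_X x = 1 :> R. Proof. by move=> h; rewrite indicE mem_set. Qed.
Let ind0 x : ~ X x -> \1_X x = 0 :> R. Proof. by move=> h; rewrite indicE memNset. Qed.

Let U_int x : mu.-integrable setT (fun y => (U (x, y))%:E) /\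
  (\int[mu]_y `|(U (x, y))%:E| <= (\1_X x * (S ^+ 2 * A * (8 * Num.sqrt (3 * M))))%:E)%E.
Proof.
have mUx : measurable_fun [set: TR] (fun y => U (x, y)).
  exact: (measurableT_comp mU (pair1 x)).
have bnd : (\int[mu]_y `|(U (x, y))%:E| <= (\1_X x * (S ^+ 2 * A * (8 * Num.sqrt (3 * M))))%:E)%E.
  have [Xx|nX] := pselect (X x); last first.
    rewrite (eq_integral (fun=> 0%E)).
      by rewrite integral0 lee_fin (ind0 nX) mul0r.
    by move=> t _; rewrite /U /= (ind0 nX) mul0r mulr0 mul0r normr0.
  have iR := integrable_rsqrt_dist M0 ((XE x).1 Xx).
  have iSR := integrableZ_fin (S ^+ 2 * A) mX iR.
  apply: (int_ind_le (E := X) _ iSR) => //.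
  - rewrite RintegralZl// (ind1 Xx) mul1r ler_wpM2l ?mulr_ge0 ?sqr_ge0//.
    exact: (Rintegral_rsqrt_dist M0 ((XE x).1 Xx)).
  - move=> y; rewrite ger0_norm ?U0// /U /= (ind1 Xx) mul1r.
    by rewrite le_eqVlt; apply/orP; left; apply/eqP; ring.
split => //; apply/integrableP; split; first exact/measurable_EFinP.
exact: le_lt_trans bnd (ltry _).
Qed.

Let mass : Rintegral mu X (fun=> S ^+ 2 * B) = S ^+ 2 * B * (2 * M).
Proof.
by rewrite Rintegral_itv_cst ?opprK; [ring|rewrite (le_trans _ (ltW M0))// oppr_le0 ltW].
Qed.

Let V_int x : mu.-integrable setT (fun y => (V (x, y))%:E) /\
  (\int[mu]_y `|(V (x, y))%:E| <= (\1_X x * (S ^+ 2 * B * (2 * M)))%:E)%E.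
Proof.
have mVx : measurable_fun [set: TR] (fun y => V (x, y)).
  exact: (measurableT_comp mV (pair1 x)).
have bnd : (\int[mu]_y `|(V (x, y))%:E| <= (\1_X x * (S ^+ 2 * B * (2 * M)))%:E)%E.
  have [Xx|nX] := pselect (X x); last first.
    rewrite (eq_integral (fun=> 0%E)).
      by rewrite integral0 lee_fin (ind0 nX) mul0r.
    by move=> t _; rewrite /V /= (ind0 nX) mul0r mulr0 mul0r normr0.
  have iC : mu.-integrable X (fun=> (S ^+ 2 * B)%:E).
    by apply: continuous_itv_integrable => ? _; exact: cvg_cst.
  apply: (int_ind_le (E := X) _ iC) => //.
  - by rewrite mass (ind1 Xx) mul1r.
  - move=> y; rewrite ger0_norm ?V0// /V /= (ind1 Xx) mul1r.
    by rewrite le_eqVlt; apply/orP; left; apply/eqP; ring.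
split => //; apply/integrableP; split; first exact/measurable_EFinP.
exact: le_lt_trans bnd (ltry _).
Qed.

Let iX (c : R) : mu.-integrable setT (fun x => (\1_X x * c)%:E).
Proof.
apply: (@integrable_ind _ X (fun=> c)) => //.
by apply: continuous_itv_integrable => ? _; exact: cvg_cst.
Qed.

Let iU : mu2.-integrable setT (fun z => (U z)%:E).
Proof. exact: (prod_integrable mU (fun x => (U_int x).2) (iX _)). Qed.

Let iG : cintegrable (mu2 \x mu)%E setT G.
Proof.
have mN := measurable_norm1 cm_G.
have h := @prod_cintegrable _ _ _ _ R mu2 mu G (fun z => norm1 (G z)) U cm_G mN (fun z => lexx _) G_int.
exact: h iU.
Qed.

Let G_t z : cintegrable mu setT (fun t => G (z, t)).
Proof.
case: z => x y.
have [[Xx Xy xy]|/w0 h] := pselect [/\ X x, X y & x <> y].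
- have [iP _] := iPhi (rangeXY Xx Xy xy).
  have -> : (fun t => G (x, y, t)) = (fun t => ind D t * (w (x, y) * Phi `|x - y| t)).
    by apply/funext => t; rewrite /G /= mulrCA.
  by apply: cintegrable_ind => //; exact: cintegrableZ.
- have -> : (fun t => G (x, y, t)) = (fun=> 0) by apply/funext => t; rewrite /G /= h mul0r.
  split; exact: integrable0.
Qed.

Let K z : C := cint mu setT (fun t => G (z, t)).

Let KE x y : K (x, y) = w (x, y) * cint mu D (Phi `|x - y|).
Proof.
have [[Xx Xy xy]|/w0 h] := pselect [/\ X x, X y & x <> y].
- have [iP _] := iPhi (rangeXY Xx Xy xy).
  rewrite -cintZ// -cint_ind; congr cint; apply/funext => t.
  by rewrite /G /= mulrCA.
- rewrite h mul0r -(@cint0 _ _ _ mu setT); congr cint; apply/funext => t.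
  by rewrite /G /= h mul0r.
Qed.

Let K_le z : norm1 (K z) <= U z.
Proof.
apply: (le_trans (norm1_cint measurableT (G_t z))).
have iN := integrable_norm1 measurableT (G_t z).
rewrite -lee_fin /Rintegral fineK; last exact: integrable_fin_num.
apply: le_trans (G_int z); rewrite le_eqVlt; apply/orP; left; apply/eqP.
by apply: eq_integral => t _; rewrite /= ger0_norm ?norm1_ge0.
Qed.

Let mass_K : quad_ok (fun x y => cint mu D (Phi `|x - y|)) /\
  quad (fun x y => cint mu D (Phi `|x - y|)) = cint (mu2 \x mu)%E setT G.
Proof.
have [iK <-] := cfubini12 iG G_t.
have mK := cintegrable_measurable iK.
have h x : cintegrable mu setT (fun y => K (x, y)).
  have mx := cmeasurable_comp mK (pair1 x).
  by have [iUx _] := U_int x; exact: (cintegrable_le measurableT mx iUx (fun y _ => K_le (x, y))).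
have e x : (fun y => w (x, y) * cint mu D (Phi `|x - y|)) = (fun y => K (x, y)).
  by apply/funext => y; rewrite KE.
have [h1 <-] := cfubini12 iK h.
split; last by congr cint; apply/funext => x; rewrite e.
split => [x|]; first by rewrite e; exact: h.
by have -> : (fun x => cint mu setT (fun y => w (x, y) * cint mu D (Phi `|x - y|))) =
  (fun x => cint mu setT (fun y => K (x, y))) by apply/funext => x; rewrite e.
Qed.

Let G_le z t : norm1 (G (z, t)) <= V z.
Proof.
case: z => x y; rewrite /G /V /=.
rewrite (le_trans (norm1M _ _))// ler_pM ?norm1_ge0// ?w_le//.
have [Dt|nD] := pselect (D t); last by rewrite (indF nD) mul0r norm1_0.
by rewrite (indT Dt) mul1r bPhi.
Qed.

Let cm_Gt t : cmeasurable setT (fun z => G (z, t)).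
Proof.
apply: (cmeasurable_comp cm_G (u := fun z => (z, t))).
exact: measurable_fun_pair.
Qed.

Let iGt t : cintegrable mu2 setT (fun z => G (z, t)).
Proof.
have h := @prod_cintegrable _ _ _ _ R mu mu (fun z => G (z, t)) V
  (fun x => \1_X x * (S ^+ 2 * B * (2 * M))) (cm_Gt t) mV (fun z => G_le z t) (fun x => (V_int x).2).
exact: h (iX _).
Qed.

Let Gt_int t x : cintegrable mu setT (fun y => G (x, y, t)).
Proof.
have mx := cmeasurable_comp (cm_Gt t) (pair1 x).
have [iVx _] := V_int x.
exact: (cintegrable_le measurableT mx iVx (fun y _ => G_le (x, y) t)).
Qed.

Lemma quad_ok_slice t : D t -> quad_ok (fun x y => Phi `|x - y| t).
Proof.
move=> Dt; have [h1 _] := cfubini12 (iGt t) (Gt_int t).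
have e x : (fun y => w (x, y) * Phi `|x - y| t) = (fun y => G (x, y, t)).
  by apply/funext => y; rewrite /G /= (indT Dt) mul1r.
split => [x|]; first by rewrite e; exact: Gt_int.
by have -> : (fun x => cint mu setT (fun y => w (x, y) * Phi `|x - y| t)) =
  (fun x => cint mu setT (fun y => G (x, y, t))) by apply/funext => x; rewrite e.
Qed.

Let quad_t t : cint mu2 setT (fun z => G (z, t)) = ind D t * quad (fun x y => Phi `|x - y| t).
Proof.
have [_ <-] := cfubini12 (iGt t) (Gt_int t).
have [Dt|nD] := pselect (D t).
  rewrite (indT Dt) mul1r; congr cint; apply/funext => x; congr cint; apply/funext => y.
  by rewrite /G /= (indT Dt) mul1r.
rewrite (indF nD) mul0r -(@cint0 _ _ _ mu setT); congr cint; apply/funext => x.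
rewrite -(@cint0 _ _ _ mu setT); congr cint; apply/funext => y.
by rewrite /G /= (indF nD) mul0r mulr0.
Qed.

(** Fubini on the product of the square and D. Absolute convergence comes from integrating in t
    first, which leaves the integrable majorant [U]; slices at fixed t are bounded by [V]. *)
Lemma quad_superposition : [/\ quad_ok (fun x y => cint mu D (Phi `|x - y|)),
  cintegrable mu D (fun t => quad (fun x y => Phi `|x - y| t)) &
  quad (fun x y => cint mu D (Phi `|x - y|)) =
  cint mu D (fun t => quad (fun x y => Phi `|x - y| t))].
Proof.
have [iQ eQ] := cfubini21 iG iGt.
have e : (fun t => cint mu2 setT (fun z => G (z, t))) =
    (fun t => ind D t * quad (fun x y => Phi `|x - y| t)).
  by apply/funext => t; exact: quad_t.
have [okK eK] := mass_K.
rewrite e in iQ eQ; split; first exact: okK.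
  have [q1 q2] := iQ; split.
  - apply: eq_integrable (integrableS measurableT mD _ q1) => // t; rewrite inE => Dt.
    by rewrite (indT Dt) mul1r.
  - apply: eq_integrable (integrableS measurableT mD _ q2) => // t; rewrite inE => Dt.
    by rewrite (indT Dt) mul1r.
by rewrite -[RHS]cint_ind eQ.
Qed.

Lemma quadE (kappa : R -> R -> C) :
  (forall x, - M <= x <= M -> cintegrable mu X (fun y => tau y * kappa x y)) ->
  quad kappa = cint mu X (fun x => conjc (tau x) * cint mu X (fun y => tau y * kappa x y)).
Proof.
move=> ik; rewrite /quad -[RHS]cint_ind; congr cint; apply/funext => x.
have [Xx|nX] := pselect (X x); last first.
  rewrite (indF nX) mul0r -(@cint0 _ _ _ mu setT); congr cint; apply/funext => y.
  by rewrite w0 ?mul0r// => -[].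
have ikx := ik x ((XE x).1 Xx).
rewrite (indT Xx) mul1r -cintZ//.
have -> : (fun y => w (x, y) * kappa x y) =
    (fun y => ind X y * (conjc (tau x) * (tau y * (ind off (x - y) * kappa x y)))).
  by apply/funext => y; rewrite /quad_weight /= (indT Xx) mul1r; ring.
rewrite cint_ind.
have mk := cintegrable_measurable ikx.
apply: (@cint_point _ _ _ _ x) => //.
- by apply: cmeasurableM => //; exact: cmeasurable_cst.
- move=> y _ yx; rewrite (@indT _ off) ?mul1r//= => /eqP; rewrite subr_eq0 => /eqP e.
  by apply: yx.
Qed.

End Superposition.

Section ComplexExponential.
Variable R : realType.
Local Notation C := R[i].

Lemma cmeasurable_cexp d (T : measurableType d) (f : T -> C) : cmeasurable setT f ->
  cmeasurable setT (fun x => cexp (f x)).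
Proof.
move=> [f1 f2].
have me : measurable_fun [set: T] (fun x => expR (complex.Re (f x))).
  exact: (measurableT_comp (@measurable_expR R)).
split; rewrite /cexp /=; apply: measurable_funM => //.
- by apply: measurableT_comp => //; apply: continuous_measurable_fun; exact: continuous_cos.
- by apply: measurableT_comp => //; apply: continuous_measurable_fun; exact: continuous_sin.
Qed.

End ComplexExponential.

(** * Masses of the angular and Laplace families *)

Section HankelKernels.
Variable R : realType.
Local Notation C := R[i].
Local Notation TR := (measurableTypeR R).
Local Notation mu := (@lebesgue_measure R).
Local Notation Dt := (`[0, pi / 2]%classic : set TR).
Local Notation Ds := (`[0, +oo[%classic : set TR).
Variable k : C.
Hypothesis k0 : 0 < complex.Re k.
Hypothesis k1 : 0 <= complex.Im k.
Variable M : R.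
Hypothesis M0 : 0 < M.

Let fstT : measurable_fun [set: TR * TR] (fun p : TR * TR => p.1 : R).
Proof. exact: measurable_fst. Qed.
Let sndT : measurable_fun [set: TR * TR] (fun p : TR * TR => p.2 : R).
Proof. exact: measurable_snd. Qed.

Lemma cmeasurable2_angl : cmeasurable setT (fun p : TR * TR => angl k (fun=> 1) p.1 p.2).
Proof.
apply: cmeasurableM; first exact: cmeasurable_cst.
apply: cmeasurable_cexp; apply: cmeasurableM; first exact: cmeasurable_cst.
apply: cmeasurable_real; apply: measurable_funM => //.
by apply: (measurableT_comp _ sndT); apply: continuous_measurable_fun; exact: continuous_cos.
Qed.

Lemma cmeasurable2_lapl :
  cmeasurable setT (fun p : TR * TR => lapl k (fun s => (wgt s)%:C) p.1 p.2).
Proof.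
apply: cmeasurableM.
  by apply: (cmeasurable_comp (f := fun s : TR => (wgt s)%:C) (u := snd)) => //; exact: cmeasurable_wgt.
apply: cmeasurable_cexp.
have -> : (fun x : TR * TR => - (k * (x.1 * x.2)%:C)) = (fun x => - k * (x.1 * x.2)%:C).
  by apply/funext => x; rewrite mulNr.
apply: cmeasurableM; first exact: cmeasurable_cst.
by apply: cmeasurable_real; exact: measurable_funM.
Qed.

Lemma angl_le2 r t : 0 <= r -> Dt t -> norm1 (angl k (fun=> 1) r t) <= 2.
Proof.
move=> r0; rewrite /= in_itv/= => /andP[t0 t1].
rewrite /angl mul1r (le_trans (norm1_angl_exp _ _ _))//.
rewrite -[leRHS]mulr1 ler_wpM2l// -[leRHS]expR0 ler_expR oppr_le0.
rewrite mulr_ge0// mulr_ge0// cos_ge0_pihalf// t1 andbT.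
by rewrite (le_trans _ t0)// oppr_le0 divr_ge0// pi_ge0.
Qed.

Lemma lapl_le2 r s : 0 <= r -> Ds s -> norm1 (lapl k (fun s => (wgt s)%:C) r s) <= 2.
Proof.
move=> r0; rewrite /= in_itv/= andbT => s0; rewrite /lapl norm1_realM.
rewrite -[leRHS]mul1r ler_pM ?norm1_ge0//; last exact: norm1_cexp_lapl2.
by rewrite ger0_norm ?wgt_le1// ltW// wgt_gt0.
Qed.

Let c1 : everywhere_cont (fun _ : R => 1 : C).
Proof. by move=> t; exact: ccontinuous_cst. Qed.

Let pi20 : 0 <= pi / 2 :> R. Proof. by rewrite divr_ge0// pi_ge0. Qed.

Let angl_mass (r : R) : 0 <= r -> cintegrable mu Dt (angl k (fun=> 1) r) /\
  Rintegral mu Dt (fun t => norm1 (angl k (fun=> 1) r t)) <= pi.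
Proof.
move=> r0; have ia := cintegrable_angl k r c1; split => //.
have i2 : mu.-integrable Dt (fun=> (2 : R)%:E).
  by apply: continuous_itv_integrable => ? _; exact: cvg_cst.
apply: (@le_trans _ _ (Rintegral mu Dt (fun=> 2 : R))).
  apply: (le_Rintegral _ (integrable_norm1 _ ia) i2) => //.
  by move=> t Dtt; exact: angl_le2.
by rewrite Rintegral_itv_cst// subr0 mulrC divfK.
Qed.

(** The mass is bounded by pi; the factor sqrt (2 M) / sqrt r >= 1 only brings it to the form shared
    with the Laplace family. *)
Lemma angl_mass_rsqrt r : 0 < r <= 2 * M -> cintegrable mu Dt (angl k (fun=> 1) r) /\
  Rintegral mu Dt (fun t => norm1 (angl k (fun=> 1) r t)) <= pi * Num.sqrt (2 * M) * rsqrt r.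
Proof.
move=> r0M; have /andP[r0 _] := r0M.
have [h1 h2] := angl_mass (ltW r0); split => //; rewrite (le_trans h2)//.
by rewrite -mulrA ler_peMr ?pi_ge0// sqrt_rsqrt_ge1.
Qed.

End HankelKernels.

Section LaplaceMass.
Variable R : realType.
Local Notation C := R[i].
Local Notation TR := (measurableTypeR R).
Local Notation mu := (@lebesgue_measure R).
Local Notation Ds := (`[0, +oo[%classic : set TR).

Let c01 : 0 < complex.Re (1 : R[i]). Proof. exact: ltr01. Qed.
Let c11 : 0 <= complex.Im (1 : R[i]). Proof. by []. Qed.

(** As [Gint 1] is i ([hank 1] - [Ein 1]), its singularity is read off from the series of the Hankel
    function. *)
Let Gint1_mass (L : R) : 0 < L -> exists2 A : R, 0 <= A & forall r, 0 < r <= L ->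
  norm1 (Gint (1 : C) r) <= A * rsqrt r.
Proof.
move=> L0; have [A A0 hA] := sqrt_holder_bound (sqrt_holder_hank (1 : C) L0).
have [Bp [Bp0 hB]] : exists Bp : R, 0 <= Bp /\ forall r, 0 < r <= L -> norm1 (Ein (1 : C) r) <= Bp * rsqrt r.
  have L2 : 0 < L / 2 by rewrite divr_gt0.
  have e2 : 2 * (L / 2) = L by rewrite mulrC divfK.
  exists (pi * Num.sqrt (2 * (L / 2))); split.
    by rewrite mulr_ge0 ?pi_ge0 ?sqrtr_ge0.
  move=> r rL; have := @angl_mass_rsqrt _ 1 c11 (L / 2) r.
  rewrite {1}e2 => /(_ rL)[h1 h2].
  exact: le_trans (norm1_cint _ h1) h2.
exists (A + Bp); first exact: addr_ge0.
move=> r rL; have /andP[r0 _] := rL.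
have -> : Gint 1 r = 'i%C * (hank 1 r - Ein 1 r).
  rewrite (hank_Hint c01 c11 r0) /Hint addrC addKr mulrN mulrA -expr2 sqr_i.
  by rewrite mulN1r opprK.
rewrite (le_trans (norm1M _ _))// norm1_i mul1r (le_trans (norm1B _ _))// mulrDl.
by rewrite lerD ?hA ?hB.
Qed.

Variable k : C.
Hypothesis k0 : 0 < complex.Re k.
Variable M : R.
Hypothesis M0 : 0 < M.

(** Up to a factor 2, the absolute integrand for k at r is the positive integrand for k = 1 at (Re
    k) r. *)
Lemma lapl_mass_rsqrt : exists2 A : R, 0 <= A & forall r, 0 < r <= 2 * M ->
  cintegrable mu Ds (lapl k (fun s => (wgt s)%:C) r) /\
  Rintegral mu Ds (fun s => norm1 (lapl k (fun s => (wgt s)%:C) r s)) <= A * rsqrt r.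
Proof.
pose kr := complex.Re k; have kr0 : 0 < kr := k0.
have L0 : 0 < kr * (2 * M) by rewrite !mulr_gt0.
have [A A0 hA] := Gint1_mass L0.
have mw : cmeasurable Ds (fun s => (wgt s)%:C) := cmeasurable_wgt (measurable_itv _).
exists (2 * A * rsqrt kr); first by rewrite mulr_ge0 ?rsqrt_ge0// mulr_ge0.
move=> r /andP[r0 rM].
have i1 : cintegrable mu Ds (lapl k (fun s => (wgt s)%:C) r).
  by apply: cintegrable_lapl => //; exact: subexp_wgt.
split => //.
have ro0 : 0 < kr * r by rewrite mulr_gt0.
have [i2 _] := @cintegrable_lapl _ 1 c01 _ (kr * r) mw (@subexp_wgt R) ro0.
have G1 := hA (kr * r); rewrite ro0 ler_wpM2l ?(ltW kr0)// in G1.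
have {}G1 := G1 isT.
have rs : rsqrt (kr * r) = rsqrt kr * rsqrt r by rewrite /rsqrt sqrtrM ?(ltW kr0)// invfM.
have lE s : complex.Re (lapl 1 (fun s => (wgt s)%:C) (kr * r) s) = wgt s * expR (- (kr * r) * s).
  by rewrite /lapl mul1r -rmorphN cexp_real -rmorphM /= mulNr.
apply: (@le_trans _ _ (Rintegral mu Ds (fun s => 2 * complex.Re (lapl 1 (fun s => (wgt s)%:C) (kr * r) s)))).
  apply: le_Rintegral => //; [exact: integrable_norm1|exact: integrableZ_fin|].
  move=> s Dss; rewrite lE /lapl norm1_realM ger0_norm; last by rewrite ltW// wgt_gt0.
  by rewrite mulrCA ler_wpM2l ?(ltW (wgt_gt0 _))// norm1_cexp_lapl.
rewrite RintegralZl// -!mulrA ler_wpM2l//.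
have := le_trans (Re_norm1 _) G1; rewrite rs => h.
by apply: le_trans h; exact: ler_norm.
Qed.

End LaplaceMass.

(** * Vanishing moments *)

Section EpsilonDelta.
Variable R : realType.
Local Notation C := R[i].
Implicit Types (f : R -> C) (x a b : R).

Let real_eps (u : R -> R) x : {for x, continuous u} <->
  forall e : R, 0 < e -> exists2 d : R, 0 < d & forall y : R, `|y - x| < d -> `|u y - u x| <= e.
Proof.
split.
- move=> cu e e0; have /cvgrPdist_le/(_ e e0)/nbhs_ballP[d d0 h] := cu; exists d => // y yx.
  by rewrite distrC; apply: h; rewrite /ball /= distrC.
- move=> h; apply/cvgrPdist_le => e e0; have [d d0 hd] := h e e0.
  apply/nbhs_ballP; exists d => // y; rewrite /ball /= => yx.
  by rewrite distrC; apply: hd; rewrite distrC.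
Qed.

Lemma ccontinuous_eps f x : ccontinuous_at f x <->
  forall e : R, 0 < e -> exists2 d : R, 0 < d &
    forall y : R, `|y - x| < d -> norm1 (f y - f x) <= e.
Proof.
split.
- move=> [/real_eps c1 /real_eps c2] e e0; have e2 : 0 < e / 2 by rewrite divr_gt0.
  have [d1 d10 h1] := c1 _ e2; have [d2 d20 h2] := c2 _ e2.
  exists (Num.min d1 d2); first by rewrite lt_min d10.
  move=> y; rewrite lt_min => /andP[/h1 a1 /h2 a2].
  by rewrite /norm1 cReB cImB [e]splitr lerD.
- move=> h; split; apply/real_eps => e e0; have [d d0 hd] := h e e0; exists d => // y /hd yd.
  + by rewrite -cReB (le_trans (Re_norm1 _)).
  + by rewrite -cImB (le_trans (Im_norm1 _)).
Qed.

Lemma eq_closed_itv f g a b : a < b ->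
  (forall x, a <= x <= b -> ccontinuous_at f x) ->
  (forall x, a <= x <= b -> ccontinuous_at g x) ->
  (forall x, a < x < b -> f x = g x) -> forall x, a <= x <= b -> f x = g x.
Proof.
move=> ab cf cg fg x xab; apply/eqP; rewrite -subr_eq0; apply/eqP.
apply: norm1_le_eps => e e0; have e2 : 0 < e / 2 by rewrite divr_gt0.
have [d1 d10 h1] := (ccontinuous_eps f x).1 (cf x xab) _ e2.
have [d2 d20 h2] := (ccontinuous_eps g x).1 (cg x xab) _ e2.
pose d := Num.min (Num.min d1 d2) (b - a).
have d0 : 0 < d by rewrite !lt_min d10 d20 subr_gt0.
have [dd1 dd2 dd3] : [/\ d <= d1, d <= d2 & d <= b - a].
  by rewrite /d; split; rewrite !ge_min !lexx ?orbT.
(* Moving d / 3 towards the farther end stays inside, because d <= b - a. *)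
have [y yab yx] : exists2 y, a < y < b & `|y - x| < d.
  have [h|h] := leP (a + b) (2 * x).
  - exists (x - d / 3); [lra|rewrite ltr_norml; lra].
  - exists (x + d / 3); [lra|rewrite ltr_norml; lra].
have g1 := h1 y (lt_le_trans yx dd1); have g2 := h2 y (lt_le_trans yx dd2).
have -> : f x - g x = (g y - g x) - (f y - f x) by rewrite (fg y yab); ring.
by rewrite (le_trans (norm1B _ _))// [e]splitr lerD.
Qed.

Lemma cderive_zero f (u v x : R) (a : C) : u < x < v ->
  (forall y, u < y < v -> f y = 0) -> cderive f x a -> a = 0.
Proof.
move=> /andP[ux xv] f0 [h1 h2].
have main (g : R -> R) (l : R) : (forall y, u < y < v -> g y = 0) -> is_derive x 1 g l -> l = 0.
  move=> g0 hg; have [_ <-] := hg; rewrite -(@derive_cst _ _ _ (0 : R) x 1).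
  apply: near_eq_derive.
  have : x \in `]u, v[ by rewrite in_itv/= ux.
  move=> xuv; near=> y; rewrite g0//; suff : y \in `]u, v[ by rewrite in_itv.
  by near: y; exact: near_in_itvoo.
by apply: complexP => /=; [apply: main h1|apply: main h2] => y /f0 ->.
Unshelve. all: by end_near. Qed.

End EpsilonDelta.

Section ZeroIntegral.
Variable R : realType.
Local Notation C := R[i].
Local Notation mu := (@lebesgue_measure R).
Implicit Types (f : R -> R) (a b : R).

Let sqr_le (a b : R) : `|a| <= b -> a ^+ 2 <= b ^+ 2.
Proof.
move=> h; have := normr_ge0 a; rewrite -(real_normK (num_real a)).
by move: `|a| h => c; nra.
Qed.

Let sqr_ge (a b : R) : 0 <= b -> b <= `|a| -> b ^+ 2 <= a ^+ 2.
Proof.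
by move=> b0; rewrite -(real_normK (num_real a)); move: `|a| => c; nra.
Qed.

Let ftc_le f F (c a b : R) : a <= b -> (forall x, {for x, continuous f}) ->
  (forall x, a <= x <= b -> is_derive x 1 F (f x)) ->
  (forall x, a <= x <= b -> c <= f x) -> c * (b - a) <= F b - F a.
Proof.
move=> ab cf dF cle.
have <- : Rintegral mu `[a, b] f = F b - F a by apply: ftc_itv.
rewrite -Rintegral_itv_cst//; apply: le_Rintegral => //.
- by apply: continuous_itv_integrable => ? _; exact: cvg_cst.
- exact: continuous_itv_integrable.
Qed.

(** The antiderivative is nondecreasing with no total increase, hence constant, so its derivative f
    vanishes at every interior point. *)
Lemma Rintegral_le0_eq0 f a b : a < b -> (forall x, {for x, continuous f}) ->
  (forall x, a <= x <= b -> 0 <= f x) -> Rintegral mu `[a, b] f <= 0 ->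
  forall x, a < x < b -> f x = 0.
Proof.
move=> ab cf f0 If x xab; have [F dF] := primitive a b cf.
have mono u v : a <= u -> u <= v -> v <= b -> F u <= F v.
  move=> au uv vb; rewrite -subr_ge0.
  have <- : 0 * (v - u) = 0 by rewrite mul0r.
  apply: (@ftc_le f) => // y /andP[y1 y2]; [apply: dF|apply: f0]; lra.
have e : Rintegral mu `[a, b] f = F b - F a by apply: ftc_itv => //; exact: ltW.
rewrite e in If.
have Fc y : a < y < b -> F y - F a = 0.
  move=> /andP[y1 y2]; have h1 := mono a y (lexx _) (ltW y1) (ltW y2).
  have h2 := mono y b (ltW y1) (ltW y2) (lexx _); lra.
have xab' : a <= x <= b by case/andP: xab => ? ?; rewrite !ltW.
have d := isd_sub (dF x xab') (isd_cst (F a) x).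
have /(congr1 (@complex.Re R)) := @cderive_zero _ (fun y => (F y - F a)%:C) a b x _ xab
  (fun y yab => congr1 (fun z : R => z%:C) (Fc y yab)) (cderive_real d).
by rewrite /= subr0.
Qed.

(** The interval is cut at x0 - d, x0 - d/2, x0 + d/2 and x0 + d. The core of length d contributes
    at least K d, the two collars nothing negative, each outer piece at least - 2 M V, and the total
    is zero. *)
Let mass_bound (psi F : R -> R) (M x0 d V K : R) :
  0 < d -> d <= x0 + M -> d <= M - x0 -> 0 <= V -> (forall y, {for y, continuous psi}) ->
  (forall y, - M <= y <= M -> is_derive y 1 F (psi y)) -> F M - F (- M) = 0 ->
  (forall y, - M <= y <= M -> d <= `|y - x0| -> - V <= psi y) ->
  (forall y, `|y - x0| <= d -> 0 <= psi y) ->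
  (forall y, `|y - x0| <= d / 2 -> K <= psi y) -> K * d <= 4 * M * V.
Proof.
move=> dp dd2 dd3 V0 cpsi dF FF out inn core.
have dF' a b : - M <= a -> b <= M -> forall y, a <= y <= b -> is_derive y 1 F (psi y).
  by move=> a1 b1 y /andP[y1 y2]; apply: dF; rewrite (le_trans a1) ?(le_trans y2).
have a1 : - M <= x0 - d by lra.
have a2 : x0 - d <= x0 - d / 2 by lra.
have a3 : x0 - d / 2 <= x0 + d / 2 by lra.
have a4 : x0 + d / 2 <= x0 + d by lra.
have a5 : x0 + d <= M by lra.
have b4 : x0 + d / 2 <= M := le_trans a4 a5.
have b3 : x0 - d / 2 <= M := le_trans a3 b4.
have b2 : x0 - d <= M := le_trans a2 b3.
have c2 : - M <= x0 - d / 2 := le_trans a1 a2.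
have c3 : - M <= x0 + d / 2 := le_trans c2 a3.
have c4 : - M <= x0 + d := le_trans c3 a4.
have s1 := ftc_le (c := - V) a1 cpsi (dF' _ _ (lexx _) b2).
have s2 := ftc_le (c := 0) a2 cpsi (dF' _ _ a1 b3).
have s3 := ftc_le (c := K) a3 cpsi (dF' _ _ c2 b4).
have s4 := ftc_le (c := 0) a4 cpsi (dF' _ _ c3 a5).
have s5 := ftc_le (c := - V) a5 cpsi (dF' _ _ c4 (lexx _)).
have {}s1 : - V * (x0 - d - - M) <= F (x0 - d) - F (- M).
  by apply: s1 => y y1; apply: out; [lra|rewrite ler_normr; lra].
have {}s2 : 0 <= F (x0 - d / 2) - F (x0 - d).
  by rewrite mul0r in s2; apply: s2 => y y1; apply: inn; rewrite ler_norml; lra.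
have {}s3 : K * (x0 + d / 2 - (x0 - d / 2)) <=
    F (x0 + d / 2) - F (x0 - d / 2).
  by apply: s3 => y y1; apply: core; rewrite ler_norml; lra.
have {}s4 : 0 <= F (x0 + d) - F (x0 + d / 2).
  by rewrite mul0r in s4; apply: s4 => y y1; apply: inn; rewrite ler_norml; lra.
have {}s5 : - V * (M - (x0 + d)) <= F M - F (x0 + d).
  by apply: s5 => y y1; apply: out; [lra|rewrite ler_normr; lra].
have t1 : V * (x0 - d - - M) <= V * (2 * M) by apply: ler_wpM2l => //; lra.
have t2 : V * (M - (x0 + d)) <= V * (2 * M) by apply: ler_wpM2l => //; lra.
have e : x0 + d / 2 - (x0 - d / 2) = d by lra.
rewrite e in s3; apply: (le_trans s3); lra.
Qed.

(* Integrates against powers of a polynomial exceeding [1] only near the point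
   where [v] does not vanish. *)
Lemma moments_eq0 (v : R -> C) (M : R) : 0 < M -> (forall x, ccontinuous_at v x) ->
  (forall n : nat, cint mu `[- M, M] (fun y => ((M - y) ^+ n)%:C * v y) = 0) ->
  forall x, - M < x < M -> v x = 0.
Proof.
move=> M0 cv mom x0 /andP[xl xr].
have cpoly (p : {poly R}) (y : R) : {for y, continuous (fun y => p.[M - y])}.
  apply: continuous_comp; last exact: continuous_horner.
  by apply: cvgB; [exact: cvg_cst|exact: cvg_id].
have polym (p : {poly R}) : cint mu `[- M, M] (fun y => (p.[M - y])%:C * v y) = 0.
  have im i : cintegrable mu `[- M, M] (fun y => (p`_i)%:C * (((M - y) ^+ i)%:C * v y)).
    apply: ccontinuous_cintegrable => y _.
    have h := ccontinuousM (ccontinuous_real (cpoly 'X^i y)) (cv y).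
    apply: eq_ccontinuous (ccontinuousM (ccontinuous_cst (p`_i)%:C y) h) => z.
    by rewrite hornerXn.
  transitivity (cint mu `[- M, M] (fun y => \sum_(i < size p) (p`_i)%:C * (((M - y) ^+ i)%:C * v y))).
    apply: eq_cint => y _; rewrite horner_coef rmorph_sum/= mulr_suml.
    by apply: eq_bigr => i _; rewrite rmorphM/= mulrA.
  rewrite cint_sum//; apply: big1 => i _.
  rewrite cintZ// ?mom ?mulr0//.
  apply: ccontinuous_cintegrable => y _.
  have h := ccontinuousM (ccontinuous_real (cpoly 'X^i y)) (cv y).
  by apply: eq_ccontinuous h => z; rewrite hornerXn.
apply/eqP; case: eqP => // vx; exfalso.
have m0 : 0 < sqn (v x0).
  by rewrite lt_neqAle sqn_ge0 andbT eq_sym; apply/eqP => /sqn_eq0.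
set m := sqn (v x0) in m0.
(* Rotation by conj (v x0) makes the real part positive at x0, namely |v x0|^2. *)
pose u y := conjc (v x0) * v y.
have cu y : ccontinuous_at u y := ccontinuousM (ccontinuous_cst (conjc (v x0)) y) (cv y).
pose f y := complex.Re (u y).
have cf y : {for y, continuous f} := (cu y).1.
have fx : f x0 = m by rewrite /f /u mul_conjc.
have [V V0 hV] := ccontinuous_bounded (fun y (_ : - M <= y <= M) => cu y).
have [d0 d00 hd] := (ccontinuous_eps u x0).1 (cu x0) (m / 2) ltac:(by rewrite divr_gt0).
pose d := Num.min (d0 / 2) (Num.min (x0 + M) (M - x0)).
have dp : 0 < d by rewrite !lt_min divr_gt0//=; lra.
have [dd1 dd2 dd3] : [/\ d <= d0 / 2, d <= x0 + M & d <= M - x0].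
  by rewrite /d; split; rewrite !ge_min !lexx ?orbT.
have fm y : `|y - x0| <= d -> m / 2 <= f y.
  move=> yd; have /hd h : `|y - x0| < d0 by lra.
  have := le_trans (Re_norm1 _) h; rewrite cReB -/(f y) -/(f x0) fx ler_norml; lra.
(* With this c, [phi] stays in [0, 1] on the segment at distance at least d from x0, and exceeds 1
   closer to it. *)
pose c : R := ((2 * M) ^+ 2)^-1.
have c0 : 0 < c by rewrite invr_gt0 exprn_gt0// mulr_gt0.
have cM : c * (2 * M) ^+ 2 = 1 by rewrite mulVf// expf_neq0// gt_eqF// mulr_gt0.
pose phi y := 1 + c * (d ^+ 2 - (y - x0) ^+ 2).
(* The peak function as a polynomial in M - y, the variable in which the moments are taken. *)
pose q : {poly R} := 1 + c%:P * ((d ^+ 2)%:P - ('X - (M - x0)%:P) ^+ 2).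
have qE n y : (q ^+ n).[M - y] = phi y ^+ n.
  by rewrite horner_exp /q !hornerE /phi; congr (_ ^+ _); ring.
(* Gain of [phi] over 1 within distance d / 2, since d^2 - (d/2)^2 = 3 d^2 / 4. *)
pose h := c * (d ^+ 2 * 3 / 4).
have h0 : 0 < h by rewrite /h !mulr_gt0// exprn_gt0.
have bound n : d * (m / 2) * (1 + n%:R * h) <= 4 * M * V.
  pose psi y := phi y ^+ n * f y.
  have cpsi y : {for y, continuous psi}.
    have cn : {for y, continuous (fun y => phi y ^+ n)}.
      by apply: eq_continuous_for (cpoly (q ^+ n) y) => z; rewrite qE.
    exact: cvgM cn (cf y).
  have [F dF] := primitive (- M) M cpsi.
  have FF : F M - F (- M) = 0.
    have <- : Rintegral mu `[- M, M] psi = F M - F (- M).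
      by apply: ftc_itv => //; lra.
    have := congr1 (fun z => complex.Re (conjc (v x0) * z)) (polym (q ^+ n)).
    rewrite mulr0 -cintZ//; last first.
      apply: ccontinuous_cintegrable => y _.
      exact: ccontinuousM (ccontinuous_real (cpoly _ y)) (cv y).
    rewrite /= => <-; apply: eq_Rintegral => y _.
    rewrite qE /psi mulrCA -/(u y) cReM /= mul0r subr0//.
  have fV y : - M <= y <= M -> - V <= f y.
    by move=> /hV hy; have := le_trans (Re_norm1 _) hy; rewrite -/(f y) ler_norml => /andP[].
  have out y : - M <= y <= M -> d <= `|y - x0| -> - V <= psi y.
    move=> yM yd; have sq : d ^+ 2 <= (y - x0) ^+ 2.
      by apply: sqr_ge => //; exact: ltW.
    have sq2 : (y - x0) ^+ 2 <= (2 * M) ^+ 2.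
      by apply: sqr_le; rewrite ler_norml; lra.
    have p1 : phi y <= 1 by rewrite /phi gerDl mulr_ge0_le0 ?(ltW c0)// subr_le0.
    have p0 : 0 <= phi y.
      have k1 := ler_wpM2l (ltW c0) sq2; have k2 : 0 <= c * d ^+ 2 by rewrite mulr_ge0 ?sqr_ge0// ltW.
      by rewrite /phi mulrBr; lra.
    have pn0 : 0 <= phi y ^+ n by exact: exprn_ge0.
    have pn1 : phi y ^+ n <= 1 by exact: exprn_ile1.
    have g1 := ler_wpM2l pn0 (fV y yM); have g2 := ler_wpM2r V0 pn1.
    rewrite /psi (le_trans _ g1)// mulrN lerN2 (le_trans g2)// mul1r.
    exact: lexx.
  have inn y : `|y - x0| <= d -> 0 <= psi y.
    move=> yd; have fy := fm y yd; apply: mulr_ge0; last by lra.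
    apply: exprn_ge0; rewrite /phi addr_ge0// mulr_ge0 ?(ltW c0)// subr_ge0.
    exact: sqr_le.
  have core y : `|y - x0| <= d / 2 -> m / 2 * (1 + n%:R * h) <= psi y.
    move=> yd; have fy : m / 2 <= f y by apply: fm; lra.
    have ph : 1 + h <= phi y.
      rewrite /phi /h lerD2l ler_wpM2l ?(ltW c0)//.
      have : (y - x0) ^+ 2 <= (d / 2) ^+ 2.
        exact: sqr_le.
      rewrite exprMn; lra.
    have bern : 1 + n%:R * h <= (1 + h) ^+ n.
      elim: n {psi cpsi F dF FF fV out inn} => [|n ih]; first by rewrite mul0r addr0 expr0.
      rewrite exprS -natr1; have := ler_wpM2l (_ : 0 <= 1 + h) ih => /(_ ltac:(lra)).
      have : 0 <= n%:R * h * h by rewrite !mulr_ge0// ltW.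
      lra.
    have le : (1 + h) ^+ n <= phi y ^+ n by rewrite lerXn2r ?nnegrE//; lra.
    rewrite mulrC /psi; apply: ler_pM => //.
    - by rewrite addr_ge0// mulr_ge0// ltW.
    - by rewrite divr_ge0// ltW.
    - exact: le_trans le.
  rewrite -mulrA (mulrC d).
  exact: (mass_bound dp dd2 dd3 V0 cpsi dF FF out inn core).
(* The left-hand side of [bound] grows linearly in n, against a fixed right-hand side. *)
have w0 : 0 < d * (m / 2) * h by rewrite !mulr_gt0// invr_gt0.
have := bound (Num.trunc (4 * M * V / (d * (m / 2) * h))).+1.
have := truncnS_gt (4 * M * V / (d * (m / 2) * h)); rewrite ltr_pdivrMr//.
have : 0 < d * (m / 2) by rewrite !mulr_gt0// invr_gt0.
move: (_.+1%:R) => N; lra.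
Qed.

End ZeroIntegral.

(** * Uniqueness *)

Section KernelIntegrable.
Variable R : realType.
Local Notation C := R[i].
Local Notation TR := (measurableTypeR R).
Local Notation mu := (@lebesgue_measure R).
Variable k : C.
Variable M : R.
Hypothesis M0 : 0 < M.
Local Notation X := (`[- M, M]%classic : set TR).

Let mX : measurable X. Proof. exact: measurable_itv. Qed.

Lemma cmeasurable_hank_dist x : cmeasurable X (fun y => hank k `|x - y|).
Proof.
have md : measurable_fun [set: TR] (fun y : TR => `|x - y| : TR).
  apply: (measurableT_comp (@normr_measurable _ setT)).
  by apply: measurable_funB => //; exact: measurable_cst.
have [h1 h2] := cmeasurable_comp (cmeasurable_hank k setT) md.
by split; [exact: measurable_funS h1|exact: measurable_funS h2].
Qed.

(** The added constant covers y = x, where [rsqrt] takes the value 0. *)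
Let hank_dist_bound : exists2 A : R, 0 <= A & forall x y, X x -> X y ->
  norm1 (hank k `|x - y|) <= A * rsqrt `|x - y| + norm1 (hank k 0).
Proof.
have L0 : 0 < 2 * M by rewrite mulr_gt0.
have [A A0 hA] := sqrt_holder_bound (sqrt_holder_hank k L0).
exists A => // x y; rewrite /= !in_itv/= => xM yM.
have [->|xy] := eqVneq x y.
  by rewrite subrr normr0 lerDr mulr_ge0// rsqrt_ge0.
apply: (@le_trans _ _ (A * rsqrt `|x - y|)); last by rewrite lerDl norm1_ge0.
by apply: hA; rewrite normr_gt0 subr_eq0 xy/= ler_norml; lra.
Qed.

Let integrable_bound (A B x : R) : X x ->
  mu.-integrable X (fun y => (A * rsqrt `|x - y| + B)%:E).
Proof.
move=> Xx; apply: (integrableD_fin mX).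
  by apply: integrableZ_fin => //; apply: integrable_rsqrt_dist => //; rewrite /= in_itv in Xx.
by apply: continuous_itv_integrable => ? _; exact: cvg_cst.
Qed.

Lemma cintegrable_hank_dist x : X x -> cintegrable mu X (fun y => hank k `|x - y|).
Proof.
move=> Xx; have [A A0 hA] := hank_dist_bound.
apply: (cintegrable_le mX (cmeasurable_hank_dist x) (integrable_bound A (norm1 (hank k 0)) Xx)).
by move=> y Xy; exact: hA.
Qed.

Lemma cintegrable_hank (phi : TR -> C) (b x : R) : cmeasurable X phi ->
  (forall y, X y -> norm1 (phi y) <= b) -> X x ->
  cintegrable mu X (fun y => phi y * hank k `|x - y|).
Proof.
move=> mphi phib Xx.
have -> : (fun y => phi y * hank k `|x - y|) = (fun y => hank k `|x - y| * phi y).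
  by apply/funext => y; rewrite mulrC.
exact: (cintegrableMr mX (cintegrable_hank_dist Xx) mphi phib).
Qed.

End KernelIntegrable.

Section Uniqueness.
Variable R : realType.
Local Notation C := R[i].
Local Notation TR := (measurableTypeR R).
Local Notation mu := (@lebesgue_measure R).
Variable k : C.
Hypothesis k0 : 0 < complex.Re k.
Hypothesis k1 : 0 <= complex.Im k.
Variable M : R.
Hypothesis M0 : 0 < M.
Local Notation X := (`[- M, M]%classic : set TR).
Local Notation Dt := (`[0, pi / 2]%classic : set TR).
Local Notation Ds := (`[0, +oo[%classic : set TR).

(** For s = cos t this is the value at M of the wave with exponent a = - i k cos t, that is, the
    boundary term of the energy identity. *)
Definition fourier (p : R -> C) (s : R) : C :=
  cint mu X (fun y => p y * cexp ('i%C * k * (s * (M - y))%:C)).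

Let lin_cont (s y : R) : ccontinuous_at (fun y => cexp ('i%C * k * (s * (M - y))%:C)) y.
Proof.
apply: cderive_cont; apply: cderive_exp; apply: cderiveZ; exact: cderive_real (isd_mul (isd_cst s y) (isd_sub (isd_cst M y) (isd_id y))).
Qed.

Let fourier_integrable (p : R -> C) s : everywhere_cont p ->
  cintegrable mu X (fun y => p y * cexp ('i%C * k * (s * (M - y))%:C)).
Proof.
move=> cp; apply: ccontinuous_cintegrable => y _.
exact: ccontinuousM (cp y) (lin_cont s y).
Qed.

Lemma fourier_derive (p : R -> C) s : everywhere_cont p ->
  cderive (fourier p) s ('i%C * k * fourier (fun y => (M - y)%:C * p y) s).
Proof.
move=> cp.
have cp' : everywhere_cont (fun y => (M - y)%:C * p y).
  move=> y; apply: ccontinuousM _ (cp y); apply: ccontinuous_real.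
  by apply: cvgB; [exact: cvg_cst|exact: cvg_id].
have [B B0 hB] := ccontinuous_bounded (fun y (_ : - M <= y <= M) => cp' y).
have suv : s - 1 < s < s + 1 by rewrite ltrBlDr !ltrDl ltr01.
pose b := norm1 ('i%C * k) * (B * (2 * expR (complex.Im k * ((`|s| + 1) * (2 * M))))).
have ib : mu.-integrable X (fun=> b%:E).
  by apply: continuous_itv_integrable => ? _; exact: cvg_cst.
rewrite -cintZ//; last exact: fourier_integrable.
apply: (@cderive_under _ _ _ mu X
  (fun s y => p y * cexp ('i%C * k * (s * (M - y))%:C))
  (fun s y => 'i%C * k * ((M - y)%:C * p y * cexp ('i%C * k * (s * (M - y))%:C)))
  s (s - 1) (s + 1) (fun=> b) _ suv _ _ ib).
- exact: measurable_itv.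
- by move=> x _; exact: fourier_integrable.
- move=> x y _ _.
  have d1 := cderive_real (isd_mul (isd_id x) (isd_cst (M - y) x)).
  have d := cderiveZ (p y) (cderive_exp (cderiveZ ('i%C * k) d1)).
  apply: cderive_eq d _; rewrite mul1r mulr0 addr0.
  by move: (p y) ((M - y)%:C : C) (cexp _) => u v e; ring.
- move=> x y xs; rewrite /= in_itv/= => yM.
  rewrite (le_trans (norm1M _ _))// ler_wpM2l ?norm1_ge0//.
  rewrite (le_trans (norm1M _ _))// ler_pM ?norm1_ge0//; first exact: hB.
  rewrite (le_trans (norm1_cexp _))// ler_wpM2l// ler_expR.
  have -> : complex.Re ('i%C * k * (x * (M - y))%:C) = complex.Im k * - (x * (M - y)).
    by rewrite cReM cReM cImM /= !mul0r mulr0 subr0 sub0r mul1r mulNr mulrN.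
  apply: ler_wpM2l => //; rewrite (le_trans (ler_norm _))// normrN normrM.
  have n1 : `|x| <= `|s| + 1.
    rewrite -{1}(subrK s x) addrC (le_trans (ler_normD _ _))// lerD2l ler_norml; lra.
  have n2 : `|M - y| <= 2 * M by rewrite ler_norml; lra.
  by rewrite ler_pM.
Qed.

Variable tau : R -> C.
Hypothesis ctau : everywhere_cont tau.

Let wave_cont (a : C) x y : ccontinuous_at (fun y => tau y * cexp (- (a * `|x - y|%:C))) y.
Proof.
have ce (z : R) : ccontinuous_at (fun r : R => cexp (- (a * r%:C))) z.
  exact: cderive_cont (cderive_exp (cderiveN (cderiveZ a (cderive_real (isd_id z))))).
have ca : {for y, continuous (fun y : R => `|x - y|)}.
  apply: continuous_comp; last exact: norm_continuous.
  by apply: cvgB; [exact: cvg_cst|exact: cvg_id].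
have h := @ccontinuous_comp _ (fun r : R => cexp (- (a * r%:C))) (fun y : R => `|x - y|) y (ce _) ca.
exact: ccontinuousM (ctau y) h.
Qed.

Let quad_wave (a : C) : quad M tau (fun x y : R => cexp (- (a * `|x - y|%:C))) =
  cint mu X (fun x => conjc (tau x) * wave M tau a x).
Proof.
rewrite quadE// => x _; apply: ccontinuous_cintegrable => y _; exact: wave_cont.
Qed.

Let quad_wave_ge (a c : C) : complex.Re (c * conjc a) = 0 -> 0 <= complex.Re (c * a) ->
  0 <= complex.Re c -> complex.Re c * sqn (wave M tau a M) <=
  2 * complex.Re (c * quad M tau (fun x y : R => cexp (- (a * `|x - y|%:C)))).
Proof. by move=> h1 h2 h3; rewrite quad_wave; exact: wave_energy. Qed.

Let tau_bound : exists2 S : R, 0 <= S & forall x, - M <= x <= M -> norm1 (tau x) <= S.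
Proof. by apply: ccontinuous_bounded => y _; exact: ctau. Qed.

Let angl_energy (t : R) : Dt t -> complex.Re k * sqn (fourier tau (cos t)) <=
  2 * complex.Re (k * quad M tau (fun x y : R => angl k (fun=> 1) `|x - y| t)).
Proof.
rewrite /= in_itv/= => /andP[t0 t1].
have ct : 0 <= cos t.
  rewrite cos_ge0_pihalf// t1 andbT.
  by rewrite (le_trans _ t0)// oppr_le0 divr_ge0// pi_ge0.
pose a := - ('i%C * k * (cos t)%:C).
have e (r : R) : cexp (- (a * r%:C)) = angl k (fun=> 1) r t.
  rewrite /angl mul1r /a mulNr opprK; congr cexp; rewrite [in RHS]rmorphM/=.
    by rewrite (mulrC (r%:C : C)) mulrA.
have -> : (fun x y : R => angl k (fun=> 1) `|x - y| t) = (fun x y : R => cexp (- (a * `|x - y|%:C))).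
  by apply/funext => x; apply/funext => y; rewrite e.
have -> : fourier tau (cos t) = wave M tau a M.
  apply: eq_cint => y; rewrite inE/= in_itv/= => /andP[_ yM].
  by rewrite e /angl mul1r ger0_norm ?subr_ge0// (mulrC (cos t)).
apply: quad_wave_ge; rewrite /a; last exact: ltW.
- by case: (k) => kr ki /=; ring.
- case: (k) k0 k1 => kr ki /= kr0 ki0.
  rewrite (_ : _ - _ = 2 * (kr * ki * cos t)); last by ring.
  by rewrite mulr_ge0// mulr_ge0// mulr_ge0// ltW.
Qed.

Let kernel_angl : exists2 A : R, 0 <= A & forall r, 0 < r <= 2 * M ->
  cintegrable mu Dt (angl k (fun=> 1) r) /\
  Rintegral mu Dt (fun t => norm1 (angl k (fun=> 1) r t)) <= A * rsqrt r.
Proof.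
exists (pi * Num.sqrt (2 * M)); first by rewrite mulr_ge0 ?pi_ge0 ?sqrtr_ge0.
by move=> r rM; exact: angl_mass_rsqrt.
Qed.

Let lapl_energy (s : R) : Ds s -> 0 <= complex.Re (- ('i%C * k) *
  quad M tau (fun x y : R => lapl k (fun s => (wgt s)%:C) `|x - y| s)).
Proof.
move=> Dss; have s0 : 0 <= s by move: Dss; rewrite /= in_itv/= andbT.
have [S S0 hS] := tau_bound.
have ok := @quad_ok_slice R M 2 S tau Ds (lapl k (fun s => (wgt s)%:C)) M0
  (measurable_itv _) ctau (ler0n R 2) hS (cmeasurable2_lapl k) (@lapl_le2 _ k k0) s Dss.
(* The energy identity is for the bare exponential; multiplying by sqrt (1 + s^2) > 0 removes the
   weight without changing the sign. *)
pose a := k * s%:C.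
have e : (fun x y : R => cexp (- (a * `|x - y|%:C))) =
    (fun x y : R => (hyp s)%:C * lapl k (fun s => (wgt s)%:C) `|x - y| s).
  have hw : (hyp s)%:C * (wgt s)%:C = 1 :> C by rewrite -rmorphM/= mulrC wgt_hyp.
  apply/funext => x; apply/funext => y; rewrite /lapl [RHS]mulrA hw mul1r; congr cexp.
  by rewrite /a [in RHS]rmorphM/= -mulrA (mulrC (s%:C : C)).
have [_ qe] := quad_okZ (hyp s)%:C ok.
have rc : 0 <= complex.Re (- ('i%C * k)).
  by rewrite cReN cReM /= mul0r mul1r sub0r opprK.
have r1 : complex.Re (- ('i%C * k) * conjc a) = 0.
  by rewrite /a; case: (k) => kr ki /=; ring.
have r2 : 0 <= complex.Re (- ('i%C * k) * a).
  rewrite /a; case: (k) k0 k1 => kr ki /= kr0 ki0.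
  rewrite (_ : _ - _ = 2 * (kr * ki * s)); last by ring.
  by rewrite mulr_ge0// mulr_ge0// mulr_ge0// ltW.
have h := quad_wave_ge r1 r2 rc.
rewrite (etrans (congr1 (quad M tau) e) qe) in h.
have {}h := le_trans (mulr_ge0 rc (sqn_ge0 _)) h.
move: (quad _ _ _) h => Q; rewrite mulrCA cReM /= mul0r subr0 pmulr_rge0// => h.
by move: h; rewrite pmulr_rge0//; exact: hyp_gt0.
Qed.

Let mDt : measurable Dt. Proof. exact: measurable_itv. Qed.
Let mDs : measurable Ds. Proof. exact: measurable_itv. Qed.
Let mX : measurable X. Proof. exact: measurable_itv. Qed.

Let energy_cont t : {for t, continuous (fun t => complex.Re k * sqn (fourier tau (cos t)))}.
Proof.
have cf := ccontinuous_comp (cderive_cont (fourier_derive (cos t) ctau)) (continuous_cos (x := t)).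
have [h _] := ccontinuousM (ccontinuous_cst k t) (ccontinuousM (ccontinuous_conjc cf) cf).
apply: eq_continuous_for h => y.
by rewrite mul_conjc cReM /= mulr0 subr0.
Qed.

(** The Laplace part enters with a nonnegative real part and is dropped; the angular part keeps its
    boundary terms. *)
Let hank_energy : Rintegral mu Dt (fun t => complex.Re k * sqn (fourier tau (cos t))) <=
  2 * complex.Re (k * quad M tau (fun x y : R => hank k `|x - y|)).
Proof.
have [S S0 hS] := tau_bound; have [A A0 hA] := lapl_mass_rsqrt k0 M0.
have [B B0 hB] := kernel_angl.
have [okE iE eE] := @quad_superposition R M B 2 S tau Dt (angl k (fun=> 1)) M0
  (measurable_itv _) ctau B0 (ler0n R 2) S0 hS (cmeasurable2_angl k) (@angl_le2 _ k k1) hB.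
have [okG iG eG] := @quad_superposition R M A 2 S tau Ds (lapl k (fun s => (wgt s)%:C)) M0
  (measurable_itv _) ctau A0 (ler0n R 2) S0 hS (cmeasurable2_lapl k) (@lapl_le2 _ k k0) hA.
have [okG' eG'] := quad_okZ (- 'i%C) okG.
have qh : quad M tau (fun x y : R => hank k `|x - y|) =
    quad M tau (fun x y : R => cint mu Dt (angl k (fun=> 1) `|x - y|)) +
    (- 'i%C) * quad M tau (fun x y : R => cint mu Ds (lapl k (fun s => (wgt s)%:C) `|x - y|)).
  apply: etrans (etrans (quad_okD okE okG') (congr1 _ eG')).
  apply: eq_quad => x y /eqP xy; rewrite mulNr.
  have r0 : 0 < `|x - y| by rewrite normr_gt0 subr_eq0.
  exact: (hank_Hint k0 k1 r0).
have iF : mu.-integrable Dt (fun t => (complex.Re k * sqn (fourier tau (cos t)))%:E).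
  by apply: continuous_itv_integrable.
pose fE t := quad M tau (fun x y : R => angl k (fun=> 1) `|x - y| t).
pose fG s := quad M tau (fun x y : R => lapl k (fun s => (wgt s)%:C) `|x - y| s).
have key : k * quad M tau (fun x y : R => hank k `|x - y|) =
    cint mu Dt (fun t => k * fE t) + cint mu Ds (fun s => - ('i%C * k) * fG s).
  have e1 := cintZ k mDt iE.
  have e2 := cintZ (- ('i%C * k)) mDs iG.
  rewrite (etrans qh (congr2 (fun a b => a + - 'i%C * b) eE eG)).
  apply: esym; apply: etrans (congr2 (fun a b => a + b) e1 e2) _.
  by move: (cint _ _ _) (cint _ _ _) => a b; ring.
have [iE1 _] := cintegrableZ k mDt iE.
have h1 : Rintegral mu Dt (fun t => complex.Re k * sqn (fourier tau (cos t))) <=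
    2 * complex.Re (cint mu Dt (fun t => k * fE t)).
  have i2 := integrableZ_fin 2 mDt iE1.
  have l := le_Rintegral mDt iF i2 (fun t Dtt => @angl_energy t Dtt).
  by apply: (le_trans l); rewrite (@RintegralZl _ _ _ mu _ _ 2 mDt iE1).
have h2 : 0 <= complex.Re (cint mu Ds (fun s => - ('i%C * k) * fG s)).
  exact: (@Rintegral_ge0 _ _ _ mu Ds (fun s => complex.Re (- ('i%C * k) * fG s)) (@lapl_energy)).
rewrite key; move: (cint mu Dt (fun t => k * fE t)) (cint mu Ds _) h1 h2 => I J h1 h2.
by apply: (le_trans h1); rewrite cReD mulrDr lerDl mulr_ge0.
Qed.

(** Pairing the equation with conj(tau) gives Re (k <H tau, tau>) = - Re beta times the integral of
    |tau|^2, which is at most 0, so every boundary term in [hank_energy] vanishes. *)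
Lemma hank_unique (beta : C) : 0 <= complex.Re beta ->
  (forall x, - M <= x <= M -> k * cint mu X (fun y => tau y * hank k `|x - y|) = - (beta * tau x)) ->
  forall x, - M < x < M -> tau x = 0.
Proof.
move=> b0 H; have [S S0 hS] := tau_bound.
have kn : k != 0 by exact: k_neq0.
have mtau : cmeasurable X tau by apply: ccontinuous_cmeasurable.
have hXS y : X y -> norm1 (tau y) <= S by rewrite /= in_itv/=; exact: hS.
have cs x : ccontinuous_at (fun x => conjc (tau x) * tau x) x.
  exact: ccontinuousM (ccontinuous_conjc (ctau x)) (ctau x).
have iss : cintegrable mu X (fun x => conjc (tau x) * tau x).
  by apply: ccontinuous_cintegrable => x _; exact: cs.
have e : k * quad M tau (fun x y : R => hank k `|x - y|) =
    - beta * cint mu X (fun x => conjc (tau x) * tau x).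
  have ik x : - M <= x <= M -> cintegrable mu X (fun y => tau y * hank k `|x - y|).
    move=> xM; have Xx : X x by rewrite /= in_itv.
    have ii := cintegrable_hank k M0 mtau hXS Xx.
    exact: ii.
  rewrite (quadE ik).
  have -> : cint mu X (fun x => conjc (tau x) * cint mu X (fun y => tau y * hank k `|x - y|)) =
      cint mu X (fun x => - (beta / k) * (conjc (tau x) * tau x)).
    apply: eq_cint => x; rewrite inE/= in_itv/= => /H h.
    have -> : cint mu X (fun y => tau y * hank k `|x - y|) = k^-1 * (- (beta * tau x)).
      by rewrite -h mulKf.
    by move: (tau x) => v; move: (conjc v) (k^-1) => u w; ring.
  rewrite (cintZ _ mX iss) mulrA; congr (_ * _).
  by rewrite mulrN mulrCA divff// mulr1.
have q0 : complex.Re (k * quad M tau (fun x y : R => hank k `|x - y|)) <= 0.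
  have eF : cint mu X (fun x => conjc (tau x) * tau x) = (Rintegral mu X (fun x => sqn (tau x)))%:C.
    transitivity (cint mu X (fun x => (sqn (tau x))%:C)).
      by apply: eq_cint => x _; rewrite mul_conjc.
    by apply: complexP => //=; rewrite /Rintegral integral0_eq.
  rewrite e eF cReM /= mulr0 subr0 cReN mulNr oppr_le0 mulr_ge0//.
  by apply: Rintegral_ge0 => x _; exact: sqn_ge0.
have pi2 : 0 < pi / 2 :> R by rewrite divr_gt0// pi_gt0.
have pos t : 0 <= t <= pi / 2 -> 0 <= complex.Re k * sqn (fourier tau (cos t)).
  by move=> _; rewrite mulr_ge0 ?sqn_ge0// ltW.
have E0 : Rintegral mu Dt (fun t => complex.Re k * sqn (fourier tau (cos t))) <= 0.
  by apply: (le_trans hank_energy); rewrite mulr_ge0_le0.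
have Z0 := Rintegral_le0_eq0 pi2 energy_cont pos E0.
(* Differentiating in t multiplies the density by M - y, up to the factor - i k sin t, which is
   nonzero inside the interval. *)
have step n : everywhere_cont (fun y => ((M - y) ^+ n)%:C * tau y) /\
    forall t, 0 < t < pi / 2 -> fourier (fun y => ((M - y) ^+ n)%:C * tau y) (cos t) = 0.
  elim: n => [|n [cn ih]].
    have -> : (fun y : R => ((M - y) ^+ 0)%:C * tau y) = tau.
      by apply/funext => y; rewrite expr0 mul1r.
    split => // t /Z0 /eqP; rewrite mulf_eq0 gt_eqF//= => /eqP.
    exact: sqn_eq0.
  have -> : (fun y : R => ((M - y) ^+ n.+1)%:C * tau y) =
      (fun y => (M - y)%:C * (((M - y) ^+ n)%:C * tau y)).
    by apply/funext => y; rewrite mulrA -rmorphM/= exprS.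
  split.
    move=> y; apply: ccontinuousM _ (cn y); apply: ccontinuous_real.
    by apply: cvgB; [exact: cvg_cst|exact: cvg_id].
  move=> t tt; have d := cderive_comp (fourier_derive (cos t) cn) (is_derive_cos t).
  have /eqP := cderive_zero tt ih d.
  rewrite !mulf_eq0 (negbTE kn) => /or3P[|/orP[]|/eqP//].
  - rewrite eq_complex /= eqxx andbT oppr_eq0 gt_eqF//.
    by case/andP: tt => t0 t1; rewrite sin_gt0_pi// t0/= (lt_trans t1)// ltr_pdivrMr// ltr_pMr ?pi_gt0// ltr1n.
  - by rewrite eq_complex /= oner_eq0 andbF.
  - by [].
(* Any interior angle would do; the moments are read off at this one. *)
have tt : 0 < (pi / 4 : R) < pi / 2.
  by rewrite divr_gt0 ?pi_gt0//= ltr_pM2l ?pi_gt0// ltf_pV2 ?posrE// ltr_nat.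
pose ex (y : R) := cexp ('i%C * k * (cos (pi / 4) * (M - y))%:C).
have cv x : ccontinuous_at (fun y => tau y * ex y) x.
  exact: ccontinuousM (ctau x) (lin_cont _ x).
move=> x xM.
have : tau x * ex x = 0.
  apply: (moments_eq0 M0 cv _ xM) => n; have [_ /(_ _ tt) h] := step n.
  rewrite -[RHS]h; apply: eq_cint => y _; by rewrite mulrA.
move=> /(congr1 (fun z => z * cexp (- ('i%C * k * (cos (pi / 4) * (M - x))%:C)))).
by rewrite mul0r -mulrA -cexpD subrr cexp0 mulr1.
Qed.

End Uniqueness.

(** * Fredholm alternative by sampling *)

Section GeometricLimit.
Variable R : realType.
Local Notation C := R[i].

Lemma half_pow_small (c e : R) : 0 <= c -> 0 < e -> exists m : nat, c * 2^-1 ^+ m <= e.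
Proof.
move=> c0 e0; exists (Num.trunc (c / e)).+1; set m := (Num.trunc _).+1.
have h1 : c / e < m%:R by exact: truncnS_gt.
have h2 : m%:R <= 2 ^+ m :> R by rewrite -natrX ler_nat ltnW// ltn_expl.
rewrite exprVn ler_pdivrMr ?exprn_gt0// mulrC -ler_pdivrMr// ltW//.
exact: lt_le_trans h2.
Qed.

(** Adding c / 2^n to u n gives a nonincreasing sequence bounded below, so convergence follows from
    monotonicity and the error bound from the telescoped tails. *)
Lemma geometric_limit (u : nat -> R) (c : R) :
  (forall n, `|u n.+1 - u n| <= c * 2^-1 ^+ n.+1) ->
  u n @[n --> \oo] --> limn u /\ forall m, `|limn u - u m| <= c * 2^-1 ^+ m.
Proof.
move=> hu.
have up n : `|u n.+1 - u n| <= c * 2^-1 ^+ n - c * 2^-1 ^+ n.+1.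
  rewrite (le_trans (hu n))// exprS; lra.
have tail m p : `|u (m + p)%N - u m| <= c * 2^-1 ^+ m - c * 2^-1 ^+ (m + p).
  elim: p => [|p ih]; first by rewrite addn0 !subrr normr0.
  rewrite addnS -(subrK (u (m + p)%N) (u (m + p).+1)) -addrA.
  rewrite (le_trans (ler_normD _ _))//; have := up (m + p)%N; lra.
have c0 : 0 <= c.
  by have := le_trans (normr_ge0 _) (hu 0%N); rewrite expr1 pmulr_lge0// invr_gt0.
have pow0 n : 0 <= c * 2^-1 ^+ n by rewrite mulr_ge0// exprn_ge0// invr_ge0.
have tail' m n : (m <= n)%N -> `|u n - u m| <= c * 2^-1 ^+ m.
  move=> mn; have := tail m (n - m)%N; rewrite subnKC// => h.
  by have := pow0 n; lra.
pose v n := u n + c * 2^-1 ^+ n.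
have vdec : nonincreasing_seq v.
  apply/nonincreasing_seqP => n; have := ler_norm (u n.+1 - u n).
  by have := up n; rewrite /v; lra.
have vlb : has_lbound (range v).
  exists (u 0%N - c) => _ [n _ <-]; have := tail' 0%N n (leq0n n).
  by have := pow0 n; rewrite expr0 mulr1 ler_norml /v; lra.
have cv : cvgn v by exact: nonincreasing_is_cvgn.
have cp : (fun n => c * 2^-1 ^+ n) @ \oo --> c * 0.
  by apply: cvgM; [exact: cvg_cst|apply: cvg_expr; rewrite ger0_norm ?invr_ge0// invf_lt1// ltr1n].
have cu : cvgn u.
  have -> : u = (fun n => v n - c * 2^-1 ^+ n) by apply/funext => n; rewrite /v addrK.
  by apply: is_cvgB => //; apply/cvg_ex; exists (c * 0).
split => // m; rewrite ler_norml; apply/andP; split.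
- rewrite lerBrDl; apply: limr_ge => //; exists m => // n /= mn.
  by have := tail' m n mn; rewrite ler_norml; lra.
- rewrite lerBlDl; apply: limr_le => //; exists m => // n /= mn.
  by have := tail' m n mn; rewrite ler_norml; lra.
Qed.

End GeometricLimit.

Section Fredholm.
Variable R : realType.
Local Notation C := R[i].
Local Notation TR := (measurableTypeR R).
Variable M : R.
Hypothesis M0 : 0 < M.
Local Notation X := (`[- M, M]%classic : set TR).

Definition sup_norm_le (phi : R -> C) (G : R) := forall x : R, - M <= x <= M -> norm1 (phi x) <= G.
(** Bounded measurable functions rather than continuous ones, because sampling involves indicators
    of cells; measurability and bounds also survive the limit of the Neumann series. *)
Definition admissible (phi : R -> C) := cmeasurable X phi /\ exists G, sup_norm_le phi G.

Definition linear_on_adm (T : (R -> C) -> R -> C) := forall (c : C) (phi psi : R -> C),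
  admissible phi -> admissible psi -> forall x : R, - M <= x <= M ->
  T (fun y => phi y + c * psi y) x = T phi x + c * T psi x.

Lemma admissibleD (c : C) phi psi : admissible phi -> admissible psi ->
  admissible (fun y => phi y + c * psi y).
Proof.
move=> [m1 [G1 b1]] [m2 [G2 b2]]; split.
  by apply: cmeasurableD => //; apply: cmeasurableM => //; exact: cmeasurable_cst.
exists (G1 + norm1 c * G2) => x xM; rewrite (le_trans (norm1D _ _))//.
by rewrite lerD ?b1// (le_trans (norm1M _ _))// ler_wpM2l ?norm1_ge0// b2.
Qed.

Lemma admissible_sum (I : Type) (s : seq I) (c : I -> C) (psi0 : R -> C) (psi : I -> R -> C) :
  admissible psi0 -> (forall i, admissible (psi i)) ->
  admissible (fun y => psi0 y + \sum_(i <- s) c i * psi i y).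
Proof.
move=> h0 hi; elim: s => [|i s ih].
  by have -> : (fun y => psi0 y + \sum_(i <- [::]) c i * psi i y) = psi0;
    [apply/funext => y; rewrite big_nil addr0|].
have -> : (fun y => psi0 y + \sum_(j <- i :: s) c j * psi j y) =
    (fun y => (psi0 y + \sum_(j <- s) c j * psi j y) + c i * psi i y).
  by apply/funext => y; rewrite big_cons addrAC addrA.
exact: admissibleD.
Qed.

Lemma linear_on_adm_sum T (I : Type) (s : seq I) (c : I -> C) (psi0 : R -> C) (psi : I -> R -> C) :
  linear_on_adm T -> admissible psi0 -> (forall i, admissible (psi i)) ->
  forall x : R, - M <= x <= M ->
  T (fun y => psi0 y + \sum_(i <- s) c i * psi i y) x = T psi0 x + \sum_(i <- s) c i * T (psi i) x.
Proof.
move=> lT h0 hi x xM; elim: s => [|i s ih].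
  rewrite big_nil addr0; congr (T _ x).
  by apply/funext => y; rewrite big_nil addr0.
have -> : (fun y => psi0 y + \sum_(j <- i :: s) c j * psi j y) =
    (fun y => (psi0 y + \sum_(j <- s) c j * psi j y) + c i * psi i y).
  by apply/funext => y; rewrite big_cons addrAC addrA.
rewrite lT//; first by rewrite ih big_cons addrAC addrA.
exact: admissible_sum.
Qed.

(** * The Neumann series of a contraction *)

Section Neumann.
Variable B : (R -> C) -> R -> C.
Hypothesis linB : linear_on_adm B.
Hypothesis admB : forall phi, admissible phi -> admissible (B phi).
Hypothesis contrB : forall phi G, admissible phi -> sup_norm_le phi G -> sup_norm_le (B phi) (G / 2).

Lemma neumann g : admissible g ->
  exists2 phi, admissible phi & forall x, - M <= x <= M -> phi x = g x + B phi x.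
Proof.
move=> ag; have [mg [G bg]] := ag.
(* Partial sums of the series. The factor 1 gives them the shape phi + c psi for which admissibility
   and linearity are stated. *)
pose f n := iter n (fun phi => fun y => g y + 1 * B phi y) g.
have fS n : f n.+1 = (fun y => g y + 1 * B (f n) y) by [].
have af n : admissible (f n).
  by elim: n => [|n ih] //; rewrite fS; apply: admissibleD => //; exact: admB.
have Bdiff phi psi x : admissible phi -> admissible psi -> - M <= x <= M ->
    B phi x - B psi x = B (fun y => phi y + -1 * psi y) x.
  by move=> a1 a2 xM; rewrite linB// mulN1r.
have step n : sup_norm_le (fun y => f n.+1 y + -1 * f n y) (G * 2^-1 ^+ n.+1).
  elim: n => [|n ih] x xM.
    rewrite fS mulN1r mul1r addrAC subrr add0r expr1.
    exact: contrB.
  rewrite [f n.+2]fS [f n.+1 in X in _ + X]fS.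
  have -> : g x + 1 * B (f n.+1) x + -1 * (g x + 1 * B (f n) x) = B (f n.+1) x - B (f n) x by ring.
  rewrite Bdiff// exprSr mulrA; apply: contrB => //.
  exact: admissibleD.
have hu x n : - M <= x <= M -> norm1 (f n.+1 x - f n x) <= G * 2^-1 ^+ n.+1.
  by move=> xM; have := step n x xM; rewrite mulN1r.
have hRe x : - M <= x <= M -> complex.Re (f n x) @[n --> \oo] --> limn (fun n => complex.Re (f n x)) /\
    forall m, `|limn (fun n => complex.Re (f n x)) - complex.Re (f m x)| <= G * 2^-1 ^+ m.
  by move=> xM; apply: geometric_limit => n; rewrite -cReB (le_trans (Re_norm1 _))// hu.
have hIm x : - M <= x <= M -> complex.Im (f n x) @[n --> \oo] --> limn (fun n => complex.Im (f n x)) /\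
    forall m, `|limn (fun n => complex.Im (f n x)) - complex.Im (f m x)| <= G * 2^-1 ^+ m.
  by move=> xM; apply: geometric_limit => n; rewrite -cImB (le_trans (Im_norm1 _))// hu.
pose phi x : C := limn (fun n => complex.Re (f n x)) +i* limn (fun n => complex.Im (f n x)).
have close m x : - M <= x <= M -> norm1 (phi x - f m x) <= 2 * G * 2^-1 ^+ m.
  move=> xM; rewrite /norm1 cReB cImB /=.
  by have [_ /(_ m) h1] := hRe x xM; have [_ /(_ m) h2] := hIm x xM; lra.
have aphi : admissible phi.
  split.
  - split; rewrite /phi /=.
    + apply: (@measurable_fun_cvg _ _ _ _ (fun n x => complex.Re (f n x))).
        by move=> n; have [[]] := af n.
      by move=> x; rewrite /= in_itv/= => /hRe[].
    + apply: (@measurable_fun_cvg _ _ _ _ (fun n x => complex.Im (f n x))).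
        by move=> n; have [[]] := af n.
      by move=> x; rewrite /= in_itv/= => /hIm[].
  - exists (2 * G + G) => x xM; have := close 0%N x xM; rewrite expr0 mulr1 => h.
    rewrite -(subrK (f 0%N x) (phi x)) (le_trans (norm1D _ _))// lerD//.
    exact: bg.
exists phi => // x xM; apply/eqP; rewrite -subr_eq0; apply/eqP.
apply: norm1_le_eps => e e0.
have G0 : 0 <= G by exact: le_trans (norm1_ge0 _) (bg x xM).
have [m hm] := half_pow_small (mulr_ge0 (ler0n R 2) G0) e0.
have c2 : sup_norm_le (fun y => f m y + -1 * phi y) (2 * G * 2^-1 ^+ m).
  by move=> y yM; rewrite mulN1r norm1C close.
have afm : admissible (fun y => f m y + -1 * phi y) by exact: admissibleD.
(* The defect is the distance to iterate m + 1 plus the image under B of the distance to iterate m,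
   both geometrically small. *)
have -> : phi x - (g x + B phi x) = (phi x - f m.+1 x) + (B (f m) x - B phi x).
  by rewrite fS mul1r; ring.
rewrite (le_trans (norm1D _ _))// Bdiff//.
have := contrB afm c2 xM; have := close m.+1 x xM; rewrite exprS.
move: hm; lra.
Qed.

End Neumann.

(** * Finite-rank sampling and reduction to a matrix *)

Section Sampling.
Variable L : (R -> C) -> R -> C.
Hypothesis linL : linear_on_adm L.
Hypothesis measL : forall phi, admissible phi -> cmeasurable X (L phi).
Variable Lam : R.
Hypothesis Lam0 : 0 <= Lam.
Hypothesis boundL : forall phi G, admissible phi -> sup_norm_le phi G -> sup_norm_le (L phi) (Lam * G).
Hypothesis holderL : forall phi G, admissible phi -> sup_norm_le phi G ->
  forall x y, - M <= x <= M -> - M <= y <= M ->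
  norm1 (L phi x - L phi y) <= Lam * G * Num.sqrt `|x - y|.
Hypothesis injL : forall phi, admissible phi ->
  (forall x, - M <= x <= M -> phi x = L phi x) -> forall x, - M <= x <= M -> phi x = 0.

(** The Hoelder exponent 1/2 asks for N + 1 above (2 Lam)^2 (2 M). *)
Let mesh_exists : exists N : nat, Lam * Num.sqrt (2 * M / N.+1%:R) <= 2^-1.
Proof.
pose c := (2 * Lam) ^+ 2 * (2 * M).
have c0 : 0 <= c by rewrite mulr_ge0 ?sqr_ge0// mulr_ge0// ltW.
exists (Num.trunc c); set N := (Num.trunc _).+1.
have Np : 0 < N%:R :> R by rewrite ltr0n.
have cN : c <= N%:R by rewrite ltW// truncnS_gt.
have d0 : 0 <= 2 * M / N%:R by rewrite divr_ge0// mulr_ge0// ltW.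
have h : (2 * Lam) ^+ 2 * (2 * M / N%:R) <= 1 by rewrite mulrA ler_pdivrMr// mul1r.
have : Num.sqrt ((2 * Lam) ^+ 2 * (2 * M / N%:R)) <= 1 by rewrite -[leRHS]sqrtr1 ler_wsqrtr.
by rewrite sqrtrM ?sqr_ge0// sqrtr_sqr ger0_norm ?mulr_ge0//; lra.
Qed.

Section Mesh.
Variable N : nat.
Hypothesis meshN : Lam * Num.sqrt (2 * M / N.+1%:R) <= 2^-1.

Let eps : R := 2 * M / N.+1%:R.
Let eps0 : 0 < eps. Proof. by rewrite divr_gt0// mulr_gt0. Qed.
(** The cells of the first N + 1 nodes are half-open and miss M; the last node is M itself, and its
    cell is there for that point. *)
Let node (j : 'I_N.+2) : R := - M + j%:R * eps.
Let cell (j : 'I_N.+2) : set TR := `[node j, (node j + eps)[%classic.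
Let e (j : 'I_N.+2) : R -> C := ind (cell j).

Let node_in j : - M <= node j <= M.
Proof.
have h : j%:R * eps <= N.+1%:R * eps.
  by rewrite ler_wpM2r ?(ltW eps0)// ler_nat -ltnS.
have h2 : N.+1%:R * eps = 2 * M by rewrite /eps mulrCA divff ?mulr1 ?pnatr_eq0.
have p : 0 <= j%:R * eps by rewrite mulr_ge0 ?(ltW eps0).
by rewrite /node; apply/andP; split; lra.
Qed.

Let cell_exists x : - M <= x <= M -> exists j, cell j x.
Proof.
move=> /andP[x1 x2]; have q0 : 0 <= (x + M) / eps by rewrite divr_ge0 ?(ltW eps0)//; lra.
have /andP[t1 t2] := truncn_itv q0.
have lt : (Num.trunc ((x + M) / eps) < N.+2)%N.
  rewrite -(ltr_nat R) (le_lt_trans t1)// ltr_pdivrMr//.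
  have : N.+1%:R * eps = 2 * M by rewrite /eps mulrCA divff ?mulr1 ?pnatr_eq0.
  by move=> h; rewrite -[N.+2%:R]natr1 mulrDl mul1r h; have := eps0; lra.
exists (Ordinal lt); rewrite /cell /node /= in_itv/=.
rewrite ler_pdivlMr// in t1; rewrite ltr_pdivrMr// -[(_.+1)%:R]natr1 mulrDl mul1r in t2.
lra.
Qed.

Let cell_uniq i j x : cell i x -> cell j x -> i = j.
Proof.
rewrite /cell /node /= !in_itv/= => /andP[i1 i2] /andP[j1 j2].
have aux (a b : nat) : - M + a%:R * eps <= x -> x < - M + b%:R * eps + eps -> (a <= b)%N.
  move=> h1 h2; rewrite -ltnS -(ltr_nat R) -(ltr_pM2r eps0) -[b.+1%:R]natr1 mulrDl mul1r; lra.
by apply/val_inj/eqP; rewrite eqn_leq !aux.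
Qed.

Let sum_e (c : 'I_N.+2 -> C) j x : cell j x -> \sum_i c i * e i x = c j.
Proof.
move=> cj; rewrite (bigD1 j)//= big1 => [|i ij]; first by rewrite /e indT// mulr1 addr0.
rewrite /e indF ?mulr0// => ci; move/eqP: ij; apply; exact: cell_uniq cj.
Qed.

Let adm_e j : admissible (e j).
Proof.
split.
  have [h1 h2] := cmeasurable_ind (measurable_itv `[node j, (node j + eps)[ : measurable (cell j)).
  by split; [exact: measurable_funS h1|exact: measurable_funS h2].
exists 1 => x _; rewrite /e; have [h|h] := pselect (cell j x).
  by rewrite indT// (norm1_real 1) normr1.
by rewrite indF// norm1_0.
Qed.

Let zero_adm : admissible (fun=> 0).
Proof. by split; [exact: cmeasurable_cst|exists 0 => x _; rewrite norm1_0]. Qed.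

Let adm_L phi : admissible phi -> admissible (L phi).
Proof.
move=> ap; split; first exact: measL.
by have [_ [G bG]] := ap; exists (Lam * G); exact: boundL.
Qed.

(* [L] minus its piecewise constant sampling, which has finite rank. *)
Let B (phi : R -> C) (x : R) : C := L phi x + -1 * \sum_j L phi (node j) * e j x.

Let adm_B phi : admissible phi -> admissible (B phi).
Proof.
move=> ap; apply: admissibleD; first exact: adm_L.
have := admissible_sum (index_enum 'I_N.+2) (fun j => L phi (node j)) zero_adm adm_e.
by congr admissible; apply/funext => y; rewrite add0r.
Qed.

Let lin_B : linear_on_adm B.
Proof.
move=> c phi psi a1 a2 x xM; rewrite /B linL//.
have -> : \sum_j L (fun y => phi y + c * psi y) (node j) * e j x =
    \sum_j L phi (node j) * e j x + c * \sum_j L psi (node j) * e j x.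
  rewrite mulr_sumr -big_split/=; apply: eq_bigr => j _.
  by rewrite linL ?node_in// mulrDl mulrA.
by move: (\sum_j _) (\sum_j _) => s t; ring.
Qed.

(** On the cell of node j the operator is the difference L phi x - L phi (node j), small by the
    Hoelder bound and the mesh width. *)
Let contr_B phi G : admissible phi -> sup_norm_le phi G -> sup_norm_le (B phi) (G / 2).
Proof.
move=> ap bp x xM; have G0 : 0 <= G by exact: le_trans (norm1_ge0 _) (bp x xM).
have [j cj] := cell_exists xM; rewrite /B (sum_e _ cj) mulN1r.
rewrite (le_trans (holderL ap bp xM (node_in j)))//.
have d : `|x - node j| <= eps.
  by move: cj; rewrite /cell /= in_itv/= ler_norml; have := eps0; lra.
have s : Num.sqrt `|x - node j| <= Num.sqrt eps by exact: ler_wsqrtr.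
rewrite mulrAC [G / 2]mulrC ler_wpM2r//.
by rewrite (le_trans _ meshN)// ler_wpM2l.
Qed.

(** Inverting I - B by Neumann series on g and on each indicator gives psi0 and psi_j. A solution
    psi0 + sum c_j psi_j then only requires c_j to be the sample of its image under L at node j, a
    square system c = b + c A; injectivity of I - L makes I - A injective, hence invertible. *)
Lemma fredholm_mesh g : admissible g ->
  exists2 phi, admissible phi & forall x, - M <= x <= M -> phi x = L phi x + g x.
Proof.
move=> ag; have [psi0 a0 h0] := neumann lin_B adm_B contr_B ag.
have /boolp.choice[psi hpsi] : forall j, exists phi, admissible phi /\
    forall x, - M <= x <= M -> phi x = e j x + B phi x.
  by move=> j; have [phi a h] := neumann lin_B adm_B contr_B (adm_e j); exists phi.
have apsi j : admissible (psi j) by have [] := hpsi j.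
pose comb (p0 : R -> C) (c : 'rV[C]_N.+2) y := p0 y + \sum_j c 0 j * psi j y.
have acomb p0 c : admissible p0 -> admissible (comb p0 c) by move=> h; exact: admissible_sum.
pose A : 'M[C]_N.+2 := \matrix_(i, j) L (psi i) (node j).
have Lcomb p0 c j : admissible p0 -> L (comb p0 c) (node j) = L p0 (node j) + (c *m A) 0 j.
  move=> ap; rewrite linear_on_adm_sum ?node_in// mxE; congr (_ + _).
  by apply: eq_bigr => i _; rewrite mxE.
(* Coefficients that coincide with the samples of the combination make it a solution; stated for a
   general p0, to serve the homogeneous and the inhomogeneous system. *)
have solve (p0 g0 : R -> C) (c : 'rV[C]_N.+2) : admissible p0 -> (forall x, - M <= x <= M -> p0 x = g0 x + B p0 x) ->
    (forall j, c 0 j = L (comb p0 c) (node j)) ->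
    forall x, - M <= x <= M -> comb p0 c x = L (comb p0 c) x + g0 x.
  move=> ap hp hc x xM.
  have e1 : B (comb p0 c) x = B p0 x + \sum_j c 0 j * B (psi j) x.
    exact: (linear_on_adm_sum (index_enum _) (fun j => c 0 j) lin_B ap apsi).
  have e2 : comb p0 c x = g0 x + \sum_j c 0 j * e j x + B (comb p0 c) x.
    rewrite e1 /comb hp// addrACA -big_split/=; congr (_ + _ + _).
    by apply: eq_bigr => j _; have [_ ->] := hpsi j; rewrite // mulrDr.
  rewrite e2 /B.
  have -> : \sum_j L (comb p0 c) (node j) * e j x = \sum_j c 0 j * e j x.
    by apply: eq_bigr => j _; rewrite hc.
  by move: (\sum_j _) => s; ring.
(* A null row gives a solution of phi = L phi, which vanishes by injectivity; the coefficients are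
   its samples, so they vanish too. *)
have unitT : (1%:M - A) \in unitmx.
  rewrite -row_free_unit; apply: inj_row_free => c; rewrite mulmxBr mulmx1 => /eqP.
  rewrite subr_eq0 => /eqP cA.
  have L0 x : - M <= x <= M -> L (fun=> 0) x = 0.
    move=> xM; apply: norm1_eq0; apply/eqP; rewrite eq_le norm1_ge0 andbT.
    by rewrite (le_trans (boundL (G := 0) zero_adm _ xM))// ?mulr0// => y _; rewrite norm1_0.
  have B0 x : - M <= x <= M -> B (fun=> 0) x = 0.
    move=> xM; rewrite /B L0// big1 ?mulr0 ?addr0// => j _.
    by rewrite L0 ?node_in// mul0r.
  have hc j : c 0 j = L (comb (fun=> 0) c) (node j).
    by rewrite Lcomb// L0 ?node_in// add0r -cA.
  have z := @solve (fun=> 0) (fun=> 0) c zero_adm.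
  have {}z : forall x, - M <= x <= M -> comb (fun=> 0) c x = 0.
    apply: injL; first exact: acomb.
    by move=> x xM; rewrite {1}z ?addr0// => y yM; rewrite B0// addr0.
  apply/rowP => j; rewrite hc mxE; apply: norm1_eq0; apply/eqP.
  rewrite eq_le norm1_ge0 andbT.
  have := boundL (G := 0) (acomb _ c zero_adm) _ (node_in j).
  by rewrite mulr0; apply => y yM; rewrite z// norm1_0.
pose b : 'rV[C]_N.+2 := \row_j L psi0 (node j).
pose c := b *m invmx (1%:M - A).
have cE : c = b + c *m A.
  have : c *m (1%:M - A) = b by rewrite /c mulmxKV.
  by rewrite mulmxBr mulmx1 => <-; rewrite subrK.
exists (comb psi0 c); first exact: acomb.
apply: solve => // j.
by rewrite Lcomb// {1}cE !mxE.
Qed.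

End Mesh.

Theorem fredholm g : admissible g ->
  exists2 phi, admissible phi & forall x, - M <= x <= M -> phi x = L phi x + g x.
Proof. by have [N hN] := mesh_exists; exact: (fredholm_mesh hN). Qed.

End Sampling.

End Fredholm.

(** * Boundary values and continuity *)

Section Clamp.
Variables (R : realType) (M : R).
Hypothesis M0 : 0 < M.

(** The 1-Lipschitz retraction onto the segment; composing with it turns continuity within [- M, M]
    into continuity on the whole line. *)
Definition clamp (x : R) : R := Num.max (- M) (Num.min x M).

Lemma clamp_in x : - M <= clamp x <= M.
Proof.
by rewrite /clamp le_max lexx/= ge_max ge_min lexx orbT andbT ge0_cp// ltW.
Qed.

Lemma clampE x : - M <= x <= M -> clamp x = x.
Proof. by move=> /andP[x1 x2]; rewrite /clamp min_l// max_r. Qed.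

Lemma clamp_contract x y : `|clamp x - clamp y| <= `|x - y|.
Proof.
have h : - M <= M by rewrite ge0_cp// ltW.
have cl z : [\/ z <= - M /\ clamp z = - M, M <= z /\ clamp z = M |
    - M <= z <= M /\ clamp z = z].
  have [a|a] := leP z (- M).
    by apply: Or31; split => //; rewrite /clamp min_l ?(le_trans a)// max_l.
  have [c|c] := leP M z; first by apply: Or32; split => //; rewrite /clamp min_r// max_r.
  by apply: Or33; rewrite clampE ?(ltW a) ?(ltW c).
have n1 := ler_norm (x - y); have n2 := ler_norm (y - x); rewrite distrC in n2.
by have [[a1 ->]|[a1 ->]|[a1 ->]] := cl x; have [[a2 ->]|[a2 ->]|[a2 ->]] := cl y;
  rewrite ler_norml; apply/andP; split; lra.
Qed.

End Clamp.

(** * Extension of Hoelder data to the endpoints *)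

Section HolderExtension.
Variable R : realType.
Local Notation C := R[i].
Variables (M b : R).
Hypothesis M0 : 0 < M.
Hypothesis b0 : 0 < b.

Let pow0 : (0 : R) `^ b = 0. Proof. by rewrite powR0// gt_eqF. Qed.

Let pow_le (s t : R) : 0 <= s -> s <= t -> s `^ b <= t `^ b.
Proof. by move=> s0 st; rewrite ge0_ler_powR ?nnegrE ?(ltW b0)// (le_trans s0). Qed.

(* The limit at the right end is the supremum of the lower barriers. *)
Let right_limit (u : R -> R) (L : R) : 0 <= L ->
  (forall x y, - M < x < M -> - M < y < M -> `|u x - u y| <= L * `|x - y| `^ b) ->
  exists l, forall x, - M < x < M -> `|l - u x| <= L * (M - x) `^ b.
Proof.
move=> L0 hu.
pose S := [set z | exists2 x, - M < x < M & z = u x - L * (M - x) `^ b].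
have ub x : - M < x < M -> forall z, S z -> z <= u x + L * (M - x) `^ b.
  move=> xM z [y yM ->]; have := hu _ _ yM xM; rewrite ler_norml => /andP[_ h].
  have [yx|xy] := leP y x.
  - have p := ler_wpM2l L0 (pow_le (normr_ge0 (y - x)) (_ : `|y - x| <= M - y)).
    have {}p : L * `|y - x| `^ b <= L * (M - y) `^ b.
      by apply: p; rewrite ler_norml; lra.
    have := mulr_ge0 L0 (powR_ge0 (M - x) b); lra.
  - have p : L * `|y - x| `^ b <= L * (M - x) `^ b.
      by rewrite ler_wpM2l// pow_le// ler_norml; lra.
    have := mulr_ge0 L0 (powR_ge0 (M - y) b); lra.
have z0 : - M < 0 < M by rewrite oppr_lt0 M0.
have ne : S !=set0 by exists (u 0 - L * (M - 0) `^ b), 0.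
have hs : has_sup S by split => //; exists (u 0 + L * (M - 0) `^ b) => z; exact: ub.
exists (sup S) => x xM; rewrite ler_norml; apply/andP; split.
- have := ub_le_sup hs.2 (_ : S (u x - L * (M - x) `^ b)) => h.
  by have := h (ex_intro2 _ _ x xM erefl); lra.
- by have := ge_sup ne (ub x xM); lra.
Qed.

Let real_extension (u : R -> R) (L : R) : 0 <= L ->
  (forall x y, - M < x < M -> - M < y < M -> `|u x - u y| <= L * `|x - y| `^ b) ->
  exists2 U : R -> R, (forall x, {for x, continuous U}) &
    forall x, - M < x < M -> U x = u x.
Proof.
move=> L0 hu; have [r hr] := right_limit L0 hu.
(* The left endpoint is the right one of the reflected function. *)
have [l hl] : exists l, forall x, - M < x < M -> `|l - u x| <= L * (x + M) `^ b.
  have [|l hl] := @right_limit (fun x => u (- x)) L L0.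
    move=> x y xM yM; rewrite (le_trans (hu _ _ _ _)); [|lra|lra|] => //.
    by rewrite -opprD normrN.
  exists l => x xM; have := hl (- x); rewrite opprK (addrC M); apply; lra.
pose v x := if M <= x then r else if x <= - M then l else u x.
have vo x : - M < x < M -> v x = u x.
  by move=> /andP[x1 x2]; rewrite /v leNgt x2/= leNgt x1.
have vr : v M = r by rewrite /v lexx.
have vl : v (- M) = l by rewrite /v lexx ifF//; apply/negbTE; rewrite -ltNge gtrN.
have d2 (x y z : R) : `|x - y| <= `|z - x| + `|z - y|.
  by rewrite (distrC z x) ler_distD.
have hv x y : - M <= x <= M -> - M <= y <= M -> x <= y -> `|v x - v y| <= 2 * L * `|x - y| `^ b.
  move=> /andP[x1 x2] /andP[y1 y2] xy.
  have p0 s : 0 <= L * s `^ b by rewrite mulr_ge0// powR_ge0.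
  have [->|yx] := eqVneq x y; first by rewrite subrr normr0 -mulrA mulr_ge0.
  have {xy yx} xy : x < y by rewrite lt_neqAle yx.
  move: y2; rewrite le_eqVlt => /predU1P[ey|y2]; move: x1; rewrite le_eqVlt => /predU1P[ex|x1].
  (* Between the two endpoints the comparison passes through 0; each half costs at most L M^b,
     whence the factor 2. *)
  - rewrite ey -ex vr vl; have z0 : - M < 0 < M by rewrite oppr_lt0 M0.
    rewrite (le_trans (d2 _ _ (u 0)))//; have := hr 0 z0; have := hl 0 z0.
    have p : L * M `^ b <= L * `|- M - M| `^ b.
      by rewrite ler_wpM2l// pow_le ?ltW// ler0_norm; lra.
    rewrite subr0 add0r (distrC (u 0)) (distrC (u 0)) -mulrA; lra.
  - rewrite ey vr vo ?x1 -?ey// distrC; have := hr x; rewrite x1 -{1}ey xy => /(_ isT) h.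
    by rewrite (le_trans h)// distrC ger0_norm ?ey ?subr_ge0//; have := p0 (M - x); rewrite -mulrA; lra.
  - rewrite -ex vl vo; last by rewrite ex xy.
    have := hl y; rewrite ex xy y2 => /(_ isT) h.
    have -> : `|x - y| = y + M by rewrite ltr0_norm; lra.
    by have := p0 (y + M); rewrite -mulrA; lra.
  - rewrite !vo ?x1 ?y2 ?andbT//; [|exact: lt_trans xy|exact: lt_trans xy _].
    have := hu x y; rewrite x1 y2 (lt_trans x1 xy) (lt_trans xy y2) => /(_ isT isT) h.
    by rewrite (le_trans h)// -mulrA; have := p0 `|x - y|; lra.
have hv' x y : `|v (clamp M x) - v (clamp M y)| <= 2 * L * `|x - y| `^ b.
  have [L20 cx cy] := And3 (mulr_ge0 (ler0n R 2) L0) (clamp_in M0 x) (clamp_in M0 y).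
  apply: (@le_trans _ _ (2 * L * `|clamp M x - clamp M y| `^ b)).
    have [h|/ltW h] := leP (clamp M x) (clamp M y); first exact: hv.
    by rewrite distrC (distrC (clamp M x)); exact: hv.
  by rewrite ler_wpM2l// pow_le// clamp_contract.
exists (fun x => v (clamp M x)).
  move=> x; apply/cvgrPdist_le => e e0.
  pose c := 2 * L + 1; have c0 : 0 < c by rewrite ltr_wpDl// mulr_ge0.
  have d0 : 0 < (e / c) `^ b^-1 by rewrite powR_gt0// divr_gt0.
  apply/nbhs_ballP; exists ((e / c) `^ b^-1) => // y; rewrite /ball /= => yx.
  rewrite (le_trans (hv' _ _))//.
  have h : `|x - y| `^ b <= e / c.
    rewrite (le_trans (pow_le (normr_ge0 _) (ltW yx)))// -powRrM mulVf ?gt_eqF//.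
    by rewrite powRr1// divr_ge0 ?ltW.
  apply: (@le_trans _ _ (c * (e / c))); last by rewrite mulrCA divff ?mulr1// gt_eqF.
  by apply: ler_pM => //; [exact: mulr_ge0|rewrite lerDl].
by move=> x xM; rewrite clampE ?vo//; lra.
Qed.

Lemma holder_extension (g : R -> C) : holder_on_segment M b g ->
  exists2 G : R -> C, everywhere_cont G & forall x, - M < x < M -> G x = g x.
Proof.
move=> [L hL].
(* The given constant carries no sign, so it is replaced by its absolute value. *)
have L' x y : - M < x < M -> - M < y < M -> normc (g x - g y) <= `|L| * `|x - y| `^ b.
  by move=> xM yM; rewrite (le_trans (hL _ _ xM yM))// ler_wpM2r ?powR_ge0// ler_norm.
have [x y xM yM|U cU eU] := @real_extension (fun x => complex.Re (g x)) _ (normr_ge0 L).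
  by rewrite -cReB (le_trans (Re_le_normc _))// L'.
have [x y xM yM|V cV eV] := @real_extension (fun x => complex.Im (g x)) _ (normr_ge0 L).
  by rewrite -cImB (le_trans (Im_le_normc _))// L'.
exists (fun x => U x +i* V x); first by move=> x; split; [exact: cU|exact: cV].
by move=> x xM; apply: complexP; rewrite /= ?eU ?eV.
Qed.

End HolderExtension.

(** * Continuity in the modulus topology *)

Section ModulusTopology.
Variable R : realType.
Local Notation C := R[i].

Let ltc_real (e : C) : 0 < e -> exists2 r : R, 0 < r & e = r%:C.
Proof.
by case: e => a c; rewrite ltcE/= => /andP[/eqP e a0]; exists a => //; rewrite e.
Qed.

Lemma ccontinuous_modulus (f : R -> C) : everywhere_cont f ->
  continuous (f : R -> R[i]^o).
Proof.
move=> cf x; apply/cvgrPdist_le => e /ltc_real[r r0 ->].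
have [d d0 hd] := (ccontinuous_eps f x).1 (cf x) r r0.
apply/nbhs_ballP; exists d => // y; rewrite /ball /= distrC => /hd h.
rewrite /Num.norm /= lecR (le_trans (normc_le_norm1 _))//.
by rewrite norm1C.
Qed.

Lemma modulus_ccontinuous (M : R) (f : R -> C) : 0 < M ->
  {within `[- M, M], continuous (f : R -> R[i]^o)} ->
  everywhere_cont (fun x => f (clamp M x)).
Proof.
move=> M0 /subspace_continuousP cf x; apply/ccontinuous_eps => e e0.
have Xc : `[- M, M]%classic (clamp M x) by rewrite /= in_itv/= clamp_in.
have e2 : 0 < (e / 2)%:C by rewrite ltcR divr_gt0.
have /cvgrPdist_le/(_ _ e2) := cf _ Xc.
rewrite near_withinE => /nbhs_ballP[d d0 hd]; exists d => // y yx.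
have /hd : ball (clamp M x) d (clamp M y).
  by rewrite /ball /= (le_lt_trans (clamp_contract M0 _ _))// distrC.
rewrite /= in_itv/= clamp_in// => /(_ isT).
rewrite /Num.norm /= lecR => h.
rewrite norm1C /norm1; have := Re_le_normc (f (clamp M x) - f (clamp M y)).
have := Im_le_normc (f (clamp M x) - f (clamp M y)); lra.
Qed.

End ModulusTopology.

(** * Mapping properties of the layer operator *)

Section LayerOperator.
Variable R : realType.
Local Notation C := R[i].
Local Notation TR := (measurableTypeR R).
Local Notation mu := (@lebesgue_measure R).
Variables (k : C) (M : R).
Hypothesis M0 : 0 < M.
Local Notation X := (`[- M, M]%classic : set TR).

Let mX : measurable X. Proof. exact: measurable_itv. Qed.

Let inX (x : R) : - M <= x <= M -> X x. Proof. by rewrite /= in_itv. Qed.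

Definition layer (phi : R -> C) (x : R) : C := cint mu X (fun y => phi y * hank k `|x - y|).

Lemma eq_layer phi psi x : (forall y, - M <= y <= M -> phi y = psi y) ->
  layer phi x = layer psi x.
Proof. by move=> h; apply: eq_cint => y; rewrite inE/= in_itv/= => /h ->. Qed.

Let layer_integrable phi x : admissible M phi -> - M <= x <= M ->
  cintegrable mu X (fun y => phi y * hank k `|x - y|).
Proof.
move=> [mphi [G bG]] xM.
have b y : X y -> norm1 (phi y) <= G by rewrite /= in_itv/=; exact: bG.
exact: (cintegrable_hank k M0 mphi b (inX xM)).
Qed.

Lemma layer_linear (c : C) phi psi x : admissible M phi -> admissible M psi ->
  - M <= x <= M -> layer (fun y => phi y + c * psi y) x = layer phi x + c * layer psi x.
Proof.
move=> a1 a2 xM; have i1 := layer_integrable a1 xM; have i2 := layer_integrable a2 xM.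
have e := cintD mX i1 (cintegrableZ c mX i2).
rewrite (cintZ c mX i2) in e; rewrite /layer -e.
by apply: eq_cint => y _; rewrite mulrDl mulrA.
Qed.

Let away (x y : R) : R := \1_(~` [set x]) y.

Let awayT x y : y <> x -> away x y = 1.
Proof. by move=> h; rewrite /away indicE mem_set. Qed.
Let awayF x : away x x = 0.
Proof. by rewrite /away indicE memNset//= => h; apply: h. Qed.
Let m_away x : measurable_fun X (away x).
Proof. by apply: measurable_indic; apply: measurableC. Qed.

(* The bound of the kernel fails at the singular points, which are cut out. *)
Let cint_away2 (f : TR -> C) x x' : cmeasurable X f ->
  cint mu X f = cint mu X (fun y => (away x y * away x' y)%:C * f y).
Proof.
move=> mf.
have m1 z : cmeasurable X (fun y => (away z y)%:C) by apply: cmeasurable_real; exact: m_away.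
have m2 : cmeasurable X (fun y => (away x' y)%:C * f y) by exact: cmeasurableM.
transitivity (cint mu X (fun y => (away x' y)%:C * f y)).
  by apply: (cint_point (x := x') mX m2) => y _ /awayT ->; rewrite mul1r.
have e : (fun y => (away x y * away x' y)%:C * f y) =
    (fun y => (away x y)%:C * ((away x' y)%:C * f y)).
  by apply/funext => y; rewrite rmorphM/= mulrA.
rewrite e; apply: (cint_point (x := x) mX (cmeasurableM (m1 x) m2)) => y _ /awayT ->.
by rewrite mul1r.
Qed.

(** The kernel estimates are integrated against sup |phi|, using that the integral of |x - y|^(-1/2)
    is at most W uniformly in x. One constant serves both conclusions: B W for the size, 2 A W for
    the variation. *)
Lemma layer_bounds : exists2 Lam : R, 0 <= Lam & forall phi G,
  admissible M phi -> sup_norm_le M phi G ->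
  sup_norm_le M (layer phi) (Lam * G) /\
  forall x y : R, - M <= x <= M -> - M <= y <= M ->
  norm1 (layer phi x - layer phi y) <= Lam * G * Num.sqrt `|x - y|.
Proof.
have L0 : 0 < 2 * M by rewrite mulr_gt0.
have [A A0 hA] := sqrt_holder_hank k L0.
have [B B0 hB] := sqrt_holder_bound (sqrt_holder_hank k L0).
pose W : R := 8 * Num.sqrt (3 * M).
have W0 : 0 <= W by rewrite mulr_ge0// sqrtr_ge0.
exists (B * W + A * (W + W)); first by rewrite addr_ge0// mulr_ge0// addr_ge0.
move=> phi G aphi bG.
have G0 : 0 <= G by apply: le_trans (norm1_ge0 _) (bG 0 _); rewrite oppr_le0 ltW//= ltW.
have dist x y : - M <= x <= M -> - M <= y <= M -> y <> x -> 0 < `|x - y| <= 2 * M.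
  move=> xM yM /eqP yx; rewrite normr_gt0 subr_eq0 eq_sym yx/= ler_norml; lra.
have iR x (xM : - M <= x <= M) := integrable_rsqrt_dist M0 xM.
have rR x (xM : - M <= x <= M) := Rintegral_rsqrt_dist M0 xM.
have mf x (xM : - M <= x <= M) := cintegrable_measurable (layer_integrable aphi xM).
split.
- move=> x xM; rewrite /layer (cint_away2 x x (mf x xM)).
  have iu := integrableZ_fin (G * B) mX (iR x xM).
  have mm : cmeasurable X (fun y => (away x y * away x y)%:C * (phi y * hank k `|x - y|)).
    apply: cmeasurableM (mf x xM); apply: cmeasurable_real.
    by apply: measurable_funM; exact: m_away.
  have le y : X y -> norm1 ((away x y * away x y)%:C * (phi y * hank k `|x - y|)) <=
      G * B * rsqrt `|x - y|.
    rewrite /= in_itv/= => yM; have r0 := rsqrt_ge0 `|x - y|.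
    have [->|/eqP yx] := eqVneq y x.
      by rewrite awayF mul0r mul0r norm1_0 !mulr_ge0// rsqrt_ge0.
    rewrite (awayT yx) mulr1 mul1r (le_trans (norm1M _ _))// -mulrA.
    by rewrite ler_pM ?norm1_ge0 ?bG// hB// dist.
  have ii := cintegrable_le mX mm iu le.
  apply: (le_trans (norm1_cint_le mX ii iu le)).
  rewrite (@RintegralZl _ _ _ mu _ _ _ mX (iR x xM)).
  have := rR x xM; rewrite -/W => h.
  have := ler_wpM2l (mulr_ge0 G0 B0) h; rewrite !mulrDl.
  have : 0 <= A * (W + W) * G by rewrite mulr_ge0// mulr_ge0// addr_ge0.
  by rewrite (mulrAC B) (mulrC B); lra.
- move=> x x' xM x'M; set s := Num.sqrt _.
  have s0 : 0 <= s by exact: sqrtr_ge0.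
  have e := cintB mX (layer_integrable aphi xM) (layer_integrable aphi x'M).
  rewrite /layer -e.
  have md := cmeasurableB (mf x xM) (mf x' x'M).
  rewrite (cint_away2 x x' md).
  have iu := integrableZ_fin (G * A * s) mX (integrableD_fin mX (iR x xM) (iR x' x'M)).
  have mm : cmeasurable X (fun y => (away x y * away x' y)%:C *
      (phi y * hank k `|x - y| - phi y * hank k `|x' - y|)).
    apply: cmeasurableM md; apply: cmeasurable_real.
    by apply: measurable_funM; exact: m_away.
  have le y : X y -> norm1 ((away x y * away x' y)%:C *
      (phi y * hank k `|x - y| - phi y * hank k `|x' - y|)) <=
      G * A * s * (rsqrt `|x - y| + rsqrt `|x' - y|).
    rewrite /= in_itv/= => yM.
    have r0 : 0 <= rsqrt `|x - y| + rsqrt `|x' - y| by rewrite addr_ge0// rsqrt_ge0.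
    have z0 : 0 <= G * A * s * (rsqrt `|x - y| + rsqrt `|x' - y|) by rewrite !mulr_ge0.
    have [yx|/eqP yx] := eqVneq y x; first
      by rewrite (_ : away x y = 0) ?mul0r ?norm1_0// yx awayF.
    have [yx'|/eqP yx'] := eqVneq y x'; first
      by rewrite (_ : away x' y = 0) ?mulr0 ?mul0r ?norm1_0// yx' awayF.
    rewrite (awayT yx) (awayT yx') mulr1 mul1r -mulrBr (le_trans (norm1M _ _))//.
    rewrite -!mulrA ler_pM ?norm1_ge0 ?bG//.
    rewrite (le_trans (hA _ _ (dist _ _ xM yM yx) (dist _ _ x'M yM yx')))//.
    rewrite ler_wpM2l// ler_wpM2r// /s ler_wsqrtr//.
    by rewrite (le_trans (ler_dist_dist _ _))// opprB addrA subrK.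
  have ii := cintegrable_le mX mm iu le.
  apply: (le_trans (norm1_cint_le mX ii iu le)).
  rewrite (@RintegralZl _ _ _ mu _ _ _ mX (integrableD_fin mX (iR x xM) (iR x' x'M))).
  rewrite (@RintegralD _ _ _ mu _ _ _ mX (iR x xM) (iR x' x'M)).
  have h := lerD (rR x xM) (rR x' x'M); rewrite -/W in h.
  have GAs : 0 <= G * A * s by rewrite !mulr_ge0.
  apply: (le_trans (ler_wpM2l GAs h)).
  have : 0 <= B * W * G * s by rewrite !mulr_ge0.
  by rewrite !mulrDl; lra.
Qed.

(* [single_layer] is defined through [hankel1_0], whose value at [0] is
   meaningless. *)
Lemma single_layerE (sigma phi : R -> C) x : admissible M phi ->
  (forall y, - M <= y <= M -> sigma y = phi y) -> 0 < complex.Re k -> - M <= x <= M ->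
  single_layer k M sigma (x, 0) = 'i%C / 4 * (2 / pi)%:C * layer phi x.
Proof.
move=> aphi e k0 xM; have ii := layer_integrable aphi xM.
rewrite /layer -(cintZ _ mX ii).
have mi := cintegrable_measurable (cintegrableZ ('i%C / 4 * (2 / pi)%:C) mX ii).
apply: (cint_point (x := x) mX mi) => y; rewrite /= in_itv/= => yM yx.
have -> : dist2 (x, 0) (y, 0) = `|x - y|.
  by rewrite /dist2 /= subrr expr0n addr0 sqrtr_sqr.
have r0 : 0 < `|x - y| by rewrite normr_gt0 subr_eq0 eq_sym; apply/eqP.
rewrite (hankelE k0 r0) (e y yM).
by move: ('i%C / 4) ((2 / pi)%:C : C) (hank _ _) (phi y) => u v w z; ring.
Qed.

End LayerOperator.

(** * The integral equation *)

Section SecondKindEquation.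
Variable R : realType.
Local Notation C := R[i].
Variables (k alpha : C) (M : R).
Hypothesis k0 : 0 < complex.Re k.
Hypothesis k1 : 0 <= complex.Im k.
Hypothesis a0 : 0 <= complex.Re alpha.
Hypothesis M0 : 0 < M.

Lemma continuous_admissible (f : R -> C) : everywhere_cont f -> admissible M f.
Proof.
move=> cf; split; first by apply: ccontinuous_cmeasurable => // x _; exact: cf.
by have [B _ hB] := ccontinuous_bounded (fun x (_ : - M <= x <= M) => cf x); exists B.
Qed.

(** Multiplying the equation by - 2 brings it to the second-kind form sigma = c (layer sigma) - 2 g;
    i / 4 and 2 / pi normalise the kernel. *)
Let c : C := 2 * ('i%C * k * alpha * ('i%C / 4 * (2 / pi)%:C)).

Let cE : c = - (k * alpha * (pi^-1)%:C).
Proof.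
have p0 : pi != 0 :> R by rewrite gt_eqF// pi_gt0.
have h : 2 * (4^-1 * (2 / pi)%:C) = (pi^-1)%:C :> C.
  rewrite (natrC_inv R 4) -(rmorph_nat (real_complex R) 2) -!rmorphM/=; congr (_%:C).
  by move: (pi : R) p0 => p p0; field.
have -> : c = 'i%C ^+ 2 * (k * alpha * (2 * (4^-1 * (2 / pi)%:C))) by rewrite /c; ring.
by rewrite h sqr_i mulN1r.
Qed.

(** Clamping the evaluation point makes the image continuous on the whole line, also when phi is
    only admissible. *)
Definition layer_clamped (phi : R -> C) (x : R) : C := c * layer k M phi (clamp M x).

Let linL : linear_on_adm M layer_clamped.
Proof.
move=> d phi psi a1 a2 x xM; rewrite /layer_clamped clampE// layer_linear//.
by rewrite mulrDr mulrCA.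
Qed.

Let boundsL : exists2 Lam : R, 0 <= Lam & forall phi G,
  admissible M phi -> sup_norm_le M phi G ->
  sup_norm_le M (layer_clamped phi) (Lam * G) /\
  forall x y : R,
  norm1 (layer_clamped phi x - layer_clamped phi y) <= Lam * G * Num.sqrt `|x - y|.
Proof.
have [A A0 hA] := layer_bounds k M0.
have c0 := norm1_ge0 c.
exists (norm1 c * A); first exact: mulr_ge0.
move=> phi G aphi bG; have [h1 h2] := hA phi G aphi bG.
have G0 : 0 <= G by apply: le_trans (norm1_ge0 _) (bG 0 _); rewrite oppr_le0 ltW//= ltW.
split => [x xM|x y].
  rewrite (le_trans (norm1M _ _))// -mulrA ler_wpM2l// clampE//; exact: h1.
rewrite -mulrBr (le_trans (norm1M _ _))// -!mulrA ler_wpM2l//.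
rewrite (le_trans (h2 _ _ (clamp_in M0 x) (clamp_in M0 y)))// -mulrA.
by rewrite ler_wpM2l// ler_wpM2l// ler_wsqrtr// clamp_contract.
Qed.

Lemma layer_clamped_cont phi : admissible M phi -> everywhere_cont (layer_clamped phi).
Proof.
move=> aphi x; have [_ [G bG]] := aphi; have [A A0 hA] := boundsL.
have [_ h] := hA phi G aphi bG.
have G0 : 0 <= G by apply: le_trans (norm1_ge0 _) (bG 0 _); rewrite oppr_le0 ltW//= ltW.
have AG0 : 0 <= A * G by exact: mulr_ge0.
apply/ccontinuous_eps => e e0.
have p0 : 0 < A * G + 1 by rewrite ltr_wpDl.
(* Squared because of the Hoelder exponent 1/2; the summand 1 avoids a vanishing denominator. *)
exists ((e / (A * G + 1)) ^+ 2); first by rewrite exprn_gt0// divr_gt0.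
move=> y yx; rewrite (le_trans (h _ _))//.
have s : Num.sqrt `|y - x| <= e / (A * G + 1).
  have q0 : 0 < e / (A * G + 1) by rewrite divr_gt0.
  by rewrite -(gtr0_norm q0) -(sqrtr_sqr (e / _)) ler_wsqrtr// ltW.
apply: (@le_trans _ _ ((A * G + 1) * (e / (A * G + 1)))).
  by apply: ler_pM => //; rewrite lerDl.
by rewrite mulrCA divff ?mulr1// gt_eqF.
Qed.

Let eq_layer_clamped phi psi x : (forall y, - M <= y <= M -> phi y = psi y) ->
  layer_clamped phi x = layer_clamped psi x.
Proof. by move=> h; rewrite /layer_clamped (eq_layer k _ h). Qed.

Let Re_inv_ge0 : 0 <= complex.Re alpha^-1.
Proof.
have [->|an] := eqVneq alpha 0; first by rewrite invr0.
move: (alpha^-1) (mulfV an) a0 => [u v]; case: (alpha) => a b /= /eqP.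
rewrite eq_complex /= => /andP[/eqP e1 /eqP e2] a0'.
(* With alpha^-1 = u + i v, this is Re (1 / alpha) = Re alpha times |1 / alpha|^2. *)
have -> : u = a * (u ^+ 2 + v ^+ 2).
  have -> : a * (u ^+ 2 + v ^+ 2) = u * (a * u - b * v) + v * (a * v + b * u) by ring.
  by rewrite e1 e2 mulr0 mulr1 addr0.
by rewrite mulr_ge0// addr_ge0// sqr_ge0.
Qed.

(** A null vector agrees on the segment with its own image, which is continuous, so [hank_unique]
    applies to the image. For alpha = 0 the operator is zero. *)
Lemma layer_clamped_inj phi : admissible M phi ->
  (forall x, - M <= x <= M -> phi x = layer_clamped phi x) ->
  forall x, - M <= x <= M -> phi x = 0.
Proof.
move=> aphi e x xM; rewrite e//.
have ct := layer_clamped_cont aphi; set tau := layer_clamped phi in ct *.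
have tE y : tau y = layer_clamped tau y by exact: eq_layer_clamped.
have [al0|an] := eqVneq alpha 0.
  by rewrite /tau /layer_clamped cE al0 mulr0 mul0r oppr0 mul0r.
(* Since c = - k alpha / pi, the equation tau = c (layer tau) reads k (layer tau) = - (pi / alpha)
   tau. *)
pose beta : C := alpha^-1 * pi%:C.
have b0 : 0 <= complex.Re beta.
  by rewrite cReM /= mulr0 subr0 mulr_ge0// pi_ge0.
have p0 : (pi : R)%:C != 0 :> C by rewrite eq_complex/= eqxx andbT gt_eqF// pi_gt0.
have H y : - M <= y <= M ->
    k * cint lebesgue_measure `[- M, M] (fun z => tau z * hank k `|y - z|) = - (beta * tau y).
  move=> yM; rewrite -/(layer k M tau y) [in RHS]tE /layer_clamped clampE// cE.
  rewrite mulNr mulrN opprK /beta mulrA.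
  have -> : alpha^-1 * pi%:C * (k * alpha * (pi^-1)%:C) = k * (alpha^-1 * alpha) * (pi%:C * (pi^-1)%:C).
    by move: ((pi : R)%:C : C) ((pi^-1)%:C : C) (alpha^-1) => u v w; ring.
  by rewrite mulVf// -rmorphM/= divff ?mulr1// gt_eqF// pi_gt0.
have z := hank_unique k0 k1 M0 ct b0 H.
have MM : - M < M by rewrite gtrN.
by apply: (eq_closed_itv MM (f := tau) (g := fun=> 0) _ _ z xM) => y _;
  [exact: ct|exact: ccontinuous_cst].
Qed.

Lemma second_kind_solution (G : R -> C) : everywhere_cont G ->
  exists2 sigma : R -> C, everywhere_cont sigma & forall x, - M <= x <= M ->
    sigma x = layer_clamped sigma x + -2 * G x.
Proof.
move=> cG; have [A A0 hA] := boundsL.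
have c2 : everywhere_cont (fun x => -2 * G x).
  by move=> x; exact: ccontinuousM (ccontinuous_cst (-2) x) (cG x).
have [phi aphi e] := fredholm M0 linL
  (fun f af => (continuous_admissible (layer_clamped_cont af)).1) A0
  (fun f G' af bf => (hA f G' af bf).1)
  (fun f G' af bf x y _ _ => (hA f G' af bf).2 x y)
  layer_clamped_inj (continuous_admissible c2).
(* The Fredholm solution is only bounded and measurable; the right-hand side of its equation is a
   continuous function with the same values on the segment. *)
exists (fun x => layer_clamped phi x + -2 * G x).
  by move=> x; exact: ccontinuousD (layer_clamped_cont aphi x) (c2 x).
move=> x xM; congr (_ + _); apply: eq_layer_clamped => y yM.
exact: e.
Qed.

Lemma second_kind_unique (G sigma tau : R -> C) :
  everywhere_cont sigma -> everywhere_cont tau ->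
  (forall x, - M <= x <= M -> sigma x = layer_clamped sigma x + -2 * G x) ->
  (forall x, - M <= x <= M -> tau x = layer_clamped tau x + -2 * G x) ->
  forall x, - M <= x <= M -> tau x = sigma x.
Proof.
move=> cs ct hs ht x xM; apply/eqP; rewrite -subr_eq0; apply/eqP.
have asig := continuous_admissible cs; have atau := continuous_admissible ct.
rewrite -mulN1r; apply: (layer_clamped_inj (admissibleD (-1) atau asig)) => // y yM.
rewrite linL// hs// ht//.
by ring.
Qed.

Lemma equationE (G g sigma tau : R -> C) x : everywhere_cont tau ->
  (forall y, - M <= y <= M -> sigma y = tau y) -> (G x = g x) -> - M < x < M ->
  - (1 / 2) * sigma x + 'i%C * k * alpha * single_layer k M sigma (x, 0) = g x <->
  tau x = layer_clamped tau x + -2 * G x.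
Proof.
move=> ct e eG /andP[x1 x2]; have xM : - M <= x <= M by rewrite !ltW.
rewrite (single_layerE M0 (continuous_admissible ct) e k0 xM) e// eG.
rewrite /layer_clamped clampE// /c.
move: (layer _ _ _ _) (tau x) (g x) ((2 / pi)%:C : C) => T t h p.
have half : 2 * (1 / 2) = 1 :> C by rewrite mul1r divff// pnatr_eq0.
set d := 'i%C * k * alpha * ('i%C / 4 * p).
have -> : 'i%C * k * alpha * ('i%C / 4 * p * T) = d * T by rewrite /d; ring.
split => [<-|E].
- rewrite (_ : _ + _ = (2 * (1 / 2)) * t); last by ring.
  by rewrite half mul1r.
- rewrite E; transitivity ((2 * (1 / 2)) * h + (1 - 2 * (1 / 2)) * (d * T)); first by ring.
  by rewrite half mul1r subrr mul0r addr0.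
Qed.

End SecondKindEquation.

Theorem theorem5p1 (R : realType) (k alpha : R[i]) (M0 beta : R)
    (g : R -> R[i])
    (hkRe : 0 < complex.Re k) (hkIm : 0 <= complex.Im k)
    (halpha : 0 <= complex.Re alpha) (hM0 : 0 < M0)
    (hbeta : 0 < beta) (hg : holder_on_segment M0 beta g) :
  exists sigma : R -> R[i],
    continuous_solution k alpha M0 g sigma /\
    forall tau : R -> R[i], continuous_solution k alpha M0 g tau ->
      forall x : R, - M0 <= x <= M0 -> tau x = sigma x.
Proof.
have [G cG eG] := holder_extension hM0 hbeta hg.
have [sigma cs hs] := second_kind_solution hkRe hkIm halpha hM0 cG.
exists sigma; split.
  split; first by apply: continuous_subspaceT; exact: ccontinuous_modulus.
  move=> x xM; apply/(equationE alpha hkRe hM0 cs (fun=> fun=> erefl) (eG x xM) xM).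
  by apply: hs; case/andP: xM => x1 x2; rewrite !ltW.
move=> tau [ctau htau] x xM.
(* A competitor is continuous on the segment only, so it is replaced by its clamped extension. *)
have ct := modulus_ccontinuous hM0 ctau; set t := fun x => tau (clamp M0 x) in ct.
have te y : - M0 <= y <= M0 -> tau y = t y by move=> yM; rewrite /t clampE.
rewrite te//; apply: (second_kind_unique hkRe hkIm halpha hM0 cs ct hs _ xM).
have MM : - M0 < M0 by rewrite gtrN.
have ht y : - M0 < y < M0 -> t y = layer_clamped k alpha M0 t y + -2 * G y.
  by move=> yM; apply/(equationE alpha hkRe hM0 ct te (eG y yM) yM); exact: htau.
(* The equation is given on the open segment and reaches the endpoints by continuity of both
   sides. *)
apply: (eq_closed_itv MM) ht => y _; first exact: ct.
have aL := layer_clamped_cont k alpha hM0 (continuous_admissible M0 ct).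
exact: ccontinuousD (aL y) (ccontinuousM (ccontinuous_cst (-2) y) (cG y)).
Qed.
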